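(* Let $\mathcal{M}$ be a Riemannian manifold, let $p \geq 2$ be an integer, and let $f \colon \mathcal{M} \to \mathbb{R}$ be of class $\mathrm{C}^p$. Let $\bar x$ be a local minimum of $f$ and let $\mathcal{S} = \{x \in \mathcal{M} : x \text{ is a local minimum of } f \text{ and } f(x) = f(\bar x)\}$. Suppose $f$ satisfies the Polyak–Łojasiewicz condition around $\bar x$: there exist $\mu > 0$ and a neighborhood of $\bar x$ such that $f(x) - f(\bar x) \leq \frac{1}{2\mu}\|\nabla f(x)\|^2$ for all $x$ in that neighborhood. Then $\mathcal{S}$ is a $\mathrm{C}^{p-1}$ submanifold of $\mathcal{M}$ locally around $\bar x$. If $f$ is (real) analytic, then $\mathcal{S}$ is also analytic (locally around $\bar x$).
   Context: $\mathcal{M}$ is a smooth finite-dimensional Riemannian manifold (for the analytic statement, $\mathcal{M}$ is a real-analytic manifold, so that analyticity of $f$ makes sense); $\nabla f$ is the Riemannian gradient and $\|\cdot\|$ the Riemannian norm on tangent spaces. ''Submanifold'' always means embedded submanifold; ''$\mathcal{S}$ is a submanifold locally around $\bar x$'' means that $\mathcal{S} \cap \mathcal{U}$ is an embedded submanifold for some neighborhood $\mathcal{U}$ of $\bar x$. *)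

(* Defs.v *)
From HB Require Import structures.
From mathcomp Require Import all_boot all_order all_algebra.
From mathcomp Require Import all_classical all_reals all_analysis.

Set Implicit Arguments.
Unset Strict Implicit.
Unset Printing Implicit Defensive.

Import Order.TTheory GRing.Theory Num.Theory.
Import numFieldNormedType.Exports.

Local Open Scope classical_set_scope.
Local Open Scope ring_scope.

(* [Cr k] is C^k for a finite k, [Cinfty] is C^infinity, [Comega] is real
   analytic. *)
Inductive regularity := Cr of nat | Cinfty | Comega.

(* Intended for [U] open.  In finite dimension, x |-> 'd f x is C^k on U iff
   x |-> 'd f x v = 'D_v f x is C^k on U for every fixed v. *)
Fixpoint Ck_on (R : realType) (V W : normedModType R) (k : nat)
    (U : set V) (f : V -> W) : Prop :=
  if k is k'.+1 then
    (forall x, U x -> differentiable f x) /\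
    (forall v : V, Ck_on k' U (fun x => 'D_v f x))
  else forall x, U x -> {for x, continuous f}.

Definition monomial (R : realType) (n : nat)
    (h : 'rV[R]_n) (alpha : {ffun 'I_n -> nat}) : R :=
  \prod_(i < n) h ord0 i ^+ alpha i.

(* The multi-indices with all entries < N. *)
Definition box_index (n N : nat) (alpha : {ffun 'I_n -> 'I_N}) :
    {ffun 'I_n -> nat} := [ffun i => val (alpha i)].

(* Near [a], [f] is the sum of an absolutely convergent power series in n
   variables; absolute convergence makes the order of summation (here, over
   growing boxes of multi-indices) immaterial. *)
Definition analytic_at (R : realType) (n : nat) (W : normedModType R)
    (f : 'rV[R]_n -> W) (a : 'rV[R]_n) : Prop :=
  exists c : {ffun 'I_n -> nat} -> W,
    \forall x \near a,
      (exists B : R, forall N : nat,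
         \sum_(alpha : {ffun 'I_n -> 'I_N})
           `|monomial (x - a) (box_index alpha) *: c (box_index alpha)| <= B) /\
      (fun N : nat => \sum_(alpha : {ffun 'I_n -> 'I_N})
         monomial (x - a) (box_index alpha) *: c (box_index alpha))
        @ \oo --> f x.

Definition of_class (R : realType) (n : nat) (W : normedModType R)
    (r : regularity) (U : set 'rV[R]_n) (f : 'rV[R]_n -> W) : Prop :=
  match r with
  | Cr k => Ck_on k U f
  | Cinfty => forall k, Ck_on k U f
  | Comega => forall a, U a -> analytic_at f a
  end.

(* A homeomorphism from an open subset [cdom] of [M] onto an open subset of
   R^n; [cmap] and [cinv] are irrelevant outside these subsets. *)
Record chart (R : realType) (n : nat) (M : topologicalType) := Chart {
  cdom : set M;
  cmap :> M -> 'rV[R]_n;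
  cinv : 'rV[R]_n -> M;
  chart_open_dom : open cdom;
  chart_open_cod : open (cmap @` cdom);
  chart_cancel : forall x, cdom x -> cinv (cmap x) = x;
  chart_continuous : forall x, cdom x -> {for x, continuous cmap};
  chart_inv_continuous :
    forall y, (cmap @` cdom) y -> {for y, continuous cinv}
}.

Definition ccod (R : realType) (n : nat) (M : topologicalType)
    (c : chart R n M) : set 'rV[R]_n := c @` cdom c.

Definition compatible (R : realType) (n : nat) (M : topologicalType)
    (r : regularity) (a b : chart R n M) : Prop :=
  of_class r (a @` (cdom a `&` cdom b)) (b \o cinv a) /\
  of_class r (b @` (cdom a `&` cdom b)) (a \o cinv b).

(* The atlas is not required to be maximal.  [chart_at x] is a preferred chart
   around [x], used to represent tangent vectors at [x]. *)
Record smoothManifold (R : realType) (n : nat) := SmoothManifold {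
  carrier :> topologicalType;
  manifold_hausdorff : hausdorff_space carrier;
  manifold_second_countable : @second_countable carrier;
  atlas : set (chart R n carrier);
  chart_at : carrier -> chart R n carrier;
  chart_at_atlas : forall x, atlas (chart_at x);
  chart_at_dom : forall x, cdom (chart_at x) x;
  atlas_compatible :
    forall a b, atlas a -> atlas b -> compatible Cinfty a b
}.

Arguments atlas {R n} M _ : rename.

(* [M], with the given atlas, is a real-analytic manifold. *)
Definition analytic_manifold (R : realType) (n : nat)
    (M : smoothManifold R n) : Prop :=
  forall a b, atlas M a -> atlas M b -> compatible Comega a b.

(* Meaningful for [r = Comega] when [M] is an analytic manifold. *)
Definition function_of_class (R : realType) (n : nat)
    (M : smoothManifold R n) (r : regularity) (f : M -> R) : Prop :=
  forall c, atlas M c -> of_class r (ccod c) (f \o cinv c).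

(* A tangent vector at [x] is represented by its coordinates in [chart_at x]. *)
Definition tangent (R : realType) (n : nat) (M : smoothManifold R n)
    (x : M) : Type := 'rV[R]_n.

Definition differential (R : realType) (n : nat) (M : smoothManifold R n)
    (f : M -> R) (x : M) (v : tangent x) : R :=
  'd (f \o cinv (chart_at x)) (chart_at x x) v.

(* The tangent vector at [x] whose coordinates in the chart [c] are [u]. *)
Definition of_coord (R : realType) (n : nat) (M : smoothManifold R n)
    (c : chart R n M) (x : M) (u : 'rV[R]_n) : tangent x :=
  'd (chart_at x \o cinv c) (c x) u.

Definition gram_inner (R : realType) (n : nat) (G : 'M[R]_n)
    (u v : 'rV[R]_n) : R := (u *m G *m v^T) ord0 ord0.

(* [gram x] is the Gram matrix of the inner product on the tangent space at
   [x]; smoothness is smoothness of the coefficients g_ij in every chart. *)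
Record riemannianMetric (R : realType) (n : nat)
    (M : smoothManifold R n) := RiemannianMetric {
  gram : M -> 'M[R]_n;
  gram_sym : forall x, (gram x)^T = gram x;
  gram_posdef : forall x (v : tangent x), v != 0 -> 0 < gram_inner (gram x) v v;
  gram_smooth : forall c, atlas M c ->
    of_class Cinfty (ccod c) (fun y : 'rV[R]_n =>
      \matrix_(i < n, j < n)
        gram_inner (gram (cinv c y))
          (of_coord c (cinv c y) (delta_mx 0 i))
          (of_coord c (cinv c y) (delta_mx 0 j)))
}.

Definition inner (R : realType) (n : nat) (M : smoothManifold R n)
    (g : riemannianMetric M) (x : M) (u v : tangent x) : R :=
  gram_inner (gram g x) u v.

Definition tnorm (R : realType) (n : nat) (M : smoothManifold R n)
    (g : riemannianMetric M) (x : M) (v : tangent x) : R :=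
  Num.sqrt (inner g v v).

(* See [gradientP] and [gradient_unique] below. *)
Definition gradient (R : realType) (n : nat) (M : smoothManifold R n)
    (g : riemannianMetric M) (f : M -> R) (x : M) : tangent x :=
  get [set w : 'rV[R]_n |
        forall v : tangent x, inner g (w : tangent x) v = differential f v].

Definition local_min (R : realType) (M : topologicalType) (f : M -> R)
    (x : M) : Prop := \forall y \near x, f x <= f y.

Definition local_minima_at_level (R : realType) (M : topologicalType)
    (f : M -> R) (xbar : M) : set M :=
  [set x | local_min f x /\ f x = f xbar].

Definition PL_around (R : realType) (n : nat) (M : smoothManifold R n)
    (g : riemannianMetric M) (f : M -> R) (xbar : M) : Prop :=
  exists2 mu : R, 0 < mu &
    \forall x \near xbar,
      f x - f xbar <= (2 * mu)^-1 * tnorm g (gradient g f x) ^+ 2.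

(* [T] is an embedded submanifold of [M] of class [r]: around each of its
   points there is a chart of the class-[r] structure of [M] (that is, one
   compatible in class [r] with the atlas) in which [T] is the slice
   R^d x {0}. *)
Definition embedded_submanifold (R : realType) (n : nat)
    (M : smoothManifold R n) (r : regularity) (T : set M) : Prop :=
  exists2 d : nat, (d <= n)%N &
    forall x, T x -> exists c : chart R n M,
      [/\ forall a, atlas M a -> compatible r a c,
          cdom c x &
          forall y, cdom c y ->
            (T y <-> forall i : 'I_n, (d <= i)%N -> c y ord0 i = 0)].

Definition submanifold_locally_around (R : realType) (n : nat)
    (M : smoothManifold R n) (r : regularity) (T : set M) (x : M) : Prop :=
  exists2 U : set M, nbhs x U & embedded_submanifold r (T `&` U).

Lemma gram_unit (R : realType) (n : nat) (M : smoothManifold R n)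
    (g : riemannianMetric M) (x : M) : gram g x \in unitmx.
Proof.
rewrite -row_free_unit -kermx_eq0; apply/eqP/row_matrixP => i.
rewrite row0; apply/eqP; apply/negPn/negP => /(@gram_posdef _ _ _ g x).
rewrite /gram_inner -row_mul mulmx_ker row0 mul0mx mxE ltxx //.
Qed.

Lemma gradientP (R : realType) (n : nat) (M : smoothManifold R n)
    (g : riemannianMetric M) (f : M -> R) (x : M) (v : tangent x) :
  inner g (gradient g f x) v = differential f v.
Proof.
rewrite /gradient; move: v.
set P := [set w | _]; suff : P (get P) by [].
set D : 'rV[R]_n := \row_j differential f (delta_mx 0 j : tangent x).
apply: (@getI _ P (D *m invmx (gram g x))) => v.
rewrite /inner /gram_inner mulmxKV ?gram_unit // mxE.
rewrite {2}(row_sum_delta v) /differential linear_sum /=.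
by apply: eq_bigr => j _; rewrite !mxE linearZ /= mulrC.
Qed.

Lemma gradient_unique (R : realType) (n : nat) (M : smoothManifold R n)
    (g : riemannianMetric M) (f : M -> R) (x : M) (w : tangent x) :
  (forall v : tangent x, inner g w v = differential f v) ->
  w = gradient g f x.
Proof.
move=> wP; pose e : 'rV[R]_n := w - gradient g f x.
suff : e = 0 by move/subr0_eq.
apply/eqP; apply/negPn/negP => /(@gram_posdef _ _ _ g x).
have -> : gram_inner (gram g x) e e
  = inner g w (e : tangent x) - inner g (gradient g f x) (e : tangent x).
  by rewrite /inner /gram_inner {1}/e !mulmxBl [LHS]mxE [X in _ + X = _]mxE.
by rewrite wP gradientP subrr ltxx.
Qed.

(* Main.v *)
(* In a chart F around x, with Hessian H of rank n - d at x, a linear change of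
   coordinates makes H block-diagonal with an invertible lower-right block.  The
   map Phi that keeps the first d coordinates and replaces the others by the
   matching partial derivatives of F (up to an invertible matrix) is then a
   local diffeomorphism, as smooth as grad F, and the set
   Z = {Phi_i = 0 for i >= d} contains the critical points near x.  Conversely,
   let G be F restricted to Z, in the first d coordinates: its gradient is that
   of F on Z, so that G still satisfies the PL inequality G - F(x) <= K |grad G|^2;
   but G has zero Hessian, so that grad G has an arbitrarily small Lipschitz
   constant L and one gradient step yields G - F(x) >= c |grad G|^2 / L.  For L
   small this forces grad G = 0 and G = F(x), that is, Z is the set S near x.

   In the analytic case, analyticity is traded for bounds
   |D_J f| <= C r^-|J| |J|! on all derivatives near a point.  If
   d_j E_i = G_ji o E then D_J (h o E) = (L_J h) o E for iterated Lie
   derivatives L_J, so these bounds for h and G imply them for h o E (each of the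
   |J| steps loses r / |J| of the radius, as in Nagumo's proof of the
   Cauchy-Kovalevskaya theorem).  Composition, reciprocal and local inverse are
   instances of this system. *)
From HB Require Import structures.
Require Import Defs.
From mathcomp Require Import all_boot all_order all_algebra.
From mathcomp Require Import all_classical all_reals all_analysis.
From mathcomp Require Import all_fingroup ring lra.
Set Implicit Arguments.
Unset Strict Implicit.
Unset Printing Implicit Defensive.
Import Order.TTheory GRing.Theory Num.Theory.
Import numFieldNormedType.Exports.
Local Open Scope classical_set_scope.
Local Open Scope ring_scope.

(** * Differentiation and C^k maps in coordinates *)

(** For [p = 2] the set Z is a priori only of class C^1, so the restriction of F to Z cannot be
    differentiated twice by the chain rule. The way out is that the tail of [grad F] vanishes on Z
    while the parametrization of Z leaves the head coordinates unchanged: the gradient of the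
    restriction is the head of [grad F] composed with the parametrization, and no derivative of the
    parametrization survives in it. A Lipschitz estimate for this composite replaces second
    derivatives. Block-diagonality of the Hessian comes from a rank factorization and symmetry
    alone, without eigenvalues. Phi is fixed before its regularity is examined, so that one chart
    serves both the C^(p-1) and the analytic statement.

    Power series appear only at the two ends of the analytic part. In between, derivatives are
    indexed by words of directions, for which the Leibniz and chain rules carry no multinomial
    coefficients. A composite or a reciprocal solves an autonomous system once the point itself is
    adjoined to the state, that is, once the map is replaced by its graph. *)

Local Notation partial i f := (fun x => 'D_(delta_mx 0 i) f x).

(** An epsilon criterion that yields differentiability and identifies the differential at once; it
    serves where a candidate derivative is known beforehand, as for an inverse map or a limit of
    functions. *)
Lemma differentiable_eps (R : realType) (V W : normedModType R) (f : V -> W)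
    (x : V) (L : {linear V -> W}) :
  continuous L ->
  (forall e : R, 0 < e -> \forall h \near (0 : V),
     `|f (h + x) - f x - L h| <= e * `|h|) ->
  differentiable f x /\ 'd f x = L :> (V -> W).
Proof.
move=> cL fL.
have E : f \o shift x = cst (f x) + L +o_ 0 id.
  apply/eqaddoP => e e0; have := fL e e0; apply: filterS => h /=.
  by rewrite /cst /= !fctE opprD addrA.
have dE := diff_unique cL E; split=> //.
by apply/diff_locallyP; rewrite dE.
Qed.

Lemma differentiable_epsE (R : realType) (V W : normedModType R) (f : V -> W)
    (x : V) :
  differentiable f x -> forall e : R, 0 < e -> \forall h \near (0 : V),
     `|f (h + x) - f x - 'd f x h| <= e * `|h|.
Proof.
move=> /diff_locally E e e0.
have /eqaddoP/(_ e e0) := E; apply: filterS => h /=.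
by rewrite !fctE opprD addrA.
Qed.

Lemma coord_le_norm (R : realType) (m n : nat) (x : 'M[R]_(m, n)) i j :
  `|x i j| <= `|x|.
Proof.
by rewrite [leRHS]/Num.norm/= mx_normrE (le_bigmax _ (fun ij => `|x ij.1 ij.2|) (i, j)).
Qed.

Lemma norm_le_coord (R : realType) (n : nat) (x : 'rV[R]_n) (e : R) :
  0 <= e -> (forall j, `|x 0 j| <= e) -> `|x| <= e.
Proof.
move=> e0 H; rewrite [leLHS]/Num.norm/= mx_normrE.
by apply: bigmax_le => // -[i j] _ /=; rewrite ord1.
Qed.

Lemma norm_lt_coord (R : realType) (n : nat) (x : 'rV[R]_n) (e : R) :
  0 < e -> (forall j, `|x 0 j| < e) -> `|x| < e.
Proof.
move=> e0 H; rewrite [ltLHS]/Num.norm/= mx_normrE.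
by apply: bigmax_lt => // -[i j] _ /=; rewrite ord1.
Qed.

Lemma differentiable_rowP (R : realType) (V : normedModType R) (m : nat)
    (f : V -> 'rV[R]_m) (x : V) :
  differentiable f x <-> forall j, differentiable (fun y => f y 0 j) x.
Proof.
split=> [df j|df].
  exact: (@differentiable_comp _ _ _ _ f (fun N : 'rV[R]_m => N 0 j) _ df
            (differentiable_coord _ _ _)).
have -> : f = \sum_(j < m) (fun y => f y 0 j *: delta_mx 0 j).
  by apply/funext => y; rewrite fct_sumE -row_sum_delta.
apply: differentiable_sum => j.
exact: differentiableZl.
Qed.

Lemma diff_row (R : realType) (V : normedModType R) (m : nat)
    (f : V -> 'rV[R]_m) (x : V) h j :
  differentiable f x -> ('d f x h) 0 j = 'd (fun y => f y 0 j) x h.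
Proof.
move=> df.
have @c : {linear 'rV[R]_m -> R}.
  by exists (fun N : 'rV[R]_m => N 0 j); do 2![eexists]; do ?[constructor];
     rewrite ?mxE// => ? *; rewrite ?mxE//; move=> ?; rewrite !mxE.
have cc : continuous c by exact: coord_continuous.
have -> : (fun y => f y 0 j) = c \o f by [].
rewrite (@diff_comp _ _ _ _ f c x df (linear_differentiable (f x) cc)).
exact: (esym (congr1 (fun k : _ -> _ => k ('d f x h)) (diff_lin (f x) cc))).
Qed.

Lemma derive_row (R : realType) (V : normedModType R) (m : nat)
    (f : V -> 'rV[R]_m) (x : V) h j :
  differentiable f x -> ('D_h f x) 0 j = 'D_h (fun y => f y 0 j) x.
Proof.
move=> df; rewrite !deriveE ?diff_row //.
by move/differentiable_rowP : df.
Qed.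

Lemma derive_partial (R : realType) (n : nat) (W : normedModType R)
    (f : 'rV[R]_n -> W) (x v : 'rV[R]_n) :
  differentiable f x -> 'D_v f x = \sum_(i < n) v 0 i *: partial i f x.
Proof.
move=> df; rewrite deriveE // [X in 'd f x X](row_sum_delta v) linear_sum.
by apply: eq_bigr => i _; rewrite linearZ /= deriveE.
Qed.

Lemma derive_comp_rV (R : realType) (V : normedModType R) (m : nat)
    (W : normedModType R)
    (E : V -> 'rV[R]_m) (f : 'rV[R]_m -> W) (x v : V) :
  differentiable E x -> differentiable f (E x) ->
  'D_v (f \o E) x = \sum_(i < m) 'D_v (fun y => E y 0 i) x *: partial i f (E x).
Proof.
move=> dE df; rewrite deriveE; last exact: differentiable_comp.
rewrite diff_comp //= -deriveE // derive_partial //.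
apply: eq_bigr => i _; congr (_ *: _).
by rewrite diff_row // -deriveE //; move/differentiable_rowP : dE.
Qed.

Lemma continuous_rowP (R : realType) (T : topologicalType) (m : nat)
    (f : T -> 'rV[R]_m) (x : T) :
  {for x, continuous f} <-> forall j, {for x, continuous (fun y => f y 0 j)}.
Proof.
split=> [cf j|cf].
  exact: (continuous_comp cf (@coord_continuous _ _ _ 0 j _)).
apply/cvgrPdist_lt => e e0.
have H : \forall y \near x, forall j, `|f x 0 j - f y 0 j| < e.
  by apply: filter_forall => j; have /cvgrPdist_lt/(_ e e0) := cf j.
apply: filterS H => y H; apply: norm_lt_coord => // j; by rewrite !mxE.
Qed.

Lemma Ck_continuous (R : realType) (V W : normedModType R) k (U : set V)
  (f : V -> W) x : Ck_on k U f -> U x -> {for x, continuous f}.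
Proof.
case: k => [|k] /=; first by apply.
by move=> [df _] Ux; apply/differentiable_continuous/df.
Qed.

Lemma near_eq_open (R : realType) (V : normedModType R) (T : Type) (U : set V)
    (f g : V -> T) x :
  open U -> (forall x, U x -> f x = g x) -> U x -> \forall y \near x, f y = g y.
Proof.
move=> oU fg Ux.
have : nbhs x U by exact: open_nbhs_nbhs.
by apply: filterS => y /fg.
Qed.

Lemma near_eq_continuous (V W : topologicalType)
    (f g : V -> W) x :
  (\forall y \near x, f y = g y) -> {for x, continuous f} -> {for x, continuous g}.
Proof.
move=> fg cf; rewrite /prop_for /continuous_at -(nbhs_singleton fg).
apply: cvg_trans cf; apply: near_eq_cvg.
by apply: filterS fg => y ->.
Qed.

Lemma near_eq_differentiable (R : realType) (V W : normedModType R)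
    (f g : V -> W) x :
  (\forall y \near x, f y = g y) -> differentiable f x -> differentiable g x.
Proof.
move=> fg df; have [//||//] := @differentiable_eps _ _ _ g x ('d f x).
  exact: diff_continuous.
move=> e e0; have Hf := differentiable_epsE df e0.
have Hg : \forall h \near (0 : V), f (h + x) = g (h + x).
  by move: fg; rewrite (near_shift 0) /=; apply: filterS => h; rewrite /= subr0 => ->.
near=> h; rewrite -(nbhs_singleton fg) -(near Hg h) //.
exact: (near Hf h).
Unshelve. all: by end_near. Qed.

Lemma near_eq_diff (R : realType) (V W : normedModType R)
    (f g : V -> W) x :
  (\forall y \near x, f y = g y) -> differentiable f x -> 'd f x = 'd g x :> (V -> W).
Proof.
move=> fg df; have dg := near_eq_differentiable fg df.
by apply/funext => v; rewrite -!deriveE //; apply: near_eq_derive.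
Qed.

Lemma Ck_eq (R : realType) (V W : normedModType R) k (U : set V)
  (f g : V -> W) : open U -> (forall x, U x -> f x = g x) ->
  Ck_on k U f -> Ck_on k U g.
Proof.
move=> oU; elim: k f g => [|k IH] f g fg /=.
  move=> cf x Ux; apply: near_eq_continuous (cf x Ux) => //.
  exact: (near_eq_open oU).
move=> [df Df]; split=> [x Ux|v].
  by apply: near_eq_differentiable (df x Ux); exact: (near_eq_open oU).
apply: IH (Df v) => x Ux; apply: near_eq_derive; exact: (near_eq_open oU).
Qed.

Lemma Ck_sub (R : realType) (V W : normedModType R) k (U U' : set V)
  (f : V -> W) : U' `<=` U -> Ck_on k U f -> Ck_on k U' f.
Proof.
move=> sU; elim: k f => [|k IH] f /=; first by move=> cf x /sU /cf.
by move=> [df Df]; split=> [x /sU/df //|v]; apply: IH.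
Qed.

Lemma Ck_le (R : realType) (V W : normedModType R) j k (U : set V)
  (f : V -> W) : (j <= k)%N -> Ck_on k U f -> Ck_on j U f.
Proof.
elim: j k f => [|j IH] k f; first by move=> _ H x Ux; exact: Ck_continuous H Ux.
by case: k => // k; rewrite ltnS => jk /= [df Df]; split=> // v; apply: IH jk _.
Qed.

Lemma Ck_cst (R : realType) (V W : normedModType R) k (U : set V) (w : W) :
  Ck_on k U (fun=> w).
Proof.
elim: k w => [|k IH] w /=; first by move=> x _; exact: cvg_cst.
split=> [x _|v]; first exact: differentiable_cst.
have -> : (fun x => 'D_v (fun=> w) x) = (fun=> 0) by apply/funext=> x; rewrite derive_cst.
exact: IH.
Qed.

Lemma Ck_add (R : realType) (V W : normedModType R) k (U : set V)
  (f g : V -> W) : open U ->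
  Ck_on k U f -> Ck_on k U g -> Ck_on k U (fun x => f x + g x).
Proof.
move=> oU; elim: k f g => [|k IH] f g /=.
  by move=> cf cg x Ux; apply: (@cvgD _ _ _ _ _ f g); [exact: cf|exact: cg].
move=> [df Df] [dg Dg]; split=> [x Ux|v].
  by apply: (@differentiableD _ _ _ f g); [exact: df|exact: dg].
apply: (Ck_eq oU _ (IH _ _ (Df v) (Dg v))) => x Ux; rewrite -deriveD //.
- by apply: diff_derivable; apply: df.
- by apply: diff_derivable; apply: dg.
Qed.

Lemma Ck_mul (R : realType) (V : normedModType R) k (U : set V)
  (f g : V -> R) : open U ->
  Ck_on k U f -> Ck_on k U g -> Ck_on k U (fun x => f x * g x).
Proof.
move=> oU; elim: k f g => [|k IH] f g.
  by move=> cf cg x Ux; apply: (@cvgM _ _ _ _ f g); [exact: cf|exact: cg].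
move=> hf hg; have [df Df] := hf; have [dg Dg] := hg; split=> [x Ux|v].
  by apply: (@differentiableM _ _ f g); [exact: df|exact: dg].
have hf' : Ck_on k U f by apply: Ck_le hf.
have hg' : Ck_on k U g by apply: Ck_le hg.
apply: (Ck_eq oU _ (Ck_add oU (IH _ _ hf' (Dg v)) (IH _ _ hg' (Df v)))) => x Ux.
by rewrite (@deriveM _ _ f g) //; apply: diff_derivable; [apply: df|apply: dg].
Qed.

Lemma Ck_sum (R : realType) (V W : normedModType R) (I : Type) (s : seq I)
    (P : pred I) k (U : set V) (f : I -> V -> W) : open U ->
  (forall i, P i -> Ck_on k U (f i)) ->
  Ck_on k U (fun x => \sum_(i <- s | P i) f i x).
Proof.
move=> oU H; elim: s => [|i s IH].
  by under [X in Ck_on _ _ X]eq_fun do rewrite big_nil; exact: Ck_cst.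
under [X in Ck_on _ _ X]eq_fun do rewrite big_cons.
by case: (boolP (P i)) => [/H Hi|_] //; apply: Ck_add.
Qed.

Lemma Ck_row (R : realType) (V : normedModType R) k (m : nat) (U : set V)
  (f : V -> 'rV[R]_m) : open U ->
  Ck_on k U f <-> forall j, Ck_on k U (fun x => f x 0 j).
Proof.
move=> oU; elim: k f => [|k IH] f /=.
  split=> [cf j x /cf/continuous_rowP//|H x Ux].
  by apply/continuous_rowP => j; apply: H.
split=> [[df Df] j|H].
  split=> [x /df/differentiable_rowP//|v].
  apply: (Ck_eq oU _ ((IH _).1 (Df v) j)) => x Ux.
  by rewrite derive_row //; exact: df.
have df x : U x -> differentiable f x.
  by move=> Ux; apply/differentiable_rowP => j; apply: (H j).1.
split=> // v; apply/IH => j.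
apply: (Ck_eq oU _ ((H j).2 v)) => x Ux.
by rewrite derive_row //; exact: df.
Qed.

Lemma Ck_coord (R : realType) (n : nat) k (U : set 'rV[R]_n) i :
  open U -> Ck_on k U (fun x : 'rV[R]_n => x 0 i).
Proof.
move=> oU; case: k => [|k] /=; first by move=> x _; exact: coord_continuous.
split=> [x _|v]; first exact: differentiable_coord.
apply: (Ck_eq oU _ (@Ck_cst _ _ _ k U (v 0 i))) => x Ux.
rewrite -(derive_row (f := id)) ?derive_id //.
Qed.

Lemma Ck_partialP (R : realType) (n : nat) k (U : set 'rV[R]_n)
  (f : 'rV[R]_n -> R) : open U -> (forall x, U x -> differentiable f x) ->
  (forall i, Ck_on k U (partial i f)) -> Ck_on k.+1 U f.
Proof.
move=> oU df H; split=> // v.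
have := @Ck_sum _ _ _ _ (index_enum 'I_n) predT k U
   (fun i x => v 0 i * partial i f x) oU.
move=> /(_ _) E; apply: (Ck_eq oU _ (E _)) => [x Ux|i _].
  by rewrite derive_partial //; exact: df.
by apply: Ck_mul => //; apply: Ck_cst.
Qed.

Lemma Ck_comp (R : realType) (n m : nat) k (U : set 'rV[R]_n) (U' : set 'rV[R]_m)
  (E : 'rV[R]_n -> 'rV[R]_m) (f : 'rV[R]_m -> R) : open U ->
  Ck_on k U E -> Ck_on k U' f -> (forall x, U x -> U' (E x)) ->
  Ck_on k U (f \o E).
Proof.
move=> oU; elim: k f => [|k IH] f hE hf EU.
  by move=> x Ux; apply: continuous_comp; [exact: hE|exact/hf/EU].
have [dE _] := hE; have [df Df] := hf.
split=> [x Ux|v].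
  by apply: differentiable_comp; [exact: dE|exact/df/EU].
have := @Ck_sum _ _ _ _ (index_enum 'I_m) predT k U
   (fun i x => 'D_v (fun y => E y 0 i) x * partial i f (E x)) oU.
move=> H; apply: (Ck_eq oU _ (H _)) => [x Ux|i _].
  by rewrite derive_comp_rV //; [exact: dE|exact/df/EU].
apply: Ck_mul => //.
  by have [_] := (Ck_row _ _ oU).1 hE i; apply.
exact: (IH (partial i f) (Ck_le (leqnSn k) hE) (Df _) EU).
Qed.

Lemma Ck_comp_row (R : realType) (n m p : nat) k (U : set 'rV[R]_n) (U' : set 'rV[R]_m)
  (E : 'rV[R]_n -> 'rV[R]_m) (f : 'rV[R]_m -> 'rV[R]_p) : open U -> open U' ->
  Ck_on k U E -> Ck_on k U' f -> (forall x, U x -> U' (E x)) ->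
  Ck_on k U (f \o E).
Proof.
move=> oU oU' hE hf EU; apply/(Ck_row _ _ oU) => j.
exact: (@Ck_comp _ _ _ _ _ _ E (fun y => f y 0 j) oU hE ((Ck_row _ _ oU').1 hf j) EU).
Qed.

Lemma Ck_inv (R : realType) (V : normedModType R) k (U : set V)
  (f : V -> R) : open U ->
  Ck_on k U f -> (forall x, U x -> f x != 0) -> Ck_on k U (fun x => (f x)^-1).
Proof.
move=> oU; elim: k => [|k IH] hf f0.
  move=> x Ux; apply: (@cvgV _ _ _ _ f) => //; [exact: f0|exact: hf].
have [df Df] := hf.
split=> [x Ux|v].
  by apply: (@differentiableV _ _ f); [exact: df|exact: f0].
have h := IH (Ck_le (leqnSn k) hf) f0.
apply: (Ck_eq oU _ (Ck_mul oU (Ck_mul oU (Ck_cst k U (-1 : R)) (Ck_mul oU h h)) (Df v))) => x Ux.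
rewrite (@deriveV _ _ f) ?f0 //; last by apply: diff_derivable; apply: df.
by rewrite mulN1r -expr2 exprVn.
Qed.

(** * Mean value and Lipschitz estimates *)

Lemma ball_normP (R : realType) (V : normedModType R) (a x : V) (r : R) :
  ball a r x <-> `|x - a| < r.
Proof. by rewrite -ball_normE /= distrC. Qed.

Lemma near_ball (R : realType) (V : normedModType R) (a : V) (P : set V) :
  (\forall x \near a, P x) -> exists2 r : R, 0 < r & forall x, ball a r x -> P x.
Proof. by move=> /nbhs_ballP[r r0 H]; exists r. Qed.

Lemma ball_near (R : realType) (V : normedModType R) (a : V) (P : set V) (r : R) :
  0 < r -> (forall x, ball a r x -> P x) -> \forall x \near a, P x.
Proof. by move=> r0 H; apply/nbhs_ballP; exists r. Qed.

Lemma ball_segment (R : realType) (V : normedModType R) (a x h : V) (r t : R) :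
  ball a r x -> ball a r (x + h) -> 0 <= t <= 1 -> ball a r (x + t *: h).
Proof.
move=> /ball_normP bx /ball_normP bh /andP[t0 t1]; apply/ball_normP.
have -> : x + t *: h - a = (1 - t) *: (x - a) + t *: (x + h - a).
  rewrite scalerBl scale1r -(addrA (x - a)) [- _ + _]addrC -scalerBr.
  by rewrite (addrC x h) -(addrA h) addrK addrAC.
apply: le_lt_trans (ler_normD _ _) _; rewrite !normrZ.
rewrite (@ger0_norm _ t) // (@ger0_norm _ (1 - t)) ?subr_ge0 //.
set m := Num.max `|x - a| `|x + h - a|.
have mr : m < r by rewrite /m gt_max bx bh.
apply: le_lt_trans mr.
have -> : m = (1 - t) * m + t * m by ring.
by apply: lerD; rewrite ler_wpM2l ?subr_ge0 // /m le_max lexx ?orbT.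
Qed.

Lemma is_derive_line (R : realType) (V : normedModType R) (f : V -> R)
    (x h : V) (t : R) :
  differentiable f (x + t *: h) ->
  is_derive t 1 (fun s : R => f (x + s *: h)) ('D_h f (x + t *: h)).
Proof.
move=> df; pose g : R -> V := cst x + ( *:%R ^~ h).
have dg : is_diff t g (0 + ( *:%R ^~ h)) by exact: is_diffD.
have dg' : differentiable g t by case: dg.
have dfg : differentiable (f \o g) t by exact: differentiable_comp.
split; first exact: diff_derivable.
rewrite -[LHS]/('D_1 (f \o g) t) deriveE // diff_comp //= -deriveE //.
by case: dg => _ ->; rewrite !fctE /= add0r scale1r.
Qed.

Lemma mvt_line (R : realType) (V : normedModType R) (f : V -> R) (x h : V) :
  (forall t : R, 0 <= t <= 1 -> differentiable f (x + t *: h)) ->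
  exists2 t : R, 0 <= t <= 1 & f (x + h) - f x = 'D_h f (x + t *: h).
Proof.
move=> df.
have D (t : R) : 0 <= t <= 1 ->
   is_derive t 1 (fun s : R => f (x + s *: h)) ('D_h f (x + t *: h)).
  by move=> /df; exact: is_derive_line.
have [] := @MVT_segment R (fun s : R => f (x + s *: h))
  (fun t => 'D_h f (x + t *: h)) 0 1 ler01.
- by move=> t; rewrite in_itv /= => /andP[t0 t1]; apply: D; rewrite !ltW.
- apply: derivable_within_continuous => t; rewrite in_itv /= => /D [] //.
- move=> t; rewrite in_itv /= => t01; rewrite scale1r scale0r addr0 subr0 mulr1.
  by exists t.
Qed.

Lemma derive_norm_le (R : realType) (n : nat) (f : 'rV[R]_n -> R)
    (x h : 'rV[R]_n) (M : R) :
  differentiable f x -> (forall i, `|partial i f x| <= M) ->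
  `|'D_h f x| <= n%:R * M * `|h|.
Proof.
move=> df H; rewrite derive_partial //.
apply: le_trans (ler_norm_sum _ _ _) _.
have -> : n%:R * M * `|h| = \sum_(i < n) (`|h| * M).
  by rewrite sumr_const card_ord -mulr_natl; ring.
apply: ler_sum => i _; rewrite normrM; apply: ler_pM => //.
exact: coord_le_norm.
Qed.

Lemma lipschitz_ball (R : realType) (n : nat) (f : 'rV[R]_n -> R)
    (a : 'rV[R]_n) (r M : R) :
  (forall x, ball a r x -> differentiable f x) ->
  (forall x i, ball a r x -> `|partial i f x| <= M) ->
  forall x y, ball a r x -> ball a r y -> `|f y - f x| <= n%:R * M * `|y - x|.
Proof.
move=> df H x y bx by_.
have yE : x + (y - x) = y by rewrite subrKC.
have B (t : R) : 0 <= t <= 1 -> ball a r (x + t *: (y - x)).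
  by apply: ball_segment => //; rewrite yE.
have [t t01] := @mvt_line R _ f x (y - x) (fun t t01 => df _ (B t t01)).
rewrite yE => ->; apply: derive_norm_le; first exact/df/B.
by move=> i; apply/H/B.
Qed.

Lemma C1_lipschitz (R : realType) (n : nat) (U : set 'rV[R]_n)
    (f : 'rV[R]_n -> R) (a : 'rV[R]_n) (e : R) :
  open U -> U a -> Ck_on 1 U f -> (forall i, partial i f a = 0) -> 0 < e ->
  exists2 r : R, 0 < r & ball a r `<=` U /\
  forall x y, ball a r x -> ball a r y -> `|f y - f x| <= e * `|y - x|.
Proof.
move=> oU Ua [df Df] fa e0.
(* For the sup norm, bounding a directional derivative by the partial ones costs a factor n; [n + 1]
   absorbs it and is nonzero also for n = 0. *)
have e'0 : 0 < e / (n%:R + 1) by rewrite divr_gt0 // ltr_wpDl.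
have H0 (i : 'I_n) : \forall x \near a, `|partial i f x| <= e / (n%:R + 1).
  have /cvgrPdist_le/(_ _ e'0) := Df (delta_mx 0 i) a Ua.
  by apply: filterS => x; rewrite fa sub0r normrN.
have H1 := filter_forall (nbhs_filter a) H0.
have Un : nbhs a U by exact: open_nbhs_nbhs.
have [r r0 H] := near_ball (filterI Un H1).
exists r => //; split; first by move=> x /H[].
move=> x y bx by_.
apply: le_trans (lipschitz_ball (M := e / (n%:R + 1)) _ _ bx by_) _.
- by move=> z /H[/df].
- by move=> z i /H[_].
rewrite ler_wpM2r // mulrA ler_pdivrMr ?ltr_wpDl // mulrC ler_wpM2l ?(ltW e0) //.
by rewrite lerDl.
Qed.

(** * Symmetry of second derivatives *)

Lemma derive_scale (R : realType) (V W : normedModType R) (f : V -> W)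
    (x u : V) (t : R) : differentiable f x -> 'D_(t *: u) f x = t *: 'D_u f x.
Proof. by move=> df; rewrite !deriveE // linearZ. Qed.

Lemma is_diff_shift (R : realType) (V W : normedModType R) (f : V -> W)
    (w x : V) : differentiable f (x + w) ->
  differentiable (fun y => f (y + w)) x /\
  forall h, 'D_h (fun y => f (y + w)) x = 'D_h f (x + w).
Proof.
move=> df; pose g : V -> V := id + cst w.
have dg : is_diff x g (id + 0) by exact: is_diffD.
have dg' : differentiable g x by case: dg.
have dfg : differentiable (f \o g) x by exact: differentiable_comp.
split=> // h; rewrite -[LHS]/('D_h (f \o g) x) deriveE // diff_comp //= -deriveE //.
by case: dg => _ ->; rewrite addr0.
Qed.

Lemma scaled_dist_le (R : realType) (t e x y : R) :
  `|y - x| <= e -> `|t *: (t *: x) - t ^+ 2 * y| <= e * t ^+ 2.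
Proof.
move=> H; have -> : t *: (t *: x) = t ^+ 2 * x by rewrite expr2 -mulrA.
rewrite -mulrBr normrM distrC (ger0_norm (sqr_ge0 t)) mulrC.
by rewrite ler_wpM2r // sqr_ge0.
Qed.

Lemma second_difference_dist (R : realType) (t e x p q z u v : R) : 0 < t ->
  `|x - p - (q - z) - t ^+ 2 * u| <= e / 2 * t ^+ 2 ->
  `|x - q - (p - z) - t ^+ 2 * v| <= e / 2 * t ^+ 2 ->
  `|u - v| <= e.
Proof.
move=> t0; have t20 : 0 < t ^+ 2 by rewrite exprn_gt0.
have -> : x - q - (p - z) = x - p - (q - z) by ring.
move: (x - p - (q - z)) => d h1 h2.
rewrite -(ler_pM2l t20) -{1}(ger0_norm (ltW t20)) -normrM mulrBr.
have -> : t ^+ 2 * e = e / 2 * t ^+ 2 + e / 2 * t ^+ 2 by field.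
have -> : t ^+ 2 * u - t ^+ 2 * v = (d - t ^+ 2 * v) - (d - t ^+ 2 * u) by ring.
by apply: le_trans (ler_normB _ _) _; apply: lerD.
Qed.

(** The mean value theorem is applied twice: to x |-> F (x + tv) - F x along u, then to the
    derivative of F in direction u along v. This lands on the mixed derivative at a point of the
    small parallelogram, where continuity at [a] takes over. *)
Lemma second_difference (R : realType) (V : normedModType R) (U : set V)
    (F : V -> R) (a u v : V) (e : R) :
  open U -> U a -> (forall x, U x -> differentiable F x) ->
  (forall x, U x -> differentiable (fun y => 'D_u F y) x) ->
  {for a, continuous (fun x => 'D_v (fun y => 'D_u F y) x)} -> 0 < e ->
  \forall t \near 0^'+,
   `|F (a + t *: u + t *: v) - F (a + t *: u) - (F (a + t *: v) - F a)
     - t ^+ 2 * 'D_v (fun y => 'D_u F y) a| <= e * t ^+ 2.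
Proof.
move=> oU Ua dF dDF cDD e0.
have Un : nbhs a U by exact: open_nbhs_nbhs.
have /cvgrPdist_le/(_ _ e0) H := cDD.
have [r r0 {}H] := near_ball (filterI Un H).
have c0 : 0 < `|u| + `|v| + 1 by rewrite ltr_wpDl // addr_ge0.
near=> t.
have t0 : 0 < t by near: t; exact: nbhs_right_gt.
have tr : t * (`|u| + `|v| + 1) < r.
  rewrite -ltr_pdivlMr //; near: t; apply: nbhs_right_lt; exact: divr_gt0.
have B (s1 s2 : R) : 0 <= s1 <= 1 -> 0 <= s2 <= 1 ->
    ball a r (a + s1 *: (t *: u) + s2 *: (t *: v)).
  move=> /andP[s10 s11] /andP[s20 s21]; apply/ball_normP.
  rewrite -(addrA a) addrAC subrr add0r !scalerA; apply: le_lt_trans tr.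
  apply: le_trans (ler_normD _ _) _; rewrite !normrZ !ger0_norm ?mulr_ge0 ?(ltW t0) //.
  rewrite !mulrDr mulr1 -[leLHS]addr0 lerD ?(ltW t0) // lerD //.
    by rewrite ler_wpM2r // ler_piMl // ltW.
  by rewrite ler_wpM2r // ler_piMl // ltW.
have i0 : 0 <= (0 : R) <= 1 by rewrite lexx ler01.
have i1 : 0 <= (1 : R) <= 1 by rewrite lexx ler01.
pose phi x := F (x + t *: v) - F x.
have D1 (s : R) : 0 <= s <= 1 -> differentiable F (a + s *: (t *: u)).
  by move=> s01; have [/dF + _] := H _ (B s 0 s01 i0); rewrite scale0r addr0.
have D2 (s : R) : 0 <= s <= 1 -> differentiable F (a + s *: (t *: u) + t *: v).
  by move=> s01; have [/dF + _] := H _ (B s 1 s01 i1); rewrite scale1r.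
have Dphi (s : R) : 0 <= s <= 1 -> differentiable phi (a + s *: (t *: u)).
  move=> s01; apply: (@differentiableB _ _ _ (fun x => F (x + t *: v)) F).
    by have [] := is_diff_shift (D2 s s01).
  exact: D1.
have [s s01 E] := mvt_line Dphi.
have -> : F (a + t *: u + t *: v) - F (a + t *: u) - (F (a + t *: v) - F a) =
  phi (a + t *: u) - phi a by [].
rewrite E.
have [d1 d2] := is_diff_shift (D2 s s01).
rewrite (@deriveB _ _ _ (fun x => F (x + t *: v)) F); last 2 first.
- exact: diff_derivable.
- by apply: diff_derivable; apply: D1.
rewrite d2 (derive_scale _ _ (D2 s s01)) (derive_scale _ _ (D1 s s01)).
have D3 (s' : R) : 0 <= s' <= 1 -> differentiable (fun y => 'D_u F y) (a + s *: (t *: u) + s' *: (t *: v)).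
  by move=> s'01; have [/dDF + _] := H _ (B s s' s01 s'01).
have [s' s'01 E'] := mvt_line D3.
rewrite -scalerBr E' (derive_scale _ _ (D3 s' s'01)).
have [_] := H _ (B s s' s01 s'01).
exact: scaled_dist_le.
Unshelve. all: by end_near. Qed.

(** The second difference is symmetric in u and v, and divided by t^2 it approximates both mixed
    derivatives. *)
Lemma schwarz (R : realType) (V : normedModType R) (U : set V)
    (F : V -> R) (a u v : V) : open U -> U a -> Ck_on 2 U F ->
  'D_v (fun y => 'D_u F y) a = 'D_u (fun y => 'D_v F y) a.
Proof.
move=> oU Ua [dF DF]; apply/eqP; rewrite -subr_eq0 -normr_le0.
 apply/ler_addgt0Pr => e e0; rewrite add0r.
have e20 : 0 < e / 2 by rewrite divr_gt0.
have H1 := @second_difference R V U F a u v _ oU Ua dF (DF u).1 ((DF u).2 v a Ua) e20.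
have H2 := @second_difference R V U F a v u _ oU Ua dF (DF v).1 ((DF v).2 u a Ua) e20.
have [t [[t0 h1]]] := filter_ex (filterI (filterI (nbhs_right_gt (0 : R)) H1) H2).
rewrite (addrAC a (t *: v)) => h2.
exact: (second_difference_dist t0 h1 h2).
Qed.

(** * Local inversion *)

(** The transpose of the usual Jacobian matrix: vectors are rows and are multiplied from the left,
    so the chain rule keeps the order of composition. *)
Definition pjac (R : realType) (n m : nat) (f : 'rV[R]_n -> 'rV[R]_m)
    (x : 'rV[R]_n) : 'M[R]_(n, m) :=
  \matrix_(i, j) 'D_(delta_mx 0 i) (fun y => f y 0 j) x.

Lemma derive_pjac (R : realType) (n m : nat) (f : 'rV[R]_n -> 'rV[R]_m)
    (x v : 'rV[R]_n) : differentiable f x -> 'D_v f x = v *m pjac f x.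
Proof.
move=> df; apply/rowP => j; rewrite derive_row // derive_partial; last first.
  by move/differentiable_rowP : df.
by rewrite mxE; apply: eq_bigr => i _; rewrite mxE.
Qed.

Lemma mulmx_norm_le (R : realType) (n m : nat) (A : 'M[R]_(n, m)) (v : 'rV[R]_n) :
  `|v *m A| <= n%:R * `|A| * `|v|.
Proof.
apply: norm_le_coord; first by rewrite !mulr_ge0.
move=> j; rewrite mxE; apply: le_trans (ler_norm_sum _ _ _) _.
have -> : n%:R * `|A| * `|v| = \sum_(i < n) (`|v| * `|A|).
  by rewrite sumr_const card_ord -mulr_natl; ring.
by apply: ler_sum => i _; rewrite normrM ler_pM // coord_le_norm.
Qed.

Lemma Ck_mulmx (R : realType) (n m k : nat) (A : 'M[R]_(n, m)) (U : set 'rV[R]_n) :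
  open U -> Ck_on k U (fun x => x *m A).
Proof.
move=> oU; apply/(Ck_row _ _ oU) => j.
have := @Ck_sum _ _ _ _ (index_enum 'I_n) predT k U
  (fun i (x : 'rV[R]_n) => x 0 i * A i j) oU.
move=> H; apply: (Ck_eq oU _ (H _)) => [x Ux|i _]; first by rewrite mxE.
by apply: Ck_mul => //; [exact: Ck_coord|exact: Ck_cst].
Qed.

(** Solutions of x + N x = y are the fixed points of x |-> y - N x, a contraction. *)
Lemma lipschitz_perturb_inverse (R : realType) (n : nat)
    (N : 'rV[R]_n -> 'rV[R]_n) (r : R) :
  0 < r -> N 0 = 0 ->
  (forall x y, ball 0 r x -> ball 0 r y -> `|N y - N x| <= 2^-1 * `|y - x|) ->
  forall y, ball 0 (r / 2) y -> exists2 x, ball 0 r x & x + N x = y.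
Proof.
move=> r0 N0 lN y /ball_normP; rewrite subr0 => yr.
pose X : completeNormedModType R := HB.pack 'rV[R]_n.
(* The contraction needs a closed ball inside the open ball of radius r. This radius is below r, and
   it is at least 2 |y|, which is what makes the closed ball invariant: |y| + s / 2 <= s. *)
pose s := `|y| + r / 2.
have sr : s < r by rewrite /s; lra.
have s0 : 0 <= s by rewrite /s addr_ge0 // ltW // divr_gt0.
pose U : set X := [set x : 'rV[R]_n | `|x| <= s].
pose T (x : X) : X := y - N x.
have Ur x : U x -> ball (0 : 'rV[R]_n) r x.
  by move=> Ux; apply/ball_normP; rewrite subr0; apply: le_lt_trans sr.
have b0 : ball (0 : 'rV[R]_n) r 0 by apply/ball_normP; rewrite subr0 normr0.
have TU : set_fun U U T.
  move=> x Ux; rewrite /U /T /=; apply: le_trans (ler_normB _ _) _.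
  have := lN _ _ b0 (Ur _ Ux); rewrite N0 !subr0 => H.
  have Ux' : `|x : 'rV[R]_n| <= s by [].
  rewrite /s in Ux' *.
  lra.
pose fT : {fun U >-> U} := HB.pack T (isFun.Build X X U U T TU).
have cT : is_contraction fT.
  exists (2^-1)%:nng; split; first by rewrite /= invf_lt1 // ltr1n.
  move=> [x z] /= [Ux Uz]; rewrite /T opprB addrC subrKA.
  rewrite [X in _ <= _ * X]distrC; exact: (lN x z (Ur _ Ux) (Ur _ Uz)).
have cU : closed U.
  have -> : U = (fun x : 'rV[R]_n => `|x|) @^-1` [set t | t <= s] by [].
  apply: closed_comp; last exact: closed_le.
  by move=> x _; exact: norm_continuous.
have U0 : U !=set0 by exists 0; rewrite /U /= normr0.
have [x Ux xE] := banach_fixed_point cT cU U0.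
exists x; first exact: Ur.
by rewrite {1}xE /= /T subrK.
Qed.

Lemma C1_lipschitz_row (R : realType) (n m : nat) (U : set 'rV[R]_n)
    (f : 'rV[R]_n -> 'rV[R]_m) (a : 'rV[R]_n) (e : R) :
  open U -> U a -> Ck_on 1 U f -> pjac f a = 0 -> 0 < e ->
  exists2 r : R, 0 < r & ball a r `<=` U /\
  forall x y, ball a r x -> ball a r y -> `|f y - f x| <= e * `|y - x|.
Proof.
move=> oU Ua Cf J0 e0.
have fP (j : 'I_m) (i : 'I_n) : partial i (fun x => f x 0 j) a = 0.
  by have /matrixP/(_ i j) := J0; rewrite !mxE.
have fr (j : 'I_m) := C1_lipschitz oU Ua ((Ck_row _ _ oU).1 Cf j) (fP j) e0.
have {}fr (j : 'I_m) : \forall r \near 0^'+,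
    forall x y, ball a r x -> ball a r y ->
    `|f y 0 j - f x 0 j| <= e * `|y - x|.
  have [r r0 [_ H]] := fr j.
  near=> s => x y bx by_; apply: H; [apply: le_ball bx|apply: le_ball by_];
    near: s; exact: nbhs_right_le.
have {}fr := filter_forall (@at_right_proper_filter R 0) fr.
have Un : nbhs a U by exact: open_nbhs_nbhs.
have [r1 r10 H1] := near_ball Un.
have [r [[r0 rr1] lf]] :=
  filter_ex (filterI (filterI (nbhs_right_gt (0 : R)) (nbhs_right_le r10)) fr).
exists r => //; split=> [x bx|x y bx by_]; first by apply: H1; apply: le_ball bx.
apply: norm_le_coord => [|j]; first by rewrite mulr_ge0 // ltW.
by have := lf j x y bx by_; rewrite !mxE.
Unshelve. all: by end_near. Qed.

(** With identity Jacobian at 0, [Phi] is the identity plus a map of Lipschitz constant 1/2 near 0.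
    The last clause, that [Phi] contracts distances by at most 2, gives injectivity and later the
    differentiability of [Psi]. *)
Lemma local_inverse (R : realType) (n : nat) (U : set 'rV[R]_n)
    (Phi : 'rV[R]_n -> 'rV[R]_n) :
  open U -> U 0 -> Phi 0 = 0 -> Ck_on 1 U Phi -> pjac Phi 0 = 1%:M ->
  exists2 r : R, 0 < r & exists Psi : 'rV[R]_n -> 'rV[R]_n,
  [/\ ball 0 r `<=` U,
      forall y, ball 0 (r / 2) y -> ball 0 r (Psi y) /\ Phi (Psi y) = y,
      forall x, ball 0 r x -> ball 0 (r / 2) (Phi x) -> Psi (Phi x) = x &
      forall x y, ball 0 r x -> ball 0 r y -> `|y - x| <= 2 * `|Phi y - Phi x|].
Proof.
move=> oU U0 Phi0 C1 J1.
pose N x := Phi x - x.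
have NC1 (j : 'I_n) : Ck_on 1 U (fun x => N x 0 j).
  have H := Ck_mul oU (Ck_cst 1 U (-1 : R)) (Ck_coord 1 j oU).
  apply: (Ck_eq oU _ (Ck_add oU ((Ck_row _ _ oU).1 C1 j) H)) => x Ux.
  by rewrite !mxE mulN1r.
have dPhi x : U x -> differentiable Phi x by move=> Ux; exact: C1.1.
have NJ : pjac N 0 = 0.
  apply/matrixP => i j; rewrite !mxE.
  have -> : (fun x => N x 0 j) = (fun x => Phi x 0 j) - (fun x => x 0 j).
    by apply/funext => x; rewrite !mxE.
  have dj : differentiable (fun x => Phi x 0 j) 0.
    by have /differentiable_rowP := dPhi 0 U0; apply.
  rewrite deriveB; last 2 first.
  - exact: diff_derivable.
  - by apply: diff_derivable; exact: differentiable_coord.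
  have /matrixP/(_ i j) := J1; rewrite !mxE => ->.
  rewrite -(derive_row (f := id)) ?derive_id // mxE.
  by rewrite eqxx eq_sym subrr.
have h20 : 0 < 2^-1 :> R by rewrite invr_gt0.
have [r r0 [rU lN]] := C1_lipschitz_row oU U0 ((Ck_row _ _ oU).2 NC1) NJ h20.
have N0 : N 0 = 0 by rewrite /N Phi0 subrr.
have E x : x + N x = Phi x by rewrite /N subrKC.
have H := lipschitz_perturb_inverse r0 N0 lN.
(* Outside the half ball, where no preimage is guaranteed, the value is an arbitrary 0. *)
pose Psi y := if pselect (ball 0 (r / 2) y) is left b then sval (cid2 (H y b)) else 0.
have inj x y : ball 0 r x -> ball 0 r y -> `|y - x| <= 2 * `|Phi y - Phi x|.
  move=> bx by_; have := lN _ _ bx by_.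
  have -> : Phi y - Phi x = (y - x) + (N y - N x) by rewrite -!E opprD addrACA.
  move: (y - x) (N y - N x) => a b hb.
  have := lerB_dist a (- b); rewrite normrN opprK; lra.
have P1 y : ball 0 (r / 2) y -> ball 0 r (Psi y) /\ Phi (Psi y) = y.
  move=> b; rewrite /Psi; case: pselect => // b'.
  by case: (cid2 _) => x /= bx; rewrite E.
exists r => //; exists Psi; split=> //.
- move=> x bx bPx; have [b1 E1] := P1 _ bPx.
  have := inj _ _ bx b1; rewrite E1 subrr normr0 mulr0 normr_le0 subr_eq0.
  by move/eqP.
Qed.

(* The Jacobian is invertible because [Phi] expands distances to first order. *)
Lemma inverse_derivative (R : realType) (n : nat) (V W : set 'rV[R]_n)
    (Phi Psi : 'rV[R]_n -> 'rV[R]_n) (c : R) :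
  open V -> open W -> 0 < c ->
  (forall y, W y -> V (Psi y) /\ Phi (Psi y) = y) ->
  (forall x y, V x -> V y -> `|y - x| <= c * `|Phi y - Phi x|) ->
  (forall x, V x -> differentiable Phi x) ->
  forall y, W y -> [/\ pjac Phi (Psi y) \in unitmx, differentiable Psi y &
     forall v, 'D_v Psi y = v *m invmx (pjac Phi (Psi y))].
Proof.
move=> oV oW c0 P1 inj dPhi y Wy.
have [Vx Ex] := P1 y Wy; set x := Psi y in Vx Ex *.
have dPx := dPhi x Vx.
have dE h : 'd Phi x h = h *m pjac Phi x by rewrite -deriveE // derive_pjac.
have near_x (P : set 'rV[R]_n) : nbhs x P -> nbhs (0 : 'rV[R]_n) (fun h => P (h + x)).
  by move=> /nbhs0P; apply: filterS => h; rewrite addrC.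
have Vn : nbhs x V by exact: open_nbhs_nbhs.
have Ju : pjac Phi x \in unitmx.
  rewrite -row_free_unit -kermx_eq0; apply/eqP/row_matrixP => i; rewrite row0.
  set u := row i _; apply/eqP; apply/negPn/negP => u0.
  have uJ : u *m pjac Phi x = 0 by rewrite -row_mul mulmx_ker row0.
  (* Along a kernel vector u, differentiability moves [Phi] by at most (2c)^-1 |tu|, whereas the
     expansion hypothesis demands at least c^-1 |tu|. *)
  have e0 : 0 < (2 * c)^-1 by rewrite invr_gt0 mulr_gt0.
  have D := differentiable_epsE dPx e0.
  have [s s0 H] := near_ball (filterI (near_x _ Vn) D).
  pose t := s / (2 * `|u|).
  have t0 : 0 < t by rewrite divr_gt0 // mulr_gt0 // normr_gt0.
  have bt : ball 0 s (t *: u).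
    apply/ball_normP; rewrite subr0 normrZ gtr0_norm // /t invfM mulrA mulfVK ?normr_eq0 //.
    by rewrite ltr_pdivrMr // ltr_pMr // ltr1n.
  have [Vh] := H _ bt; rewrite dE -scalemxAl uJ scaler0 subr0 => D'.
  have := inj _ _ Vx Vh; rewrite addrK => I'.
  have tu0 : 0 < `|t *: u| by rewrite normr_gt0 scaler_eq0 negb_or gt_eqF.
  have : `|t *: u| <= 2^-1 * `|t *: u|.
    apply: le_trans I' _; rewrite -(ler_pM2l c0) in D'.
    by apply: le_trans D' _; rewrite mulrA invfM mulrCA mulfV ?gt_eqF // mulr1.
  by move: tu0; move: `|t *: u| => z; lra.
pose A := invmx (pjac Phi x).
pose C := n%:R * `|A| + 1.
have C0 : 0 < C by rewrite ltr_wpDl // mulr_ge0.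
have CA (v : 'rV[R]_n) : `|v *m A| <= C * `|v|.
  apply: le_trans (mulmx_norm_le A v) _; rewrite ler_wpM2r // /C lerDl //.
have cL : continuous (mulmxr A : 'rV[R]_n -> 'rV[R]_n).
  by move=> v; have /= := @Ck_mulmx R n n 0 A setT openT; apply.
have [] := @differentiable_eps R 'rV[R]_n 'rV[R]_n Psi y (mulmxr A) cL.
  move=> e e0.
  (* The factor C is lost when multiplying by the inverse Jacobian, and c when bounding the
     increment of [Psi] by that of its argument. *)
  have e'0 : 0 < e / (C * c) by rewrite divr_gt0 // mulr_gt0.
  have [s s0 H] := near_ball (differentiable_epsE dPx e'0).
  have Wn : nbhs y W by exact: open_nbhs_nbhs.
  have [s' s'0 H'] := near_ball Wn.
  have m0 : 0 < Num.min s' (s / c) by rewrite lt_min s'0 divr_gt0.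
  apply: (ball_near m0) => k /ball_normP; rewrite subr0 lt_min => /andP[ks' ks].
  have Wk : W (k + y) by apply: H'; apply/ball_normP; rewrite addrK.
  have [Vk Ek] := P1 _ Wk; pose h := Psi (k + y) - x.
  have hx : h + x = Psi (k + y) by rewrite subrK.
  have hk : `|h| <= c * `|k| by have := inj _ _ Vx Vk; rewrite Ek Ex addrK.
  have bh : ball 0 s h.
    by apply/ball_normP; rewrite subr0 (le_lt_trans hk) // mulrC -ltr_pdivlMr.
  have := H _ bh; rewrite dE hx Ek Ex addrK => D.
  (* The linearization error of [Psi] is the image under the inverse Jacobian of that of [Phi], up
     to sign. *)
  have -> : Psi (k + y) - x - mulmxr A k = - ((k - h *m pjac Phi x) *m A).
    by rewrite mulmxBl -mulmxA mulmxV // mulmx1 opprB.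
  rewrite normrN; apply: le_trans (CA _) _.
  have -> : e * `|k| = C * (e / (C * c) * (c * `|k|)).
    by field; rewrite ?gt_eqF.
  rewrite ler_pM2l //; apply: le_trans D _.
  by rewrite ler_pM2l.
move=> dPsi E; split=> [||v]; [exact: Ju|exact: dPsi|].
exact: (etrans (deriveE v dPsi) (congr1 (fun k : 'rV[R]_n -> 'rV[R]_n => k v) E)).
Qed.

(** A determinant is a polynomial in the entries. The class P is left abstract because the same
    argument is needed for C^k functions and for functions with factorial bounds. *)
Lemma det_closed (T : Type) (R : comNzRingType) (P : (T -> R) -> Prop) :
  (forall c, P (fun=> c)) ->
  (forall f g, P f -> P g -> P (fun x => f x + g x)) ->
  (forall f g, P f -> P g -> P (fun x => f x * g x)) ->
  forall (n : nat) (A : T -> 'M[R]_n), (forall i j, P (fun x => A x i j)) ->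
  P (fun x => \det (A x)).
Proof.
move=> Pc PD PM n A PA; rewrite /determinant.
elim: (index_enum _) => [|s l IH].
  by under eq_fun do rewrite big_nil; exact: Pc.
under eq_fun do rewrite big_cons.
apply: (PD _ _ _ IH); apply: (PM _ _ (Pc _)).
elim: (index_enum _) => [|i k IH'].
  by under eq_fun do rewrite big_nil; exact: Pc.
under eq_fun do rewrite big_cons.
exact: (PM _ _ (PA _ _) IH').
Qed.

Lemma adj_closed (T : Type) (R : comNzRingType) (P : (T -> R) -> Prop) :
  (forall c, P (fun=> c)) ->
  (forall f g, P f -> P g -> P (fun x => f x + g x)) ->
  (forall f g, P f -> P g -> P (fun x => f x * g x)) ->
  forall (n : nat) (A : T -> 'M[R]_n), (forall i j, P (fun x => A x i j)) ->
  forall i j, P (fun x => (\adj (A x)) i j).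
Proof.
move=> Pc PD PM n A PA i j.
have -> : (fun x => (\adj (A x)) i j) =
   (fun x => (-1) ^+ (j + i) * \det (row' j (col' i (A x)))).
  by apply/funext => x; rewrite mxE.
apply: (PM _ _ (Pc _)).
apply: det_closed => // k l.
have -> : (fun x => row' j (col' i (A x)) k l) =
  (fun x => A x (lift j k) (lift i l)) by apply/funext => x; rewrite !mxE.
exact: PA.
Qed.

Lemma Ck_invmx (R : realType) (V : normedModType R) k (U : set V) (n : nat)
    (A : V -> 'M[R]_n) : open U ->
  (forall i j, Ck_on k U (fun x => A x i j)) ->
  (forall x, U x -> A x \in unitmx) ->
  forall i j, Ck_on k U (fun x => invmx (A x) i j).
Proof.
move=> oU CA uA i j.
pose P (f : V -> R) := Ck_on k U f.
have Pc c : P (fun=> c) by exact: Ck_cst.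
have PD f g : P f -> P g -> P (fun x => f x + g x) by exact: Ck_add.
have PM f g : P f -> P g -> P (fun x => f x * g x) by exact: Ck_mul.
have Cd : Ck_on k U (fun x => (\det (A x))^-1).
  apply: Ck_inv => // [|x /uA]; last by rewrite unitmxE unitfE.
  exact: (det_closed Pc PD PM CA).
have Ca : Ck_on k U (fun x => (\adj (A x)) i j) := adj_closed Pc PD PM CA i j.
apply: (Ck_eq oU _ (Ck_mul oU Cd Ca)) => x Ux.
by rewrite /invmx uA // [RHS]mxE.
Qed.

(** A bootstrap: the derivative of [Psi] is the inverse Jacobian of [Phi] evaluated at [Psi], hence
    it is as smooth as [Psi] is already known to be, up to the smoothness of the Jacobian. *)
Lemma Ck_inverse (R : realType) (n k : nat) (V W : set 'rV[R]_n)
    (Phi Psi : 'rV[R]_n -> 'rV[R]_n) :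
  open V -> open W -> (forall y, W y -> V (Psi y)) ->
  Ck_on k V Phi ->
  (forall y, W y -> [/\ pjac Phi (Psi y) \in unitmx, differentiable Psi y &
     forall v, 'D_v Psi y = v *m invmx (pjac Phi (Psi y))]) ->
  Ck_on k W Psi.
Proof.
move=> oV oW WV; elim: k => [|k IH] CPhi H.
  by move=> y /H[_ d _]; exact: differentiable_continuous.
have CPsi := IH (Ck_le (leqnSn k) CPhi) H.
split=> [y /H[]//|v]; apply/(Ck_row _ _ oW) => j.
have C i l : Ck_on k W (fun y => pjac Phi (Psi y) i l).
  have Cl := (Ck_row _ _ oV).1 CPhi l.
  have := Ck_comp oW CPsi (Cl.2 (delta_mx 0 i)) WV.
  by apply: Ck_eq => // y Wy; rewrite /= mxE.
have Ci := Ck_invmx oW C (fun y Wy => let: And3 a _ _ := H y Wy in a).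
have := @Ck_sum _ _ _ _ (index_enum 'I_n) predT k W
  (fun i y => v 0 i * invmx (pjac Phi (Psi y)) i j) oW.
move=> S; apply: (Ck_eq oW _ (S _)) => [y /H[_ _ ->]|i _]; first by rewrite mxE.
exact: (Ck_mul oW (Ck_cst k W (v 0 i)) (Ci i j)).
Qed.

(** * Factorial bounds on derivatives *)

Definition smooth_on (R : realType) (n : nat) (U : set 'rV[R]_n)
  (f : 'rV[R]_n -> R) := forall k, Ck_on k U f.

Lemma smooth_partial (R : realType) (n : nat) (U : set 'rV[R]_n)
  (f : 'rV[R]_n -> R) i : smooth_on U f -> smooth_on U (partial i f).
Proof. by move=> sf k; have [_] := sf k.+1; apply. Qed.

Lemma smooth_differentiable (R : realType) (n : nat) (U : set 'rV[R]_n)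
  (f : 'rV[R]_n -> R) x : smooth_on U f -> U x -> differentiable f x.
Proof. by move=> sf; have [+ _] := sf 1; apply. Qed.

(* The innermost derivative is along the first letter of [J]. *)
Definition Dword (R : realType) (n : nat) (J : seq 'I_n) (f : 'rV[R]_n -> R) :=
  foldl (fun g j => partial j g) f J.

Lemma Dword_eq (R : realType) (n : nat) (U : set 'rV[R]_n) (J : seq 'I_n)
    (f g : 'rV[R]_n -> R) : open U -> (forall x, U x -> f x = g x) ->
  forall x, U x -> Dword J f x = Dword J g x.
Proof.
move=> oU; elim: J f g => [|j J IH] f g fg x Ux /=; first exact: fg.
apply: IH => // y Uy; apply: near_eq_derive; exact: (near_eq_open oU).
Qed.

Lemma Dword_smooth (R : realType) (n : nat) (U : set 'rV[R]_n) (J : seq 'I_n)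
    (f : 'rV[R]_n -> R) : smooth_on U f -> smooth_on U (Dword J f).
Proof. by elim: J f => [|j J IH] f sf //=; exact/IH/smooth_partial. Qed.

Lemma Dword_rcons (R : realType) (n : nat) (J : seq 'I_n) j (f : 'rV[R]_n -> R) :
  Dword (rcons J j) f = partial j (Dword J f).
Proof. by rewrite /Dword -cats1 foldl_cat. Qed.

Lemma Dword_add (R : realType) (n : nat) (U : set 'rV[R]_n) (J : seq 'I_n)
    (f g : 'rV[R]_n -> R) : open U -> smooth_on U f -> smooth_on U g ->
  forall x, U x -> Dword J (fun y => f y + g y) x = Dword J f x + Dword J g x.
Proof.
move=> oU; elim: J f g => [|j J IH] f g sf sg x Ux //=.
have E y : U y -> partial j (fun z => f z + g z) y = partial j f y + partial j g y.
  move=> Uy; rewrite (@deriveD _ _ _ f g) //.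
  - exact/diff_derivable/(smooth_differentiable sf).
  - exact/diff_derivable/(smooth_differentiable sg).
apply: etrans (Dword_eq J oU E Ux) _.
exact: (IH _ _ (smooth_partial j sf) (smooth_partial j sg) x Ux).
Qed.

Lemma partialM (R : realType) (n : nat) (U : set 'rV[R]_n) j
    (f g : 'rV[R]_n -> R) x : smooth_on U f -> smooth_on U g -> U x ->
  partial j (fun y => f y * g y) x = partial j f x * g x + f x * partial j g x.
Proof.
move=> sf sg Ux /=; rewrite (@deriveM _ _ f g); last 2 first.
- exact/diff_derivable/(smooth_differentiable sf).
- exact/diff_derivable/(smooth_differentiable sg).
by rewrite addrC [_ *: _]mulrC.
Qed.

Definition cauchy_prod (R : pzRingType) (a b : nat -> R) (k : nat) : R :=
  \sum_(i < k.+1) a i * b (k - i)%N.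

(** The coefficients of the derivative of the power series with coefficients a. *)
Definition fderiv (R : pzRingType) (a : nat -> R) (k : nat) : R :=
  k.+1%:R * a k.+1.

(** The Leibniz rule for formal power series, read off at one coefficient: the weights i and k + 1 -
    i add up to k + 1. *)
Lemma cauchy_prod_fderiv (R : comPzRingType) (a b : nat -> R) k :
  cauchy_prod (fderiv a) b k + cauchy_prod a (fderiv b) k =
  k.+1%:R * cauchy_prod a b k.+1.
Proof.
rewrite /cauchy_prod /fderiv.
have -> : \sum_(i < k.+1) i.+1%:R * a i.+1 * b (k - i)%N =
   \sum_(i < k.+2) i%:R * (a i * b (k.+1 - i)%N).
  rewrite [RHS]big_ord_recl /= mul0r add0r; apply: eq_bigr => i _.
  by rewrite /bump /= add1n subSS mulrA.
have -> : \sum_(i < k.+1) a i * ((k - i).+1%:R * b (k - i).+1) =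
   \sum_(i < k.+2) (k.+1 - i)%:R * (a i * b (k.+1 - i)%N).
  rewrite [RHS]big_ord_recr /= subnn mul0r addr0; apply: eq_bigr => i _.
  by rewrite subSn -1?ltnS // mulrCA.
rewrite -big_split mulr_sumr; apply: eq_bigr => i _ /=.
by rewrite -mulrDl -natrD subnKC // -ltnS.
Qed.

(** The quantity k! a_k is the k-th derivative at 0 of the one-variable series with coefficients a.
    This series thus dominates f at every point of U, and operations on functions turn into the same
    operations on series. *)
Definition majorant (R : realType) (n : nat) (U : set 'rV[R]_n)
    (f : 'rV[R]_n -> R) (a : nat -> R) :=
  smooth_on U f /\
  forall (J : seq 'I_n) x, U x -> `|Dword J f x| <= (size J)`!%:R * a (size J).

Lemma majorant_partial (R : realType) (n : nat) (U : set 'rV[R]_n)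
    (f : 'rV[R]_n -> R) (a : nat -> R) i :
  majorant U f a -> majorant U (partial i f) (fderiv a).
Proof.
move=> [sf H]; split=> [|J x Ux]; first exact: smooth_partial.
apply: le_trans (H (i :: J) x Ux) _; rewrite /fderiv /= factS natrM.
by rewrite mulrA [_.+1%:R * _]mulrC.
Qed.

Lemma majorant_eq (R : realType) (n : nat) (U : set 'rV[R]_n)
    (f g : 'rV[R]_n -> R) (a : nat -> R) :
  open U -> (forall x, U x -> f x = g x) -> majorant U f a -> majorant U g a.
Proof.
move=> oU fg [sf H]; split=> [k|J x Ux]; first exact: Ck_eq (sf k).
by rewrite -(Dword_eq J oU fg Ux); exact: H.
Qed.

Lemma majorant_add (R : realType) (n : nat) (U : set 'rV[R]_n)
    (f g : 'rV[R]_n -> R) (a b : nat -> R) : open U ->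
  majorant U f a -> majorant U g b -> majorant U (fun x => f x + g x) (fun k => a k + b k).
Proof.
move=> oU [sf Hf] [sg Hg]; split=> [k|J x Ux]; first exact: Ck_add.
rewrite (Dword_add _ oU) // mulrDr; apply: le_trans (ler_normD _ _) _.
by apply: lerD; [exact: Hf|exact: Hg].
Qed.

(** Induction on the word: its first letter splits the product by the Leibniz rule, and the formal
    Leibniz rule reassembles the two bounds. *)
Lemma majorant_mul (R : realType) (n : nat) (U : set 'rV[R]_n)
    (f g : 'rV[R]_n -> R) (a b : nat -> R) : open U ->
  majorant U f a -> majorant U g b -> majorant U (fun x => f x * g x) (cauchy_prod a b).
Proof.
move=> oU mf mg; split=> [k|J].
  by apply: Ck_mul => //; [exact: mf.1|exact: mg.1].
elim: J f g a b mf mg => [|j J IH] f g a b mf mg x Ux.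
  rewrite /= /cauchy_prod big_ord_recl big_ord0 addr0 subn0 mul1r normrM.
  have := mf.2 [::] x Ux; have := mg.2 [::] x Ux; rewrite /= !mul1r => h1 h2.
  exact: ler_pM.
have sf := mf.1; have sg := mg.1.
have E y : U y -> partial j (fun z => f z * g z) y =
    partial j f y * g y + f y * partial j g y by exact: partialM.
have s1 : smooth_on U (fun y => partial j f y * g y).
  by move=> k; apply: Ck_mul => //; exact: smooth_partial.
have s2 : smooth_on U (fun y => f y * partial j g y).
  by move=> k; apply: Ck_mul => //; exact: smooth_partial.
have -> : Dword (j :: J) (fun y => f y * g y) x =
    Dword J (fun y => partial j f y * g y) x + Dword J (fun y => f y * partial j g y) x.
  exact: etrans (Dword_eq J oU E Ux) (Dword_add J oU s1 s2 Ux).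
apply: le_trans (ler_normD _ _) _.
have h1 := IH _ _ _ _ (majorant_partial j mf) mg x Ux.
have h2 := IH _ _ _ _ mf (majorant_partial j mg) x Ux.
apply: le_trans (lerD h1 h2) _.
by rewrite -mulrDr cauchy_prod_fderiv /= factS natrM mulrA [_.+1%:R * _]mulrC.
Qed.

Lemma Dword_cst (R : realType) (n : nat) (J : seq 'I_n) (c : R) x :
  Dword J (fun=> c) x = if J is [::] then c else 0.
Proof.
elim: J c => [|j J IH] c //=.
have E (y : 'rV[R]_n) : [set: 'rV[R]_n] y ->
    partial j (fun=> c : R) y = (fun=> 0) y by move=> _; rewrite derive_cst.
apply: etrans (Dword_eq J openT E I) _.
by rewrite IH; case: J {IH E}.
Qed.

Lemma majorant_cst (R : realType) (n : nat) (U : set 'rV[R]_n) (c : R) :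
  majorant U (fun=> c) (fun k => if k is 0 then `|c| else 0).
Proof.
split=> [k|J x _]; first exact: Ck_cst.
by rewrite Dword_cst; case: J => [|j J] /=; rewrite ?mul1r // normr0 mulr0.
Qed.

Lemma majorant_coord (R : realType) (n : nat) (U : set 'rV[R]_n) i (c : R) (b : R) :
  open U -> (forall x, U x -> `|x 0 i - c| <= b) ->
  majorant U (fun x => x 0 i - c) (fun k => if k is k'.+1 then (if k' is 0 then 1 else 0) else b).
Proof.
move=> oU H; split=> [k|J x Ux].
  by apply: Ck_add => //; [exact: Ck_coord|exact: Ck_cst].
case: J => [|j J]; first by rewrite /= mul1r H.
have E y : partial j (fun x : 'rV[R]_n => x 0 i - c) y = (i == j)%:R.
  rewrite (@deriveB _ _ _ (fun x : 'rV[R]_n => x 0 i) (fun=> c)); last 2 first.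
  - exact/diff_derivable/differentiable_coord.
  - exact: derivable_cst.
  by rewrite derive_cst subr0 -(derive_row (f := id)) ?derive_id // mxE eqxx.
have -> : Dword (j :: J) (fun x : 'rV[R]_n => x 0 i - c) x = if J is [::] then (i == j)%:R else 0.
  apply: etrans (Dword_eq J openT (g := fun=> (i == j)%:R) (fun y _ => E y) I) _.
  exact: Dword_cst.
case: J => [|l J] /=.
  by rewrite mulr1; case: (i == j); rewrite ?normr1 ?normr0.
by rewrite normr0 mulr0.
Qed.

(* A weighted l^1 norm, at most [A], of the Taylor coefficients of a
   one-variable majorant of [f]: submultiplicative, and differentiation costs
   only a loss of radius. *)
Definition nagumo (R : realType) (n : nat) (U : set 'rV[R]_n) (r : R)
    (f : 'rV[R]_n -> R) (A : R) :=
  exists a : nat -> R, [/\ majorant U f a, forall k, 0 <= a k &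
    forall K, \sum_(k < K) a k * r ^+ k <= A].

Lemma nagumo_ge0 (R : realType) (n : nat) (U : set 'rV[R]_n) (r : R)
    (f : 'rV[R]_n -> R) (A : R) : nagumo U r f A -> 0 <= A.
Proof. by move=> [a [_ _ /(_ 0)]]; rewrite big_ord0. Qed.

Lemma nagumo_smooth (R : realType) (n : nat) (U : set 'rV[R]_n) (r : R)
    (f : 'rV[R]_n -> R) (A : R) : nagumo U r f A -> smooth_on U f.
Proof. by move=> [a [[]]]. Qed.

Lemma nagumo_eq (R : realType) (n : nat) (U : set 'rV[R]_n) (r A : R)
    (f g : 'rV[R]_n -> R) :
  open U -> (forall x, U x -> f x = g x) -> nagumo U r f A -> nagumo U r g A.
Proof. by move=> oU fg [a [ma a0 aA]]; exists a; split=> //; exact: majorant_eq ma. Qed.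

Lemma nagumo_sub (R : realType) (n : nat) (U U' : set 'rV[R]_n) (r A : R)
    (f : 'rV[R]_n -> R) : U' `<=` U -> nagumo U r f A -> nagumo U' r f A.
Proof.
move=> sU [a [[sa ma] a0 aA]]; exists a; split=> //; split=> [k|J x /sU].
  exact: Ck_sub (sa k).
exact: ma.
Qed.

Lemma nagumo_le (R : realType) (n : nat) (U : set 'rV[R]_n) (r r' A A' : R)
    (f : 'rV[R]_n -> R) : 0 <= r' -> r' <= r -> A <= A' ->
  nagumo U r f A -> nagumo U r' f A'.
Proof.
move=> r'0 r'r AA' [a [ma a0 aA]]; exists a; split=> // K.
apply: le_trans AA'; apply: le_trans (aA K); apply: ler_sum => k _.
by rewrite ler_wpM2l // lerXn2r // nnegrE (le_trans r'0).
Qed.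

Lemma nagumo_add (R : realType) (n : nat) (U : set 'rV[R]_n) (r A B : R)
    (f g : 'rV[R]_n -> R) : open U ->
  nagumo U r f A -> nagumo U r g B -> nagumo U r (fun x => f x + g x) (A + B).
Proof.
move=> oU [a [ma a0 aA]] [b [mb b0 bB]]; exists (fun k => a k + b k); split.
- exact: majorant_add.
- by move=> k; rewrite addr_ge0.
move=> K; under eq_bigr do rewrite mulrDl.
by rewrite big_split lerD.
Qed.

(** The left side sums the products u_i v_j over the triangle i + j < K, the right side over the
    square i, j < K, and all terms are nonnegative. *)
Lemma cauchy_prod_sum_le (R : numDomainType) (a b : nat -> R) (r : R) K :
  0 <= r -> (forall k, 0 <= a k) -> (forall k, 0 <= b k) ->
  \sum_(k < K) cauchy_prod a b k * r ^+ k <=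
  (\sum_(k < K) a k * r ^+ k) * (\sum_(k < K) b k * r ^+ k).
Proof.
move=> r0 a0 b0.
pose u k := a k * r ^+ k; pose v k := b k * r ^+ k.
have u0 k : 0 <= u k by rewrite mulr_ge0 // exprn_ge0.
have v0 k : 0 <= v k by rewrite mulr_ge0 // exprn_ge0.
have -> : \sum_(k < K) cauchy_prod a b k * r ^+ k =
    \sum_(k < K) \sum_(i < K | (i <= k)%N) u i * v (k - i)%N.
  apply: eq_bigr => k _; rewrite /cauchy_prod mulr_suml.
  rewrite (big_ord_widen_cond K (fun=> true) (fun i => a i * b (k - i)%N * r ^+ k)) //=.
  apply: eq_big => [i|i]; first by rewrite ltnS.
  rewrite ltnS => ik; rewrite /u /v mulrACA -exprD subnKC //.
rewrite (exchange_big_dep xpredT) //= mulr_suml; apply: ler_sum => i _.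
rewrite -mulr_sumr ler_wpM2l //.
rewrite -(big_mkord (fun k => (i <= k)%N) (fun k => v (k - i)%N)).
rewrite -(big_mkord xpredT v).
rewrite (big_cat_nat (n := i)) //=; last exact: ltnW.
rewrite big1_seq ?add0r; last first.
  by move=> k /andP[ik]; rewrite mem_index_iota => /andP[_]; rewrite ltnNge ik.
rewrite -{1}[i : nat]add0n big_addn (eq_big xpredT v); last 2 first.
- by move=> k; rewrite leq_addl.
- by move=> k _; rewrite addnK.
rewrite [leRHS](big_cat_nat (n := (K - i)%N)) //=; last exact: leq_subr.
by rewrite lerDl sumr_ge0.
Qed.

Lemma nagumo_mul (R : realType) (n : nat) (U : set 'rV[R]_n) (r A B : R)
    (f g : 'rV[R]_n -> R) : open U -> 0 <= r ->
  nagumo U r f A -> nagumo U r g B -> nagumo U r (fun x => f x * g x) (A * B).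
Proof.
move=> oU r0 [a [ma a0 aA]] [b [mb b0 bB]]; exists (cauchy_prod a b); split.
- exact: majorant_mul.
- by move=> k; apply: sumr_ge0 => i _; rewrite mulr_ge0.
move=> K; apply: le_trans (cauchy_prod_sum_le K r0 a0 b0) _.
by apply: ler_pM => //; apply: sumr_ge0 => i _; rewrite mulr_ge0 // exprn_ge0.
Qed.

(** A Cauchy estimate: factoring r^(k+1) - r'^(k+1) shows that (r - r') (k + 1) r'^k <= r^(k+1),
    which absorbs the factor k + 1 of the differentiated series. *)
Lemma nagumo_partial (R : realType) (n : nat) (U : set 'rV[R]_n) (r r' A : R)
    (f : 'rV[R]_n -> R) i : 0 <= r' -> r' < r ->
  nagumo U r f A -> nagumo U r' (partial i f) (A / (r - r')).
Proof.
move=> r'0 r'r [a [ma a0 aA]]; exists (fderiv a); split.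
- exact: majorant_partial.
- by move=> k; rewrite mulr_ge0.
move=> K; rewrite ler_pdivlMr ?subr_gt0 //; apply: le_trans (aA K.+1).
rewrite mulr_suml big_ord_recl ler_wpDl ?mulr_ge0 //.
apply: ler_sum => k _; rewrite lift0 /fderiv.
have -> : k.+1%:R * a k.+1 * r' ^+ k * (r - r') =
  a k.+1 * ((r - r') * (r' ^+ k *+ k.+1)) by rewrite -mulr_natl; ring.
rewrite ler_wpM2l //.
have : (r - r') * (r' ^+ k *+ k.+1) <= r ^+ k.+1 - r' ^+ k.+1.
  have -> : r' ^+ k *+ k.+1 = \sum_(j < k.+1) r' ^+ k by rewrite sumr_const card_ord.
  rewrite subrXX ler_pM2l ?subr_gt0 //.
  apply: ler_sum => j _; have jk : (j <= k)%N by rewrite -ltnS.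
  rewrite -{1}(subnK jk) exprD ler_wpM2r ?exprn_ge0 //.
  by rewrite lerXn2r ?nnegrE // ?ltW // (le_lt_trans r'0).
by move/le_trans; apply; rewrite gerBl exprn_ge0.
Qed.

Lemma nagumo_cst (R : realType) (n : nat) (U : set 'rV[R]_n) (r c : R) :
  nagumo U r (fun=> c) `|c|.
Proof.
exists (fun k => if k is 0 then `|c| else 0); split; first exact: majorant_cst.
  by case.
case=> [|K]; first by rewrite big_ord0.
rewrite big_ord_recl mulr1 big1 ?addr0 // => i _.
by rewrite mul0r.
Qed.

Lemma nagumo_coord (R : realType) (n : nat) (U : set 'rV[R]_n) i (r c b : R) :
  open U -> 0 <= b -> 0 <= r -> (forall x, U x -> `|x 0 i - c| <= b) ->
  nagumo U r (fun x => x 0 i - c) (b + r).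
Proof.
move=> oU b0 r0 H.
exists (fun k => if k is k'.+1 then (if k' is 0 then 1 else 0) else b); split.
- exact: majorant_coord.
- by case=> [|[|k]].
case=> [|K]; first by rewrite big_ord0 addr_ge0.
rewrite big_ord_recl mulr1 lerD2l; case: K => [|K]; first by rewrite big_ord0.
rewrite big_ord_recl /= mul1r expr1 big1 ?addr0 // => j _.
by rewrite mul0r.
Qed.

Lemma nagumo_sum (R : realType) (n : nat) (I : Type) (s : seq I) (U : set 'rV[R]_n)
    (r : R) (f : I -> 'rV[R]_n -> R) (A : I -> R) : open U ->
  (forall i, nagumo U r (f i) (A i)) ->
  nagumo U r (fun x => \sum_(i <- s) f i x) (\sum_(i <- s) A i).
Proof.
move=> oU H; elim: s => [|i s IH].
  rewrite big_nil; under eq_fun do rewrite big_nil.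
  by have := nagumo_cst U r 0; rewrite normr0.
by rewrite big_cons; under eq_fun do rewrite big_cons; exact: nagumo_add.
Qed.

Lemma nagumo_prod (R : realType) (n : nat) (I : Type) (s : seq I) (U : set 'rV[R]_n)
    (r : R) (f : I -> 'rV[R]_n -> R) (A : I -> R) : open U -> 0 <= r ->
  (forall i, nagumo U r (f i) (A i)) ->
  nagumo U r (fun x => \prod_(i <- s) f i x) (\prod_(i <- s) A i).
Proof.
move=> oU r0 H; elim: s => [|i s IH].
  rewrite big_nil; under eq_fun do rewrite big_nil.
  by have := nagumo_cst U r 1; rewrite normr1.
by rewrite big_cons; under eq_fun do rewrite big_cons; exact: nagumo_mul.
Qed.

Lemma nagumo_Dword_le (R : realType) (n : nat) (U : set 'rV[R]_n) (r A : R)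
    (f : 'rV[R]_n -> R) : 0 < r -> nagumo U r f A ->
  forall J x, U x -> `|Dword J f x| <= (size J)`!%:R * (A * r^-1 ^+ size J).
Proof.
move=> r0 [a [[sf H] a0 aA]] J x Ux; apply: le_trans (H J x Ux) _.
rewrite ler_wpM2l // exprVn ler_pdivlMr ?exprn_gt0 //.
apply: le_trans (aA (size J).+1); rewrite big_ord_recr ler_wpDl //.
by apply: sumr_ge0 => i _; rewrite mulr_ge0 // exprn_ge0 // ltW.
Qed.

Lemma nagumo_norm_le (R : realType) (n : nat) (U : set 'rV[R]_n) (r A : R)
    (f : 'rV[R]_n -> R) : nagumo U r f A -> forall x, U x -> `|f x| <= A.
Proof.
move=> [a [[_ H] _ aA]] x Ux; have := H [::] x Ux; rewrite /= mul1r.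
by move/le_trans; apply; have := aA 1; rewrite big_ord1 mulr1.
Qed.

(** Halving the radius turns the bounds into a geometric series of ratio 1/2, whose partial sums
    stay below 2 A. *)
Lemma nagumo_of_Dword_le (R : realType) (n : nat) (U : set 'rV[R]_n) (r A : R)
    (f : 'rV[R]_n -> R) : 0 < r -> 0 <= A -> smooth_on U f ->
  (forall J x, U x -> `|Dword J f x| <= (size J)`!%:R * (A * r^-1 ^+ size J)) ->
  nagumo U (r / 2) f (2 * A).
Proof.
move=> r0 A0 sf H; exists (fun k => A * r^-1 ^+ k); split=> //.
  by move=> k; rewrite mulr_ge0 // exprn_ge0 // invr_ge0 ltW.
move=> K; have -> : \sum_(k < K) A * r^-1 ^+ k * (r / 2) ^+ k =
    2 * A * (1 - 2^-1 ^+ K).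
  elim: K => [|K IH]; first by rewrite big_ord0 expr0 subrr mulr0.
  have E : r^-1 ^+ K * (r / 2) ^+ K = 2^-1 ^+ K.
    by rewrite -exprMn mulrA mulVf ?gt_eqF // mul1r.
  rewrite big_ord_recr IH /= -[X in _ + X = _]mulrA E exprS.
  by field.
by rewrite ler_piMr ?mulr_ge0 // gerBl exprn_ge0.
Qed.

(** * Derivatives along solutions of total differential systems *)

Definition lieD (R : realType) (m N : nat) (G : 'I_m -> 'I_N -> 'rV[R]_N -> R)
    (j : 'I_m) (h : 'rV[R]_N -> R) : 'rV[R]_N -> R :=
  fun x => \sum_(i < N) G j i x * partial i h x.

(* [E] solves the total differential system [d_j E_i = G_ji o E], so that
   derivatives of [h o E] are iterated Lie derivatives of [h]. *)
Definition flow (R : realType) (m N : nat) (W : set 'rV[R]_m) (U : set 'rV[R]_N)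
    (G : 'I_m -> 'I_N -> 'rV[R]_N -> R) (E : 'rV[R]_m -> 'rV[R]_N) :=
  forall y, W y -> [/\ U (E y), differentiable E y &
    forall j i, partial j (fun z => E z 0 i) y = G j i (E y)].

Lemma flow_partial (R : realType) (m N : nat) (W : set 'rV[R]_m) (U : set 'rV[R]_N)
    (G : 'I_m -> 'I_N -> 'rV[R]_N -> R) (E : 'rV[R]_m -> 'rV[R]_N)
    (h : 'rV[R]_N -> R) j y : flow W U G E -> smooth_on U h -> W y ->
  partial j (h \o E) y = (lieD G j h \o E) y.
Proof.
move=> F sh Wy; have [UE dE EG] := F y Wy.
rewrite derive_comp_rV //; last exact: (smooth_differentiable sh).
by apply: eq_bigr => i _; rewrite -EG.
Qed.

(** Only differentiability of [E] is assumed. The induction runs over all smooth h at once, since a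
    partial derivative of h o E is again of the form h' o E with h' smooth. *)
Lemma flow_smooth (R : realType) (m N : nat) (W : set 'rV[R]_m) (U : set 'rV[R]_N)
    (G : 'I_m -> 'I_N -> 'rV[R]_N -> R) (E : 'rV[R]_m -> 'rV[R]_N)
    (h : 'rV[R]_N -> R) : open W -> open U -> flow W U G E ->
  (forall j i, smooth_on U (G j i)) -> smooth_on U h -> smooth_on W (h \o E).
Proof.
move=> oW oU F sG + k; elim: k h => [|k IH] h sh.
  move=> y Wy; have [UE dE _] := F y Wy.
  apply: continuous_comp; first exact: differentiable_continuous.
  exact/differentiable_continuous/(smooth_differentiable sh).
apply: Ck_partialP => // [y Wy|j].
  have [UE dE _] := F y Wy; apply: differentiable_comp => //.
  exact: (smooth_differentiable sh).
have sL : smooth_on U (lieD G j h).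
  move=> l; apply: Ck_sum => // i _; apply: Ck_mul => //; first exact: sG.
  exact: smooth_partial.
by apply: (Ck_eq oW _ (IH _ sL)) => y Wy; rewrite (flow_partial j F sh Wy).
Qed.

(** Every letter spends d of the radius: a Lie derivative has N terms, each bounded by C times the
    Cauchy estimate A / d. The function h must vary in the induction, because the first letter
    replaces it by its Lie derivative. *)
Lemma flow_Dword_le (R : realType) (m N : nat) (W : set 'rV[R]_m) (U : set 'rV[R]_N)
    (G : 'I_m -> 'I_N -> 'rV[R]_N -> R) (E : 'rV[R]_m -> 'rV[R]_N) (r C d : R) :
  open W -> open U -> flow W U G E -> 0 < d ->
  (forall j i, nagumo U r (G j i) C) ->
  forall (J : seq 'I_m) (h : 'rV[R]_N -> R) (s A : R),
  (size J)%:R * d <= s -> s <= r -> nagumo U s h A ->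
  forall y, W y -> `|Dword J (h \o E) y| <= A * (N%:R * C / d) ^+ size J.
Proof.
move=> oW oU F d0 gG; elim=> [|j J IH] h s A /= Js sr gh y Wy.
  by rewrite mulr1; have [UE _ _] := F y Wy; exact: (nagumo_norm_le gh).
have Jd0 : 0 <= (size J)%:R * d by rewrite mulr_ge0 // ltW.
have ds : (size J)%:R * d <= s - d.
  by move: Js; rewrite -natr1 mulrDl mul1r lerBrDr.
have sd0 : 0 <= s - d by apply: le_trans ds.
have E1 z : W z -> partial j (h \o E) z = (lieD G j h \o E) z.
  by move=> Wz; exact: (flow_partial j F (nagumo_smooth gh) Wz).
have gL : nagumo U (s - d) (lieD G j h) (N%:R * C / d * A).
  have -> : N%:R * C / d * A = \sum_(i < N) C * (A / (s - (s - d))).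
    by rewrite sumr_const card_ord -mulr_natl opprB subrKC; ring.
  apply: nagumo_sum => // i; apply: nagumo_mul => //.
    by apply: nagumo_le (gG j i) => //; rewrite (le_trans _ sr) // gerBl ltW.
  by apply: nagumo_partial => //; rewrite gtrBl.
have := IH _ _ _ ds _ gL y Wy; rewrite (le_trans _ sr) ?gerBl ?(ltW d0) // => /(_ isT).
have -> : Dword J (lieD G j h \o E) y = foldl (fun g j => partial j g) (partial j (h \o E)) J y.
  exact: (esym (Dword_eq J oW E1 Wy)).
by rewrite exprS mulrA [A * _]mulrC.
Qed.

(** The term k^k / k! of the exponential series at k is at most e^k. *)
Lemma expn_le_fact (R : realType) (k : nat) :
  k%:R ^+ k <= expR 1 ^+ k * k`!%:R :> R.
Proof.
case: k => [|k]; first by rewrite !expr0 mul1r.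
have := @expR_ge1Dxn R k.+1%:R k (ler0n _ _).
rewrite -[X in expR X]mulr1 expRM_natl => H.
rewrite -ler_pdivrMr ?ltr0n ?fact_gt0 //; apply: le_trans H.
by rewrite lerDr.
Qed.

Lemma nagumo_flow (R : realType) (m N : nat) (W : set 'rV[R]_m) (U : set 'rV[R]_N)
    (G : 'I_m -> 'I_N -> 'rV[R]_N -> R) (E : 'rV[R]_m -> 'rV[R]_N)
    (h : 'rV[R]_N -> R) (r C A : R) :
  open W -> open U -> flow W U G E -> 0 < r -> 0 <= C ->
  (forall j i, nagumo U r (G j i) C) -> nagumo U r h A ->
  exists r' A', 0 < r' /\ nagumo W r' (h \o E) A'.
Proof.
move=> oW oU F r0 C0 gG gh.
(* Adding 1 keeps D positive even if N or C vanishes. *)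
pose D := N%:R * C + 1; have D0 : 0 < D by rewrite ltr_wpDl // mulr_ge0.
pose e : R := expR 1; have e0 : 0 < e by exact: expR_gt0.
(* With steps d = r / k the bound for words of length k is at most A (D k / r)^k, and k^k <= e^k k!
   turns it into A k! q^-k. *)
pose q := r / (e * D); have q0 : 0 < q by rewrite divr_gt0 // mulr_gt0.
have A0 := nagumo_ge0 gh.
exists (q / 2), (2 * A); split; first by rewrite divr_gt0.
apply: nagumo_of_Dword_le => //.
  by apply: (flow_smooth oW oU F) => [j i|]; [exact: nagumo_smooth (gG j i)|exact: nagumo_smooth gh].
move=> J y Wy.
(* The empty word is treated apart because the step r / k would divide by zero. *)
case: J => [|j J].
  rewrite /= mul1r expr0 mulr1.
  by have [UE _ _] := F y Wy; exact: (nagumo_norm_le gh).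
set k := size (j :: J); have k0 : 0 < k%:R :> R by rewrite ltr0n.
have d0 : 0 < r / k%:R by rewrite divr_gt0.
have kd : (size (j :: J))%:R * (r / k%:R) <= r by rewrite mulrCA mulfV ?mulr1 // gt_eqF.
apply: le_trans (flow_Dword_le oW oU F d0 gG kd (lexx r) gh Wy) _.
rewrite -/k mulrCA ler_wpM2l //.
have -> : N%:R * C / (r / k%:R) = N%:R * C / r * k%:R by field; rewrite ?gt_eqF.
rewrite exprMn; apply: le_trans (_ : (D / r) ^+ k * (e ^+ k * k`!%:R) <= _).
  apply: ler_pM; rewrite ?exprn_ge0 ?divr_ge0 ?mulr_ge0 ?(ltW r0) //.
    rewrite lerXn2r ?nnegrE ?divr_ge0 ?mulr_ge0 ?(ltW r0) ?(ltW D0) //.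
    by rewrite ler_pM2r ?invr_gt0 // /D lerDl.
  exact: expn_le_fact.
rewrite mulrA -exprMn /q invf_div mulrC le_eqVlt; apply/orP; left; apply/eqP.
by congr (_ * _ ^+ _); rewrite mulrAC [D * e]mulrC.
Qed.

(** * Closure properties of functions with factorial bounds *)

(** The working form of real analyticity; the equivalence with power series is [analytic_omegaP].
    The radius e delimits where the bounds hold, while r is the radius in the weighted norm. *)
Definition omega_at (R : realType) (n : nat) (f : 'rV[R]_n -> R) (x : 'rV[R]_n) :=
  exists e r A : R, [/\ 0 < e, 0 < r & nagumo (ball x e) r f A].

Lemma nagumo_omega (R : realType) (n : nat) (U : set 'rV[R]_n)
    (f : 'rV[R]_n -> R) (x : 'rV[R]_n) (r A : R) :
  open U -> U x -> 0 < r -> nagumo U r f A -> omega_at f x.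
Proof.
move=> oU Ux r0 gf.
have Un : nbhs x U by exact: open_nbhs_nbhs.
have [e e0 H] := near_ball Un.
by exists e, r, A; split=> //; exact: nagumo_sub gf.
Qed.

Lemma omega_common (R : realType) (n : nat) (I : finType)
    (f : I -> 'rV[R]_n -> R) (x : 'rV[R]_n) :
  (forall i, omega_at (f i) x) ->
  exists e r A : R, [/\ 0 < e, 0 < r, 0 <= A & forall i, nagumo (ball x e) r (f i) A].
Proof.
move=> H.
(* Both radii are set to the same small number, and the property is stated for all small values, so
   that finitely many such conditions can be met together. *)
have {H}H i : \forall e \near 0^'+, exists A, nagumo (ball x e) e (f i) A.
  have [e [r [A [e0 r0 g]]]] := H i.
  have m0 : 0 < Num.min e r by rewrite lt_min e0.
  apply: filterS2 (nbhs_right_gt (0 : R)) (nbhs_right_le m0) => s s0.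
  rewrite le_min => /andP[se sr]; exists A.
  apply: (@nagumo_le _ _ _ r s A A) => //; first exact: ltW.
  exact: nagumo_sub (le_ball se) g.
have {}H := filter_forall (@at_right_proper_filter R 0) H.
have [e [e0 {}H]] := filter_ex (filterI (nbhs_right_gt (0 : R)) H).
have {}H i := cid (H i).
have A0 i : 0 <= sval (H i) by exact: nagumo_ge0 (svalP (H i)).
exists e, e, (\sum_i sval (H i)); split=> //; first by rewrite sumr_ge0.
move=> i; apply: nagumo_le (svalP (H i)) => //; first exact: ltW.
by rewrite (bigD1 i) //= lerDl sumr_ge0.
Qed.

Lemma omega_eq (R : realType) (n : nat) (f g : 'rV[R]_n -> R) (x : 'rV[R]_n) :
  (\forall y \near x, f y = g y) -> omega_at f x -> omega_at g x.
Proof.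
move=> /near_ball[e' e'0 fg] [e [r [A [e0 r0 gf]]]].
have m0 : 0 < Num.min e e' by rewrite lt_min e0.
exists (Num.min e e'), r, A; split=> //.
apply: (@nagumo_eq _ _ _ _ _ f g); first exact: ball_open.
  by move=> y yb; apply: fg; apply: le_ball yb; rewrite ge_min lexx orbT.
by apply: nagumo_sub gf; apply: le_ball; rewrite ge_min lexx.
Qed.

Lemma omega_cst (R : realType) (n : nat) (c : R) (x : 'rV[R]_n) :
  omega_at (fun=> c) x.
Proof. by exists 1, 1, `|c|; split=> //; exact: nagumo_cst. Qed.

Lemma omega_pair (R : realType) (n : nat) (f g : 'rV[R]_n -> R) (x : 'rV[R]_n) :
  omega_at f x -> omega_at g x ->
  exists e r A : R, [/\ 0 < e, 0 < r, nagumo (ball x e) r f A & nagumo (ball x e) r g A].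
Proof.
move=> hf hg.
have [|e [r [A [e0 r0 _ H]]]] := @omega_common R n bool (fun b => if b then f else g) x.
  by case.
by exists e, r, A; split=> //; [exact: (H true)|exact: (H false)].
Qed.

Lemma omega_add (R : realType) (n : nat) (f g : 'rV[R]_n -> R) (x : 'rV[R]_n) :
  omega_at f x -> omega_at g x -> omega_at (fun y => f y + g y) x.
Proof.
move=> hf hg; have [e [r [A [e0 r0 gf gg]]]] := omega_pair hf hg.
by exists e, r, (A + A); split=> //; apply: nagumo_add => //; exact: ball_open.
Qed.

Lemma omega_mul (R : realType) (n : nat) (f g : 'rV[R]_n -> R) (x : 'rV[R]_n) :
  omega_at f x -> omega_at g x -> omega_at (fun y => f y * g y) x.
Proof.
move=> hf hg; have [e [r [A [e0 r0 gf gg]]]] := omega_pair hf hg.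
exists e, r, (A * A); split=> //; apply: nagumo_mul => //; first exact: ball_open.
exact: ltW.
Qed.

Lemma omega_sum (R : realType) (n : nat) (I : Type) (s : seq I)
    (f : I -> 'rV[R]_n -> R) (x : 'rV[R]_n) :
  (forall i, omega_at (f i) x) -> omega_at (fun y => \sum_(i <- s) f i y) x.
Proof.
move=> H; elim: s => [|i s IH].
  by under eq_fun do rewrite big_nil; exact: omega_cst.
by under eq_fun do rewrite big_cons; exact: omega_add.
Qed.

Lemma omega_partial (R : realType) (n : nat) (f : 'rV[R]_n -> R) (x : 'rV[R]_n) i :
  omega_at f x -> omega_at (partial i f) x.
Proof.
move=> [e [r [A [e0 r0 gf]]]].
exists e, (r / 2), (A / (r - r / 2)); split=> //; first by rewrite divr_gt0.
apply: nagumo_partial => //; first by rewrite divr_ge0 // ltW.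
by rewrite ltr_pdivrMr // ltr_pMr // ltr1n.
Qed.

Lemma omega_coord (R : realType) (n : nat) i (x : 'rV[R]_n) :
  omega_at (fun y => y 0 i) x.
Proof.
have H : omega_at (fun y : 'rV[R]_n => y 0 i - 0) x.
  exists 1, 1, (`|x| + 1 + 1); split=> //.
  apply: nagumo_coord => //; first exact: ball_open.
  move=> y /ball_normP yx; rewrite subr0; apply: le_trans (coord_le_norm _ _ _) _.
  rewrite -(subrK x y) addrC; apply: le_trans (ler_normD _ _) _.
  by rewrite lerD2l ltW.
by apply: omega_eq H; apply: (@ball_near R 'rV[R]_n x _ 1 ltr01) => y _; rewrite subr0.
Qed.

Lemma omega_smooth (R : realType) (n : nat) (f : 'rV[R]_n -> R) (x : 'rV[R]_n) :
  omega_at f x -> exists2 e : R, 0 < e & smooth_on (ball x e) f.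
Proof. by move=> [e [r [A [e0 r0 gf]]]]; exists e => //; exact: nagumo_smooth gf. Qed.

Lemma omega_differentiable (R : realType) (n : nat) (f : 'rV[R]_n -> R) (x : 'rV[R]_n) :
  omega_at f x -> \forall y \near x, differentiable f y.
Proof.
move=> /omega_smooth[e e0 sf]; apply: (ball_near e0) => y.
exact: (smooth_differentiable sf).
Qed.

Lemma omega_flow (R : realType) (m N : nat)
    (G : 'I_m -> 'I_N -> 'rV[R]_N -> R) (E : 'rV[R]_m -> 'rV[R]_N)
    (h : 'rV[R]_N -> R) (y : 'rV[R]_m) :
  (\forall z \near y, differentiable E z /\
     forall j i, partial j (fun z => E z 0 i) z = G j i (E z)) ->
  (forall j i, omega_at (G j i) (E y)) -> omega_at h (E y) ->
  omega_at (h \o E) y.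
Proof.
move=> /near_ball[e1 e10 H] oG oh.
(* The [option] type adjoins [h] to the coefficients [G], so that one neighbourhood, radius and
   bound serve all of them. *)
have [|e [r [A [e0 r0 A0 gA]]]] := @omega_common R N (option ('I_m * 'I_N))
  (fun o => if o is Some ji then G ji.1 ji.2 else h) (E y).
  by case.
have dE : differentiable E y by have [] := H y (ballxx y e10).
have nE : \forall z \near y, ball (E y) e (E z).
  by apply: (differentiable_continuous dE); exact: nbhsx_ballx.
have [e2 e20 H2] := near_ball nE.
have m0 : 0 < Num.min e1 e2 by rewrite lt_min e10.
have F : flow (ball y (Num.min e1 e2)) (ball (E y) e) G E.
  move=> z bz.
  have [dz Ez] : differentiable E z /\
     forall j i, partial j (fun z => E z 0 i) z = G j i (E z).
    by apply: H; apply: le_ball bz; rewrite ge_min lexx.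
  split=> //; apply: H2; apply: le_ball bz; by rewrite ge_min lexx orbT.
have [r' [A' [r'0 g']]] := nagumo_flow (@ball_open _ _ y _) (@ball_open _ _ (E y) _) F r0 A0
  (fun j i => gA (Some (j, i))) (gA None).
by exists (Num.min e1 e2), r', A'.
Qed.

Lemma row_mx_coord (R : Type) (n m : nat) (x : 'rV[R]_n) (y : 'rV[R]_m) i :
  (row_mx x y) 0 i = match fintype.split i with inl k => x 0 k | inr k => y 0 k end.
Proof. by rewrite mxE. Qed.

Lemma partial_coord (R : realType) (n : nat) (j k : 'I_n) (x : 'rV[R]_n) :
  partial j (fun y : 'rV[R]_n => y 0 k) x = (k == j)%:R.
Proof.
apply: etrans (esym (@derive_row R 'rV[R]_n n id x (delta_mx 0 j) k _)) _ => //.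
by rewrite derive_id mxE eqxx.
Qed.

(** A linear map solves a total differential system with constant coefficients, namely the entries
    of its matrix. *)
Lemma omega_linear (R : realType) (N n : nat) (A : 'M[R]_(N, n))
    (g : 'rV[R]_n -> R) (z : 'rV[R]_N) :
  omega_at g (z *m A) -> omega_at (fun y => g (y *m A)) z.
Proof.
move=> og.
have dA y : differentiable (fun y : 'rV[R]_N => y *m A) y.
  by have [+ _] := @Ck_mulmx R N n 1 A setT openT; apply.
apply: (@omega_flow _ _ _ (fun j i _ => A j i) (fun y => y *m A) g) => //; last first.
  by move=> j i; exact: omega_cst.
apply: (@ball_near R 'rV[R]_N z _ 1 ltr01) => y _; split=> // j i.
have cA : continuous (mulmxr A : 'rV[R]_N -> 'rV[R]_n).
  by move=> v; exact: (differentiable_continuous (dA v)).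
apply: etrans (esym (derive_row (delta_mx 0 j) i (dA y))) _.
have -> : 'D_(delta_mx 0 j) (fun y : 'rV[R]_N => y *m A) y = delta_mx 0 j *m A.
  apply: etrans (deriveE _ (dA y)) _.
  exact: (congr1 (fun k : 'rV[R]_N -> 'rV[R]_n => k (delta_mx 0 j)) (diff_lin y cA)).
by rewrite -rowE mxE.
Qed.

(** The derivatives of [Phi] depend on y rather than on [Phi] y. The graph y |-> (y, [Phi] y) has y
    among its coordinates and therefore solves an autonomous system; f is then read on the second
    block. *)
Lemma omega_comp (R : realType) (n m : nat) (Phi : 'rV[R]_n -> 'rV[R]_m)
    (f : 'rV[R]_m -> R) (x : 'rV[R]_n) :
  (forall j, omega_at (fun y => Phi y 0 j) x) -> omega_at f (Phi x) ->
  omega_at (f \o Phi) x.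
Proof.
move=> oPhi of_.
pose P1 : 'M[R]_(n + m, n) := col_mx 1%:M 0.
pose P2 : 'M[R]_(n + m, m) := col_mx 0 1%:M.
have E1 (a : 'rV[R]_n) (b : 'rV[R]_m) : row_mx a b *m P1 = a.
  by rewrite mul_row_col mulmx1 mulmx0 addr0.
have E2 (a : 'rV[R]_n) (b : 'rV[R]_m) : row_mx a b *m P2 = b.
  by rewrite mul_row_col mulmx1 mulmx0 add0r.
pose E (y : 'rV[R]_n) := row_mx y (Phi y).
pose G (j : 'I_n) (i : 'I_(n + m)) (z : 'rV[R]_(n + m)) : R :=
  match fintype.split i with
  | inl k => (k == j)%:R
  | inr k => partial j (fun y => Phi y 0 k) (z *m P1)
  end.
have -> : f \o Phi = (fun z => f (z *m P2)) \o E.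
  by apply/funext => y /=; rewrite E2.
have dPhi := filter_forall (nbhs_filter x) (fun j => omega_differentiable (oPhi j)).
apply: (omega_flow (G := G)).
- apply: (@filterS _ (nbhs x) (nbhs_filter x) _ _ _ dPhi) => y dy.
  have EE i : (fun z => E z 0 i) = (fun z => match fintype.split i with
      | inl k => z 0 k | inr k => Phi z 0 k end).
    by apply/funext => z; rewrite /E row_mx_coord.
  split.
    apply/differentiable_rowP => i; rewrite EE.
    by case: (fintype.split i) => // k; exact: differentiable_coord.
  move=> j i; rewrite EE /G; case: (fintype.split i) => k; first exact: partial_coord.
  by rewrite /E E1.
- move=> j i; rewrite /G; case: (fintype.split i) => k; first exact: omega_cst.
  apply: (@omega_linear _ _ _ P1 (partial j (fun y => Phi y 0 k))).
  by rewrite /E E1; exact: omega_partial.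
- by apply: (@omega_linear _ _ _ P2 f); rewrite /E E2.
Qed.

(** The derivative of 1/f is -(1/f)^2 times that of f, so y |-> (y, 1/f(y)) solves a system that is
    polynomial in the adjoined coordinate: no division is left in its coefficients. *)
Lemma omega_inv (R : realType) (n : nat) (f : 'rV[R]_n -> R) (x : 'rV[R]_n) :
  omega_at f x -> f x != 0 -> omega_at (fun y => (f y)^-1) x.
Proof.
move=> of_ fx0.
pose P1 : 'M[R]_(n + 1, n) := col_mx 1%:M 0.
have E1 (a : 'rV[R]_n) (b : 'rV[R]_1) : row_mx a b *m P1 = a.
  by rewrite mul_row_col mulmx1 mulmx0 addr0.
pose E (y : 'rV[R]_n) := row_mx y ((f y)^-1)%:M : 'rV[R]_(n + 1).
pose h (z : 'rV[R]_(n + 1)) := z 0 (rshift n ord0).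
have hE y : h (E y) = (f y)^-1.
  by rewrite /h /E row_mxEr mxE eqxx mulr1n.
pose G (j : 'I_n) (i : 'I_(n + 1)) (z : 'rV[R]_(n + 1)) : R :=
  match fintype.split i with
  | inl k => (k == j)%:R
  | inr k => -1 * (h z * h z) * partial j f (z *m P1)
  end.
have -> : (fun y => (f y)^-1) = h \o E by apply/funext => y; rewrite /= hE.
have df := omega_differentiable of_.
have cf : {for x, continuous f} := differentiable_continuous (nbhs_singleton df).
have nf : \forall y \near x, f y != 0 by exact: (cvgr_neq0 (f x) cf).
apply: (omega_flow (G := G)).
- apply: filterS2 df nf => y dy fy0.
  have EE i : (fun z => E z 0 i) = (fun z => match fintype.split i with
      | inl k => z 0 k | inr k => (f z)^-1 end).
    apply/funext => z; rewrite /E row_mx_coord; case: (fintype.split i) => // k.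
    by rewrite mxE ord1 eqxx mulr1n.
  have dV : differentiable (fun z => (f z)^-1) y by exact: (@differentiableV _ _ f).
  split.
    apply/differentiable_rowP => i; rewrite EE.
    by case: (fintype.split i) => // k; exact: differentiable_coord.
  move=> j i; rewrite EE /G; case: (fintype.split i) => k; first exact: partial_coord.
  rewrite hE /E E1 (@deriveV _ _ f) ?f0 //; last exact: diff_derivable.
  by rewrite mulN1r -expr2 exprVn.
- move=> j i; rewrite /G; case: (fintype.split i) => k; first exact: omega_cst.
  apply: omega_mul.
    by apply: omega_mul; [exact: omega_cst|apply: omega_mul; exact: omega_coord].
  apply: (@omega_linear _ _ _ P1 (partial j f)).
  by rewrite /E E1; exact: omega_partial.
- exact: omega_coord.
Qed.

(** The local inverse solves the system whose coefficients are the entries of the inverse Jacobian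
    of [Phi], written by cofactors. *)
Lemma omega_inverse (R : realType) (n : nat) (Phi Psi : 'rV[R]_n -> 'rV[R]_n)
    (y : 'rV[R]_n) :
  (forall j, omega_at (fun x => Phi x 0 j) (Psi y)) ->
  (\forall z \near y, [/\ pjac Phi (Psi z) \in unitmx, differentiable Psi z &
     forall v, 'D_v Psi z = v *m invmx (pjac Phi (Psi z))]) ->
  forall i, omega_at (fun z => Psi z 0 i) y.
Proof.
move=> oPhi H i.
pose x := Psi y.
have oJ j k : omega_at (fun z => pjac Phi z j k) x.
  have := omega_partial j (oPhi k).
  by apply: omega_eq; apply: (@ball_near R 'rV[R]_n x _ 1 ltr01) => z _; rewrite mxE.
pose P (f : 'rV[R]_n -> R) := omega_at f x.
have Pc c : P (fun=> c) by exact: omega_cst.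
have PD f g : P f -> P g -> P (fun x => f x + g x) by exact: omega_add.
have PM f g : P f -> P g -> P (fun x => f x * g x) by exact: omega_mul.
have od : omega_at (fun z => (\det (pjac Phi z))^-1) x.
  apply: omega_inv; first exact: (det_closed Pc PD PM oJ).
  by have [+ _ _] := nbhs_singleton H; rewrite unitmxE unitfE.
pose G (j k : 'I_n) z := (\det (pjac Phi z))^-1 * (\adj (pjac Phi z)) j k.
have oG j k : omega_at (G j k) x.
  exact: (omega_mul od (adj_closed Pc PD PM oJ j k)).
have -> : (fun z => Psi z 0 i) = (fun z : 'rV[R]_n => z 0 i) \o Psi by [].
apply: (omega_flow (G := G)) => //; last exact: omega_coord.
apply: filterS H => z [uz dz Ez]; split=> // j k.
rewrite -derive_row // Ez -rowE mxE /invmx uz.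
by rewrite [LHS]mxE.
Qed.

(** * Power series and factorial bounds *)

Lemma differentiable_partial_eps (R : realType) (n : nat) (g : 'rV[R]_n -> R)
    (x : 'rV[R]_n) (l : 'I_n -> R) :
  (forall e : R, 0 < e -> \forall h \near (0 : 'rV[R]_n),
    `|g (h + x) - g x - \sum_i h 0 i * l i| <= e * `|h|) ->
  differentiable g x /\ forall i, partial i g x = l i.
Proof.
move=> H; pose C : 'M[R]_(n, 1) := \col_i l i.
(* The target is viewed as row vectors of length 1 so that the candidate differential is a matrix
   multiplication, which is already bundled as a linear map. *)
pose F (y : 'rV[R]_n) : 'rV[R]_1 := (g y)%:M.
have cC : continuous (mulmxr C : 'rV[R]_n -> 'rV[R]_1).
  by move=> v; have /= := @Ck_mulmx R n 1 0 C setT openT; apply.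
have [e e0|dF E] := @differentiable_eps R 'rV[R]_n 'rV[R]_1 F x (mulmxr C) cC.
  have := H e e0; apply: (@filterS _ _ (nbhs_filter (0 : 'rV[R]_n))) => h Hh.
  apply: norm_le_coord; first exact: le_trans Hh.
  move=> j; rewrite ord1 /F /= !mxE eqxx !mulr1n.
  by under eq_bigr do rewrite mxE.
have gE : (fun y => F y 0 0) = g by apply/funext => y; rewrite /F mxE eqxx mulr1n.
split=> [|i]; first by have := (differentiable_rowP _ _).1 dF 0; rewrite gE.
rewrite -gE; apply: etrans (esym (derive_row (delta_mx 0 i) 0 dF)) _.
have -> : 'D_(delta_mx 0 i) F x = delta_mx 0 i *m C.
  apply: etrans (deriveE _ dF) _.
  exact: (congr1 (fun k : 'rV[R]_n -> 'rV[R]_1 => k (delta_mx 0 i)) E).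
by rewrite -rowE !mxE.
Qed.

Lemma taylor1_ball (R : realType) (n : nat) (g : 'rV[R]_n -> R) (x h : 'rV[R]_n)
    (r M : R) : 0 <= M -> ball x r (x + h) ->
  (forall y, ball x r y -> differentiable g y) ->
  (forall i y, ball x r y -> differentiable (partial i g) y) ->
  (forall i j y, ball x r y -> `|partial j (partial i g) y| <= M) ->
  `|g (x + h) - g x - \sum_i h 0 i * partial i g x| <= n%:R * (n%:R * M) * `|h| ^+ 2.
Proof.
move=> M0 bh dg dpg H.
have r0 : 0 < r.
  have : `|x + h - x| < r by exact/(@ball_normP R 'rV[R]_n).
  exact: le_lt_trans.
have bx : ball x r x by exact: ballxx.
have B (t : R) : 0 <= t <= 1 -> ball x r (x + t *: h) by exact: ball_segment.
have [t t01 ->] := mvt_line (fun t t01 => dg _ (B t t01)).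
rewrite derive_partial; last exact/dg/B.
rewrite -sumrB.
have -> : n%:R * (n%:R * M) * `|h| ^+ 2 = \sum_(i < n) (`|h| * (n%:R * M * `|h|)).
  by rewrite sumr_const card_ord -mulr_natl; ring.
apply: le_trans (ler_norm_sum _ _ _) _; apply: ler_sum => i _.
rewrite -mulrBr normrM ler_pM //; first exact: coord_le_norm.
apply: le_trans (lipschitz_ball (dpg i) (fun y j => H i j y) bx (B t t01)) _.
rewrite addrAC subrr add0r normrZ ler_wpM2l ?mulr_ge0 //.
by have /andP[t0 t1] := t01; rewrite ger0_norm // ler_piMl.
Qed.

Lemma cvg_sumR (R : realType) (I : Type) (s : seq I) (u : I -> nat -> R) (l : I -> R) :
  (forall i, u i N @[N --> \oo] --> l i) ->
  \sum_(i <- s) u i N @[N --> \oo] --> \sum_(i <- s) l i.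
Proof.
move=> H; elim: s => [|i s IH].
  by under eq_fun do rewrite big_nil; rewrite big_nil; exact: cvg_cst.
by under eq_fun do rewrite big_cons; rewrite big_cons; exact: cvgD.
Qed.

(* Differentiation passes to pointwise limits when second derivatives are
   uniformly bounded (Landau's interpolation inequality). *)
Lemma lim_partial (R : realType) (n : nat) (U : set 'rV[R]_n)
    (g_ : nat -> 'rV[R]_n -> R) (g : 'rV[R]_n -> R) (M : R) :
  open U -> 0 <= M -> (forall N, smooth_on U (g_ N)) ->
  (forall N i j x, U x -> `|partial j (partial i (g_ N)) x| <= M) ->
  (forall x, U x -> g_ N x @[N --> \oo] --> g x) ->
  forall x, U x -> differentiable g x /\
    forall i, partial i (g_ N) x @[N --> \oo] --> partial i g x.
Proof.
move=> oU M0 sg H cg x Ux.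
have Un : nbhs x U by exact: open_nbhs_nbhs.
have [r r0 rU] := near_ball Un.
pose K := n%:R * (n%:R * M); have K0 : 0 <= K by rewrite !mulr_ge0.
have key N (h : 'rV[R]_n) : ball x r (x + h) ->
    `|g_ N (x + h) - g_ N x - \sum_i h 0 i * partial i (g_ N) x| <= K * `|h| ^+ 2.
  move=> bh; apply: (taylor1_ball M0 bh) => [y /rU|i y /rU|i j y /rU].
  - exact: (smooth_differentiable (sg N)).
  - exact: (smooth_differentiable (smooth_partial i (sg N))).
  - exact: H.
have cu i : cvg (partial i (g_ N) x @[N --> \oo]).
  apply: cauchy_cvg; apply: cauchy_exP => e e0.
  (* A difference quotient with step t differs from the partial derivative by at most K t, here at
     most e / 2, uniformly in N. *)
  pose t := Num.min (r / 2) (e / (2 * (K + 1))).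
  have K1 : 0 < K + 1 by rewrite ltr_wpDl.
  have t0 : 0 < t by rewrite lt_min !divr_gt0 // mulr_gt0.
  pose h : 'rV[R]_n := t *: delta_mx 0 i.
  have nh : `|h| <= t.
    apply: norm_le_coord => [|j]; first exact: ltW.
    rewrite !mxE eqxx normrM (gtr0_norm t0) ler_piMr ?(ltW t0) //.
    by case: (j == i); rewrite ?normr1 ?normr0.
  have bh : ball x r (x + h).
    apply/ball_normP; rewrite addrAC subrr add0r; apply: le_lt_trans nh _.
    by apply: le_lt_trans (_ : r / 2 < r); rewrite ?ge_min ?lexx // ltr_pdivrMr // ltr_pMr // ltr1n.
  have sh N : \sum_j h 0 j * partial j (g_ N) x = t * partial i (g_ N) x.
    rewrite (bigD1 i) //= big1 ?addr0 => [|j ji]; first by rewrite !mxE !eqxx mulr1.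
    by rewrite !mxE (negPf ji) andbF mulr0 mul0r.
  have te : 0 < t * (e / 2) by rewrite mulr_gt0 // divr_gt0.
  have cD : g_ N (x + h) - g_ N x @[N --> \oo] --> g (x + h) - g x.
    by apply: cvgB; [exact/cg/rU|exact: cg].
  (* The difference quotient of the limit serves as centre: it is e / 2-close to the quotients of
     [g_ N] for large N, hence e-close to their partial derivatives. *)
  exists ((g (x + h) - g x) / t).
  have /cvgrPdist_lt/(_ _ te) := cD; apply: filterS => N HN.
  apply/ball_normP; have := key N h bh; rewrite sh.
  have Kh : K * `|h| ^+ 2 <= t * (e / 2).
    apply: le_trans (_ : K * t ^+ 2 <= _).
      by rewrite ler_wpM2l // lerXn2r // nnegrE // ltW.
    rewrite expr2 mulrCA ler_pM2l //.
    apply: le_trans (_ : (K + 1) * (e / (2 * (K + 1))) <= _).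
      by rewrite ler_pM ?(ltW t0) // ?lerDl // ge_min lexx orbT.
    have -> // : (K + 1) * (e / (2 * (K + 1))) = e / 2 by field; rewrite gt_eqF.
  move: HN Kh; move: (g_ N (x + h) - g_ N x) (partial i (g_ N) x) (g (x + h) - g x) => a u b h1 h2 h3.
  rewrite -(ltr_pM2l t0) -{1}(gtr0_norm t0) -normrM mulrBr mulrCA mulfV ?gt_eqF // mulr1.
  have -> : t * u - b = (a - b) - (a - t * u) by ring.
  apply: le_lt_trans (ler_normB _ _) _.
  have -> : t * e = t * (e / 2) + t * (e / 2) by field.
  by rewrite distrC; apply: ltr_leD => //; apply: le_trans h2.
pose l i := lim (partial i (g_ N) x @[N --> \oo]).
have kl (h : 'rV[R]_n) : ball x r (x + h) ->
    `|g (x + h) - g x - \sum_i h 0 i * l i| <= K * `|h| ^+ 2.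
  move=> bh; apply: (@ler_cvg_to _ \oo _ _
    (fun N => `|g_ N (x + h) - g_ N x - \sum_i h 0 i * partial i (g_ N) x|)
    (fun=> K * `|h| ^+ 2)).
  - apply: cvg_norm; apply: cvgB.
      by apply: cvgB; [exact/cg/rU|exact: cg].
    apply: (@cvg_sumR R 'I_n _ (fun i N => h 0 i * partial i (g_ N) x)
      (fun i => h 0 i * l i)) => i.
    apply: cvgM; first exact: cvg_cst.
    exact: cu.
  - exact: cvg_cst.
  - by apply: nearW => N; exact: key.
have [dg E] : differentiable g x /\ forall i, partial i g x = l i.
  apply: differentiable_partial_eps => e e0.
  have K1 : 0 < K + 1 by rewrite ltr_wpDl.
  have m0 : 0 < Num.min r (e / (K + 1)) by rewrite lt_min r0 divr_gt0.
  apply: (ball_near m0) => h /ball_normP; rewrite subr0 lt_min => /andP[hr he].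
  rewrite (addrC h); apply: le_trans (kl h _) _.
    by apply/ball_normP; rewrite addrAC subrr add0r.
  rewrite expr2 mulrA ler_wpM2r //.
  apply: le_trans (_ : (K + 1) * `|h| <= _); first by rewrite ler_wpM2r // lerDl.
  by rewrite mulrC -ler_pdivlMr // ltW.
by split=> // i; rewrite E; exact: cu.
Qed.

Lemma smooth_of_Dword (R : realType) (n : nat) (U : set 'rV[R]_n)
    (f : 'rV[R]_n -> R) : open U ->
  (forall J x, U x -> differentiable (Dword J f) x) -> smooth_on U f.
Proof.
move=> oU H k.
suff : forall J, Ck_on k U (Dword J f) by move/(_ [::]).
elim: k => [|k IH] J.
  by move=> x Ux; exact/differentiable_continuous/H.
apply: Ck_partialP => // [x|i]; first exact: H.
by have := IH (rcons J i); rewrite Dword_rcons.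
Qed.

(** Convergence passes from a word to the words one letter longer; the uniform second-derivative
    bound needed for that is the majorant at length plus two. *)
Lemma lim_majorant (R : realType) (n : nat) (U : set 'rV[R]_n)
    (f_ : nat -> 'rV[R]_n -> R) (f : 'rV[R]_n -> R) (a : nat -> R) :
  open U -> (forall k, 0 <= a k) -> (forall N, majorant U (f_ N) a) ->
  (forall x, U x -> f_ N x @[N --> \oo] --> f x) -> majorant U f a.
Proof.
move=> oU a0 mf cf.
have L J : (forall x, U x -> Dword J (f_ N) x @[N --> \oo] --> Dword J f x) ->
    forall x, U x -> differentiable (Dword J f) x /\
    forall i, partial i (Dword J (f_ N)) x @[N --> \oo] --> partial i (Dword J f) x.
  move=> cJ; apply: (@lim_partial _ _ _ _ _ ((size J).+2`!%:R * a (size J).+2) oU) => //.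
  - by rewrite mulr_ge0.
  - by move=> N; exact/Dword_smooth/(mf N).1.
  - move=> N i j x Ux; have := (mf N).2 (rcons (rcons J i) j) x Ux.
    by rewrite !Dword_rcons !size_rcons.
have {}cf J : forall x, U x -> Dword J (f_ N) x @[N --> \oo] --> Dword J f x.
  elim/last_ind: J => [|J i IH] //.
  move=> x Ux; have [_ /(_ i)] := L J IH x Ux.
  have -> : (fun N => Dword (rcons J i) (f_ N) x) = (fun N => partial i (Dword J (f_ N)) x).
    by apply/funext => N; rewrite Dword_rcons.
  by rewrite Dword_rcons.
split=> [|J x Ux].
  by apply: smooth_of_Dword => // J x Ux; have [] := L J (cf J) x Ux.
apply: (@ler_cvg_to _ \oo _ _ (fun N => `|Dword J (f_ N) x|)
  (fun=> (size J)`!%:R * a (size J))).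
- by apply: cvg_norm; exact: cf.
- exact: cvg_cst.
- by apply: nearW => N; exact: (mf N).2.
Qed.

(** On the ball of radius r, each factor x_i - a_i has the majorant r + t, whose value at t = r is
    2r. Hence the weighted norm is controlled by the monomial at the point with all coordinates
    2r. *)
Lemma nagumo_monomial (R : realType) (n : nat) (a : 'rV[R]_n) (r : R)
    (alpha : {ffun 'I_n -> nat}) : 0 < r ->
  nagumo (ball a r) r (fun x => monomial (x - a) alpha) (monomial (const_mx (r + r)) alpha).
Proof.
move=> r0; rewrite /monomial; apply: nagumo_prod => [||i]; first exact: ball_open.
  exact: ltW.
have -> : (fun x => (x - a) ord0 i ^+ alpha i) =
    (fun x => \prod_(k < alpha i) (x 0 i - a 0 i)).
  by apply/funext => x; rewrite prodr_const card_ord !mxE.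
have -> : (const_mx (r + r) : 'rV[R]_n) ord0 i ^+ alpha i = \prod_(k < alpha i) (r + r).
  by rewrite prodr_const card_ord mxE.
apply: nagumo_prod => [||_]; first exact: ball_open.
  exact: ltW.
apply: nagumo_coord; rewrite ?(ltW r0) //; first exact: ball_open.
move=> x /ball_normP xr; apply: le_trans (ltW xr).
by have := coord_le_norm (x - a) 0 i; rewrite !mxE.
Qed.

(** Absolute convergence at the single point a + (2r, ..., 2r) bounds the weighted norms of all
    partial sums at once; these bounds then pass to the limit. *)
Lemma analytic_omegaR (R : realType) (n : nat) (f : 'rV[R]_n -> R) (a : 'rV[R]_n) :
  analytic_at f a -> omega_at f a.
Proof.
move=> [c /near_ball[e e0 H]].
(* With this r the test point is at distance at most 2r = e / 2 from a, inside the region of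
   convergence. *)
pose r := e / 4; have r0 : 0 < r by rewrite divr_gt0.
pose x1 : 'rV[R]_n := a + const_mx (r + r).
have bx1 : ball a e x1.
  apply/ball_normP; rewrite /x1 addrAC subrr add0r.
  apply: le_lt_trans (_ : r + r < e); last by rewrite /r; lra.
  apply: norm_le_coord => [|j]; first by rewrite addr_ge0 // ltW.
  by rewrite mxE ger0_norm // addr_ge0 // ltW.
have [[B HB] _] := H _ bx1.
have x1a : x1 - a = const_mx (r + r) by rewrite /x1 addrAC subrr add0r.
pose f_ N x : R := \sum_(alpha : {ffun 'I_n -> 'I_N})
         monomial (x - a) (box_index alpha) *: c (box_index alpha).
have oU : open (ball a r) by exact: ball_open.
have gf N : nagumo (ball a r) r (f_ N) B.
  apply: nagumo_le (lexx r) _ _; first exact: ltW.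
    exact: (HB N).
  rewrite x1a; apply: nagumo_sum => // alpha.
  have mr0 : 0 <= monomial (const_mx (r + r) : 'rV[R]_n) (box_index alpha).
    by apply: prodr_ge0 => i _; rewrite mxE exprn_ge0 // addr_ge0 // ltW.
  rewrite normrM (ger0_norm mr0).
  apply: nagumo_mul => //; first exact: ltW.
    exact: nagumo_monomial.
  exact: nagumo_cst.
have B0 := nagumo_ge0 (gf 0%N).
pose b k := B * r^-1 ^+ k.
have mf N : majorant (ball a r) (f_ N) b.
  split; first exact: nagumo_smooth (gf N).
  by move=> J x Ux; exact: (nagumo_Dword_le r0 (gf N)).
have [sf Hf] : majorant (ball a r) f b.
  apply: (lim_majorant oU _ mf) => [k|x bx].
    by rewrite mulr_ge0 // exprn_ge0 // invr_ge0 ltW.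
  have [_ +] : (exists B : R, forall N : nat,
         \sum_(alpha : {ffun 'I_n -> 'I_N})
           `|monomial (x - a) (box_index alpha) *: c (box_index alpha)| <= B) /\
      (fun N : nat => \sum_(alpha : {ffun 'I_n -> 'I_N})
         monomial (x - a) (box_index alpha) *: c (box_index alpha))
        @ \oo --> f x.
    by apply: H; apply: le_ball bx; rewrite /r; lra.
  by [].
have g := nagumo_of_Dword_le r0 B0 sf Hf.
apply: (nagumo_omega oU _ _ g); last by rewrite divr_gt0.
exact: ballxx.
Qed.

Lemma analytic_coord (R : realType) (n m : nat) (f : 'rV[R]_n -> 'rV[R]_m)
    (a : 'rV[R]_n) j : analytic_at f a -> analytic_at (fun x => f x 0 j) a.
Proof.
move=> [c H]; exists (fun alpha => c alpha 0 j).
apply: (@filterS _ (nbhs a) (nbhs_filter a) _ _ _ H) => x [[B HB] L]; split.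
  exists B => N; apply: le_trans (HB N); apply: ler_sum => alpha _.
  by have := coord_le_norm (monomial (x - a) (box_index alpha) *: c (box_index alpha)) 0 j; rewrite mxE.
have -> : (fun N : nat => \sum_(alpha : {ffun 'I_n -> 'I_N})
         monomial (x - a) (box_index alpha) *: c (box_index alpha) 0 j) =
  (fun N : 'rV[R]_m => N 0 j) \o (fun N : nat => \sum_(alpha : {ffun 'I_n -> 'I_N})
         monomial (x - a) (box_index alpha) *: c (box_index alpha)).
  by apply/funext => N /=; rewrite summxE; apply: eq_bigr => alpha _; rewrite mxE.
by apply: (cvg_comp _ _ L); exact: coord_continuous.
Qed.

Lemma analytic_row (R : realType) (n m : nat) (f : 'rV[R]_n -> 'rV[R]_m)
    (a : 'rV[R]_n) :
  (forall j, analytic_at (fun x => f x 0 j) a) -> analytic_at f a.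
Proof.
move=> H; have {}H j := cid (H j).
pose c alpha : 'rV[R]_m := \row_j sval (H j) alpha.
exists c.
have := filter_forall (nbhs_filter a) (fun j => svalP (H j)).
apply: (@filterS _ (nbhs a) (nbhs_filter a)) => x Hx; split.
  have {Hx}Hx j := cid (Hx j).1.
  exists (\sum_j sval (Hx j)) => N.
  apply: le_trans (_ : \sum_j \sum_(alpha : {ffun 'I_n -> 'I_N})
     `|monomial (x - a) (box_index alpha) *: sval (H j) (box_index alpha)| <= _); last first.
    by apply: ler_sum => j _; exact: (svalP (Hx j)).
  rewrite exchange_big; apply: ler_sum => alpha _.
  apply: norm_le_coord => [|j]; first exact: sumr_ge0.
  by rewrite !mxE (bigD1 j) //= lerDl sumr_ge0.
have E N : \sum_(alpha : {ffun 'I_n -> 'I_N})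
         monomial (x - a) (box_index alpha) *: c (box_index alpha) =
   \row_j \sum_(alpha : {ffun 'I_n -> 'I_N})
         monomial (x - a) (box_index alpha) *: sval (H j) (box_index alpha).
  apply/rowP => j; rewrite mxE summxE; apply: eq_bigr => alpha _.
  by rewrite !mxE.
apply/cvgrPdist_lt => e e0.
have FF : Filter (\oo : set_system nat) by exact: eventually_filter.
have Hj j := (@cvgrPdist_lt R _ _ _ FF _ _).1 (Hx j).2 e e0.
have := filter_forall FF Hj; apply: filterS => N HN.
rewrite E; apply: norm_lt_coord => // j.
by have := HN j; rewrite !mxE.
Qed.

(** * Taylor expansion over words and return to power series *)

(** The [phi i] stand for the successive derivatives. Bounding (1 - t)^K by 1 leaves the factor K +
    1 in place of 1; the geometric decay of M in the application makes up for it. *)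
Lemma taylor_remainder (R : realType) (phi : nat -> R -> R) (K : nat) (M : R) :
  (forall i (t : R), (i <= K)%N -> 0 <= t <= 1 -> is_derive t 1 (phi i) (phi i.+1 t)) ->
  (forall t : R, 0 <= t <= 1 -> `|phi K.+1 t| <= K.+1`!%:R * M) ->
  `|phi 0%N 1 - \sum_(i < K.+1) phi i 0 / i`!%:R| <= K.+1%:R * M.
Proof.
move=> dphi H.
(* The mean value theorem is applied to the Taylor polynomial at 1 as a
   function of its base point. *)
pose G k (t : R) := \sum_(i < k.+1) phi i t * ((1 - t) ^+ i / i`!%:R).
(* The derivative telescopes: differentiating the weight of each new term cancels what the previous
   terms left over. *)
have dG k (t : R) : (k <= K)%N -> 0 <= t <= 1 ->
    is_derive t 1 (G k) (phi k.+1 t * ((1 - t) ^+ k / k`!%:R)).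
  move=> + t01; elim: k => [|k IH] kK.
    have -> : G 0%N = phi 0%N.
      by apply/funext => s; rewrite /G big_ord1 expr0 divr1 mulr1.
    by rewrite expr0 divr1 mulr1; exact: dphi.
  have -> : G k.+1 = G k + (phi k.+1 * (fun s => (1 - s) ^+ k.+1 / k.+1`!%:R)).
    by apply/funext => s; rewrite /G big_ord_recr.
  have d1 : is_derive t 1 (fun s : R => (1 - s) ^+ k.+1 / k.+1`!%:R)
      (- ((1 - t) ^+ k / k`!%:R)).
    have d0 : is_derive t 1 ((cst 1 - id : R -> R) ^+ k.+1 * cst (k.+1`!%:R^-1))
      (((cst 1 - id : R -> R) ^+ k.+1) t *: 0 + cst (k.+1`!%:R^-1) t *: ((k.+1%:R * (cst 1 - id : R -> R) t ^+ k) *: (0 - 1))).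
      by apply: is_deriveM.
    have <- : ((cst 1 - id : R -> R) ^+ k.+1 * cst (k.+1`!%:R^-1)) = (fun s : R => (1 - s) ^+ k.+1 / k.+1`!%:R).
      by apply/funext => s; rewrite !fctE.
    apply: is_derive_eq; rewrite scaler0 add0r /= sub0r scalerN /GRing.scale /=.
    rewrite mulr1 factS natrM !fctE; field.
    by rewrite addrC natr1 !pnatr_eq0 andbT -lt0n fact_gt0.
  have := is_deriveD (IH (ltnW kK)) (is_deriveM (dphi k.+1 t kK t01) d1).
  move/(is_derive_eq); apply.
  rewrite /GRing.scale /=; ring.
have DK (t : R) : 0 <= t <= 1 -> is_derive t 1 (G K) (phi K.+1 t * ((1 - t) ^+ K / K`!%:R)).
  exact: dG.
have Do (t : R) : t \in `]0, 1[%R ->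
    is_derive t 1 (G K) (phi K.+1 t * ((1 - t) ^+ K / K`!%:R)).
  by rewrite in_itv /= => /andP[t0 t1]; apply: DK; rewrite !ltW.
have cG : {within `[0, 1], continuous (G K)}.
  apply: derivable_within_continuous => t; rewrite in_itv /= => /DK [] //.
have [t] := @MVT_segment R (G K) _ 0 1 ler01 Do cG.
rewrite in_itv /= => t01.
have -> : G K 1 = phi 0%N 1.
  rewrite /G big_ord_recl subrr expr0 divr1 mulr1 big1 ?addr0 // => i _.
  by rewrite expr0n mul0r mulr0.
have -> : G K 0 = \sum_(i < K.+1) phi i 0 / i`!%:R.
  by apply: eq_bigr => i _; rewrite subr0 expr1n mul1r.
move=> ->; rewrite subr0 mulr1 normrM.
have /andP[t0 t1] := t01.
have f0 : 0 < K`!%:R :> R by rewrite ltr0n fact_gt0.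
have p1 : 0 <= (1 - t) ^+ K <= 1.
  by rewrite exprn_ge0 ?subr_ge0 // exprn_ile1 ?subr_ge0 // gerBl.
have /andP[p10 p11] := p1.
rewrite (ger0_norm (divr_ge0 p10 (ltW f0))).
apply: le_trans (_ : `|phi K.+1 t| * (1 / K`!%:R) <= _).
  by rewrite ler_wpM2l // ler_pM2r ?invr_gt0.
rewrite mul1r ler_pdivrMr //; apply: le_trans (H t t01) _.
by rewrite factS natrM -mulrA [_ * M]mulrC mulrA.
Qed.

Lemma derive_sumZ (R : realType) (V : normedModType R) (I : Type) (s : seq I)
    (c : I -> R) (f : I -> V -> R) (x v : V) :
  (forall i, differentiable (f i) x) ->
  'D_v (fun y => \sum_(i <- s) c i * f i y) x = \sum_(i <- s) c i * 'D_v (f i) x.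
Proof.
move=> df.
suff [] : differentiable (fun y => \sum_(i <- s) c i * f i y) x /\
  'D_v (fun y => \sum_(i <- s) c i * f i y) x = \sum_(i <- s) c i * 'D_v (f i) x by [].
elim: s => [|i s [IH1 IH2]].
  have -> : (fun y => \sum_(i <- [::]) c i * f i y) = cst 0.
    by apply/funext => y; rewrite big_nil.
  by rewrite big_nil derive_cst; split=> //; exact: differentiable_cst.
have -> : (fun y => \sum_(i <- (i :: s)) c i * f i y) =
    c i \*: f i + (fun y => \sum_(i <- s) c i * f i y).
  by apply/funext => y; rewrite big_cons.
have d1 : differentiable (c i \*: f i) x by exact: differentiableZ.
split; first exact: differentiableD.
rewrite deriveD; [|exact: diff_derivable..].
rewrite IH2 big_cons deriveZ //; exact: diff_derivable.
Qed.

Lemma big_tuple_cons (R : nmodType) (n k : nat) (F : seq 'I_n -> R) :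
  \sum_(J : k.+1.-tuple 'I_n) F J = \sum_(i < n) \sum_(J : k.-tuple 'I_n) F (i :: J).
Proof.
rewrite pair_big /=.
rewrite (reindex (fun p : 'I_n * k.-tuple 'I_n => [tuple of p.1 :: p.2])) //=.
exists (fun J : k.+1.-tuple 'I_n => (thead J, [tuple of behead J])).
  by move=> [i J] _ /=; congr (_, _); exact: val_inj.
by move=> J _; rewrite [RHS]tuple_eta; exact: val_inj.
Qed.

Definition iterD (R : realType) (n : nat) (h : 'rV[R]_n) (k : nat)
  (f : 'rV[R]_n -> R) := iter k (fun g x => 'D_h g x) f.

Lemma iterD_smooth (R : realType) (n : nat) (U : set 'rV[R]_n) (h : 'rV[R]_n) k
    (f : 'rV[R]_n -> R) : smooth_on U f -> smooth_on U (iterD h k f).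
Proof.
by move=> sf; elim: k => [|k IH] // m; have [_] := IH m.+1; apply.
Qed.

(** Each further derivative along h is outermost and puts its letter in front of the word, whereas
    [Dword] differentiates along the first letter innermost; hence the reversal. *)
Lemma iterD_words (R : realType) (n : nat) (U : set 'rV[R]_n) (h : 'rV[R]_n) k
    (f : 'rV[R]_n -> R) x : open U -> smooth_on U f -> U x ->
  iterD h k f x =
  \sum_(J : k.-tuple 'I_n) (\prod_(j <- J) h 0 j) * Dword (rev J) f x.
Proof.
move=> oU sf; elim: k x => [|k IH] x Ux.
  rewrite (big_pred1 [tuple]) => [|J]; last by rewrite [J]tuple0.
  by rewrite big_nil mul1r.
have dJ (J : k.-tuple 'I_n) : differentiable (Dword (rev J) f) x.
  exact: (smooth_differentiable (Dword_smooth _ sf)).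
have -> : iterD h k.+1 f x = 'D_h (iterD h k f) x by [].
have -> : 'D_h (iterD h k f) x = 'D_h (fun y => \sum_(J : k.-tuple 'I_n)
    (\prod_(j <- J) h 0 j) * Dword (rev J) f y) x.
  by apply: near_eq_derive; exact: (near_eq_open oU IH).
rewrite derive_sumZ //.
rewrite (big_tuple_cons k (fun J => (\prod_(j <- J) h 0 j) * Dword (rev J) f x)).
rewrite exchange_big /=; apply: eq_bigr => J _.
rewrite derive_partial // mulr_sumr; apply: eq_bigr => i _.
by rewrite big_cons rev_cons Dword_rcons /GRing.scale /= mulrA [_ * h 0 i]mulrC.
Qed.

Definition word_type (n : nat) (J : seq 'I_n) : {ffun 'I_n -> nat} :=
  [ffun i => count_mem i J].

Lemma word_typeE (n : nat) (J : seq 'I_n) i : word_type J i = count_mem i J.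
Proof. by rewrite ffunE. Qed.

Lemma box_indexE (n N : nat) (alpha : {ffun 'I_n -> 'I_N}) i :
  box_index alpha i = alpha i.
Proof. by rewrite ffunE. Qed.

Lemma monomial_word_type (R : realType) (n : nat) (h : 'rV[R]_n) (J : seq 'I_n) :
  monomial h (word_type J) = \prod_(j <- J) h 0 j.
Proof.
transitivity (\prod_i h 0 i ^+ count_mem i J).
  by apply: eq_bigr => i _; rewrite word_typeE.
elim: J => [|j J IH]; first by rewrite big_nil big1 // => i _; rewrite expr0.
rewrite big_cons -IH (bigD1 j) //= [in RHS](bigD1 j) //= eqxx exprS -!mulrA.
congr (_ * (_ * _)); apply: eq_bigr => i ij.
by rewrite eq_sym (negPf ij).
Qed.

Lemma sum_word_type (n : nat) (J : seq 'I_n) : (\sum_i word_type J i)%N = size J.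
Proof.
transitivity (\sum_i count_mem i J)%N; first by apply: eq_bigr => i _; rewrite word_typeE.
elim: J => [|j J IH] /=; first by rewrite big1.
rewrite big_split /= IH (bigD1 j) //= eqxx big1 // => i ij.
by rewrite eq_sym (negPf ij).
Qed.

(** Words are grouped by their letter counts. A type in the box is a word using each letter fewer
    than N times, so its length is at most n N and the cut-off at K loses nothing. *)
Lemma box_sum_words (R : nmodType) (n N K : nat) (F : seq 'I_n -> R) :
  (n * N < K)%N ->
  \sum_(alpha : {ffun 'I_n -> 'I_N})
    \sum_(J : (\sum_i box_index alpha i)%N.-tuple 'I_n |
          word_type J == box_index alpha) F J =
  \sum_(k < K) \sum_(J : k.-tuple 'I_n | [forall i, count_mem i J < N]%N) F J.
Proof.
move=> NK; symmetry.
transitivity (\sum_(k < K) \sum_(alpha : {ffun 'I_n -> 'I_N})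
    \sum_(J : k.-tuple 'I_n | word_type J == box_index alpha) F J).
  apply: eq_bigr => k _; rewrite (exchange_big_dep xpredT) //= big_mkcond /=.
  apply: eq_bigr => J _; case: forallP => [H|H].
    pose alpha0 : {ffun 'I_n -> 'I_N} := [ffun i => Ordinal (H i)].
    rewrite (big_pred1 alpha0) // => alpha /=.
    apply/eqP/eqP => [E|->]; apply/ffunP => i.
      by apply: val_inj; have /ffunP/(_ i) := E; rewrite word_typeE box_indexE ffunE.
    by rewrite word_typeE box_indexE ffunE.
  rewrite big_pred0 // => alpha; apply/eqP => E; apply: H => i.
  by have /ffunP/(_ i) := E; rewrite word_typeE box_indexE => ->.
rewrite exchange_big; apply: eq_bigr => alpha _.
have sK : ((\sum_i box_index alpha i)%N < K)%N.
  apply: leq_ltn_trans NK; rewrite -[n in (n * N)%N]card_ord -sum_nat_const.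
  by apply: leq_sum => i _; rewrite box_indexE ltnW.
rewrite (bigD1 (Ordinal sK)) //= [X in _ + X = _]big1 ?addr0 // => k kneq.
rewrite big_pred0 // => J; apply/eqP => E; case/eqP: kneq; apply: val_inj => /=.
by rewrite -E sum_word_type size_tuple.
Qed.

Lemma omega_analyticR (R : realType) (n : nat) (f : 'rV[R]_n -> R) (a : 'rV[R]_n) :
  omega_at f a -> analytic_at f a.
Proof.
move=> [e [r [A [e0 r0 gf]]]].
have sf := nagumo_smooth gf; have A0 := nagumo_ge0 gf.
have oU : open (ball a e) by exact: ball_open.
have aU : ball a e a by exact: ballxx.
(* Summing over words rather than multi-indices avoids multinomial
   coefficients and the symmetry of higher derivatives. *)
pose c (alpha : {ffun 'I_n -> nat}) : R :=
  \sum_(J : (\sum_i alpha i)%N.-tuple 'I_n | word_type J == alpha)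
     Dword (rev J) f a / (size J)`!%:R.
exists c.
(* There are n^k words of length k, so the series is geometric of ratio q = n |h| / r. The choice
   gives q <= 1/4 rather than 1/2 because the Taylor remainder carries a factor N + 1, bounded by
   2^(N+1). *)
have m0 : 0 < Num.min e (r / (4 * (n%:R + 1))).
  by rewrite lt_min e0 divr_gt0 // mulr_gt0 // ltr_wpDl.
apply: (ball_near m0) => x /ball_normP.
rewrite lt_min => /andP[he hr].
pose h := x - a; have xE : x = a + h by rewrite subrKC.
have bt (t : R) : 0 <= t <= 1 -> ball a e (a + t *: h).
  move=> t01; apply: ball_segment => //; rewrite -xE; exact/ball_normP.
pose q := n%:R * `|h| / r.
have q0 : 0 <= q by rewrite divr_ge0 ?mulr_ge0 ?(ltW r0).
have q4 : q <= 4^-1.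
  rewrite /q ler_pdivrMr //.
  have n1 : 0 < n%:R + 1 :> R by rewrite ltr_wpDl.
  apply: le_trans (_ : (n%:R + 1) * `|h| <= _); first by rewrite ler_wpM2r // lerDl.
  move: hr; rewrite invfM mulrA ltr_pdivlMr // => hr.
  by rewrite mulrC ltW // [4^-1 * r]mulrC.
pose w (J : seq 'I_n) : R := (\prod_(j <- J) h 0 j) * Dword (rev J) f a / (size J)`!%:R.
have wle k (J : k.-tuple 'I_n) y : ball a e y ->
    `|(\prod_(j <- J) h 0 j) * Dword (rev J) f y| <= `|h| ^+ k * (k`!%:R * (A * r^-1 ^+ k)).
  move=> by_; rewrite normrM; apply: ler_pM => //.
    rewrite normr_prod -[k in _ ^+ k](size_tuple J).
    elim: (J : seq _) => [|j s IH]; first by rewrite big_nil expr0.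
    by rewrite big_cons exprS; apply: ler_pM => //; [exact: prodr_ge0|exact: coord_le_norm].
  by have := nagumo_Dword_le r0 gf (rev J) by_; rewrite size_rev size_tuple.
have Dle k y : ball a e y -> `|iterD h k f y| <= k`!%:R * (A * q ^+ k).
  move=> by_; rewrite (iterD_words h k oU sf by_).
  apply: le_trans (ler_norm_sum _ _ _) _.
  apply: le_trans (ler_sum _ (fun J _ => wle k J y by_)) _.
  rewrite sumr_const card_tuple card_ord -[_ *+ (n ^ k)%N]mulr_natl natrX /q !exprMn.
  by rewrite le_eqVlt; apply/orP; left; apply/eqP; ring.
have Wle k : \sum_(J : k.-tuple 'I_n) `|w J| <= A * q ^+ k.
  have f0 : 0 < k`!%:R :> R by rewrite ltr0n fact_gt0.
  apply: le_trans (ler_sum _ (_ : forall J : k.-tuple 'I_n, _ -> `|w J| <= `|h| ^+ k * (A * r^-1 ^+ k))) _.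
    move=> J _; rewrite /w size_tuple normrM normfV (gtr0_norm f0) ler_pdivrMr //.
    apply: le_trans (wle k J a aU) _.
    by rewrite le_eqVlt; apply/orP; left; apply/eqP; ring.
  rewrite sumr_const card_tuple card_ord -[_ *+ (n ^ k)%N]mulr_natl natrX /q !exprMn.
  by rewrite le_eqVlt; apply/orP; left; apply/eqP; ring.
have cE N (alpha : {ffun 'I_n -> 'I_N}) :
    monomial h (box_index alpha) *: c (box_index alpha) =
    \sum_(J : (\sum_i box_index alpha i)%N.-tuple 'I_n | word_type J == box_index alpha) w J.
  rewrite /c /GRing.scale /= mulr_sumr; apply: eq_bigr => J /eqP JE.
  have -> : monomial h (box_index alpha) = \prod_(j <- J) h 0 j.
    by apply: etrans (congr1 (monomial h) (esym JE)) _; exact: monomial_word_type.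
  by rewrite /w mulrA.
have geo M N : (N <= M)%N -> \sum_(N <= k < M) A * q ^+ k <= 2 * A * 2^-1 ^+ N.
  move=> NM; apply: le_trans (_ : \sum_(N <= k < M) A * 2^-1 ^+ k <= _).
    apply: ler_sum => k _; rewrite ler_wpM2l // lerXn2r // ?nnegrE ?invr_ge0 //.
    by apply: le_trans q4 _; rewrite lef_pV2 ?posrE // ler_nat.
  rewrite -mulr_sumr -mulrA [X in _ <= X]mulrCA ler_wpM2l //.
  have -> : \sum_(N <= k < M) (2^-1 : R) ^+ k = 2 * (2^-1 ^+ N - 2^-1 ^+ M).
    rewrite (@telescope_sumr_eq _ _ _ (fun k => - 2 * 2^-1 ^+ k)) // => [|k _].
      by ring.
    by rewrite exprS; field.
  by rewrite ler_pM2l // gerBl exprn_ge0 ?invr_ge0.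
split.
  exists (2 * A) => N.
  have NK : (n * N < (n * N).+1)%N by [].
  apply: le_trans (_ : \sum_(alpha : {ffun 'I_n -> 'I_N})
    \sum_(J : (\sum_i box_index alpha i)%N.-tuple 'I_n | word_type J == box_index alpha)
       `|w J| <= _).
    by apply: ler_sum => alpha _; rewrite cE; exact: ler_norm_sum.
  rewrite (box_sum_words (fun J => `|w J|) NK).
  apply: le_trans (_ : \sum_(k < (n * N).+1) A * q ^+ k <= _).
    apply: ler_sum => k _; apply: le_trans (Wle k).
    by rewrite big_mkcond; apply: ler_sum => J _; case: ifP.
  rewrite -(big_mkord xpredT (fun k => A * q ^+ k)).
  by have := geo _ _ (leq0n (n * N).+1); rewrite expr0 mulr1.
have main N : `|f x - \sum_(alpha : {ffun 'I_n -> 'I_N.+1})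
     monomial h (box_index alpha) *: c (box_index alpha)| <= 3 * A * 2^-1 ^+ N.+1.
  under eq_bigr do rewrite cE.
  pose K := (n * N.+1 + N.+1).+1.
  have NK : (n * N.+1 < K)%N by rewrite ltnS leq_addr.
  rewrite (box_sum_words w NK) -(big_mkord xpredT (fun k =>
    \sum_(J : k.-tuple 'I_n | [forall i, (count_mem i J < N.+1)%N]) w J)).
  (* Words of length at most N all lie in the box and make up the Taylor polynomial; the longer ones
     are an incomplete family, controlled by the absolute geometric tail. *)
  rewrite (big_cat_nat (n := N.+1)) //=; last by rewrite /K leqW // leq_addl.
  have -> : \sum_(0 <= k < N.+1)
      \sum_(J : k.-tuple 'I_n | [forall i, (count_mem i J < N.+1)%N]) w J =
      \sum_(k < N.+1) iterD h k f a / k`!%:R.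
    rewrite big_mkord; apply: eq_bigr => k _.
    rewrite (iterD_words h k oU sf aU) mulr_suml; apply: eq_big => J.
      apply/forallP => i; apply: leq_ltn_trans (count_size _ _) _.
      by rewrite size_tuple.
    by rewrite /w size_tuple.
  rewrite opprD addrA; apply: le_trans (ler_normB _ _) _.
  have -> : 3 * A * 2^-1 ^+ N.+1 = A * 2^-1 ^+ N.+1 + 2 * A * 2^-1 ^+ N.+1 by ring.
  apply: lerD.
    pose phi i (t : R) := iterD h i f (a + t *: h).
    have := @taylor_remainder R phi N (A * q ^+ N.+1).
    rewrite /phi scale1r -xE => T.
    under [X in _ - X]eq_bigr do rewrite -[a in iterD _ _ _ a]addr0 -[X in a + X](scale0r h).
    apply: le_trans (T _ _) _.
    - move=> i t _ t01; apply: is_derive_line.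
      exact: (smooth_differentiable (iterD_smooth h i sf) (bt t t01)).
    - by move=> t t01; exact: (Dle _ _ (bt t t01)).
    rewrite mulrCA ler_wpM2l //.
    apply: le_trans (_ : 2 ^+ N.+1 * 4^-1 ^+ N.+1 <= _).
      apply: ler_pM; rewrite ?exprn_ge0 //.
        by rewrite -natrX ler_nat ltnW // ltn_expl.
      by rewrite lerXn2r // ?nnegrE ?invr_ge0.
    by rewrite -exprMn; have -> : 2 * 4^-1 = 2^-1 :> R by field.
  apply: le_trans (geo K N.+1 _); last by rewrite /K leqW // leq_addl.
  apply: le_trans (ler_norm_sum _ _ _) _; apply: ler_sum => k _.
  apply: le_trans (ler_norm_sum _ _ _) _; apply: le_trans (Wle k).
  by rewrite big_mkcond; apply: ler_sum => J _; case: ifP.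
have g0 : (fun N => 3 * A * 2^-1 ^+ N) @ \oo --> (0 : R).
  have -> : (fun N => 3 * A * 2^-1 ^+ N) = geometric (3 * A) 2^-1 by [].
  by apply: cvg_geometric; rewrite gtr0_norm ?invr_gt0 // invf_lt1 // ltr1n.
apply/cvgrPdist_le => d d0.
have /cvgrPdist_le/(_ d d0)[N0 _ HN] := g0.
exists N0.+1 => // -[|N] // HNN.
apply: le_trans (main N) _.
have := HN N.+1 (leqW HNN); rewrite sub0r normrN; apply: le_trans.
exact: ler_norm.
Qed.

(** * Flatness of the reduced function *)

(** The gradient for the standard inner product of coordinates; the Riemannian metric is traded for
    it in [PL_chart]. *)
Definition grad (R : realType) (n : nat) (F : 'rV[R]_n -> R) (x : 'rV[R]_n) : 'rV[R]_n :=
  \row_i partial i F x.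

Lemma derive_grad (R : realType) (n : nat) (F : 'rV[R]_n -> R) (x v : 'rV[R]_n) :
  differentiable F x -> 'D_v F x = \sum_i v 0 i * grad F x 0 i.
Proof. by move=> dF; rewrite derive_partial //; apply: eq_bigr => i _; rewrite mxE. Qed.

Lemma norm_sqr_le_sum (R : realType) (n : nat) (u : 'rV[R]_n) :
  `|u| ^+ 2 <= \sum_i u 0 i ^+ 2.
Proof.
have S0 : 0 <= \sum_i u 0 i ^+ 2 by apply: sumr_ge0 => i _; exact: sqr_ge0.
have : `|u| <= Num.sqrt (\sum_i u 0 i ^+ 2).
  apply: norm_le_coord => [|j]; first exact: sqrtr_ge0.
  rewrite -sqrtr_sqr ler_sqrt // (bigD1 j) //= lerDl.
  by apply: sumr_ge0 => i _; exact: sqr_ge0.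
by move=> h; rewrite -[leRHS](sqr_sqrtr S0) lerXn2r // nnegrE //; exact: sqrtr_ge0.
Qed.

(** A gradient step of length t = 4 K lowers G by at least t S / 2 = 2 K S, where S is the squared
    gradient. Since G w <= m + K S, the new value would be at most m - K S, which forces S = 0. The
    field g is passed separately, so that it may come from a formula that requires no second
    derivative of G. *)
Lemma PL_flat (R : realType) (n : nat) (G : 'rV[R]_n -> R)
    (g : 'rV[R]_n -> 'rV[R]_n) (s K m : R) : 0 < s -> 0 < K ->
  (forall w, ball 0 (2 * s) w -> differentiable G w) ->
  (forall w u, ball 0 (2 * s) w -> 'D_u G w = \sum_i u 0 i * g w 0 i) ->
  (forall w, ball 0 (2 * s) w -> m <= G w) ->
  (forall w w', ball 0 (2 * s) w -> ball 0 (2 * s) w' ->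
     `|g w' - g w| <= (8 * (n%:R + 1) * K)^-1 * `|w' - w|) ->
  g 0 = 0 ->
  (forall w, ball 0 s w -> G w - m <= K * \sum_i g w 0 i ^+ 2) ->
  forall w, ball 0 s w -> G w = m.
Proof.
move=> s0 K0 dG DG mG lg g0 PL w bw.
have bw2 : ball 0 (2 * s) w.
  by apply: le_ball bw; move: s0; lra.
have b02 : ball (0 : 'rV[R]_n) (2 * s) 0 by apply: ballxx; rewrite mulr_gt0.
have n1 : 1 <= n%:R + 1 :> R by rewrite lerDr.
have n1' : 0 < n%:R + 1 :> R by apply: lt_le_trans n1.
pose c := (8 * (n%:R + 1) * K)^-1.
have c0 : 0 < c by rewrite invr_gt0 !mulr_gt0.
have cK : c * (8 * (n%:R + 1) * K) = 1.
  by rewrite mulVf // gt_eqF // !mulr_gt0.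
pose S := \sum_i g w 0 i ^+ 2.
have S0 : 0 <= S by apply: sumr_ge0 => i _; exact: sqr_ge0.
have gS : `|g w| ^+ 2 <= S by exact: norm_sqr_le_sum.
have gw : `|g w| <= c * `|w| by have := lg _ _ b02 bw2; rewrite g0 !subr0.
have ws : `|w| < s by move: bw => /ball_normP; rewrite subr0.
pose t := 4 * K; have t0 : 0 < t by rewrite mulr_gt0.
(* Thus t c = 1 / (2 (n + 1)): the step from the ball of radius s stays within 2 s, and the change
   of g along it costs at most n t c S <= S / 2. *)
have tc : t * c * (2 * (n%:R + 1)) = 1 by apply: etrans cK; rewrite /t; ring.
have tc1 : t * c <= 1.
  rewrite -tc ler_peMr // ?mulr_ge0 ?(ltW t0) ?(ltW c0) //; lra.
pose h := - t *: g w.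
have bh : ball 0 (2 * s) (w + h).
  apply/ball_normP; rewrite subr0; apply: le_lt_trans (ler_normD _ _) _.
  rewrite normrZ normrN (gtr0_norm t0).
  have : t * `|g w| <= `|w|.
    apply: le_trans (_ : t * (c * `|w|) <= _); first by rewrite ler_pM2l.
    by rewrite mulrA ler_piMl.
  by move: ws; lra.
have B (z : R) : 0 <= z <= 1 -> ball 0 (2 * s) (w + z *: h) by exact: ball_segment.
have [z z01 E] := mvt_line (fun z z01 => dG _ (B z z01)).
have bz := B z z01; have /andP[z0 z1] := z01.
pose D := g (w + z *: h) - g w.
have Dle : `|D| <= c * (t * `|g w|).
  apply: le_trans (lg _ _ bw2 bz) _; rewrite addrAC subrr add0r ler_wpM2l ?(ltW c0) //.
  by rewrite !normrZ normrN (gtr0_norm t0) (ger0_norm z0) ler_piMl // mulr_ge0 // ltW.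
have E2 : 'D_h G (w + z *: h) = - t * (S + \sum_i g w 0 i * D 0 i).
  rewrite DG // mulrDr /S !mulr_sumr -big_split; apply: eq_bigr => i _ /=.
  by rewrite /h /D !mxE; ring.
have cross : `|\sum_i g w 0 i * D 0 i| <= n%:R * (c * t) * S.
  apply: le_trans (ler_norm_sum _ _ _) _.
  apply: le_trans (_ : \sum_(i < n) (c * t) * `|g w| ^+ 2 <= _).
    apply: ler_sum => i _; rewrite normrM.
    apply: le_trans (_ : `|g w| * (c * (t * `|g w|)) <= _).
      apply: ler_pM => //; first exact: coord_le_norm.
      by apply: le_trans Dle; exact: coord_le_norm.
    by rewrite le_eqVlt; apply/orP; left; apply/eqP; ring.
  rewrite sumr_const card_ord -[leLHS]mulr_natl -[leRHS]mulrA ler_wpM2l // ler_wpM2l //.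
  by rewrite mulr_ge0 // ltW.
have cross2 : `|\sum_i g w 0 i * D 0 i| <= 2^-1 * S.
  apply: le_trans cross _; rewrite ler_wpM2r //.
  have -> : n%:R * (c * t) = 2^-1 * (t * c * (2 * (n%:R + 1))) - t * c by field.
  by rewrite tc mulr1 gerBl mulr_ge0 // ltW.
have := mG _ bh; have := PL w bw; rewrite -/S => p1 p2.
have p3 : G (w + h) - G w <= - t * (2^-1 * S).
  rewrite E E2 ler_nM2l ?oppr_lt0 //.
  by move: cross2; rewrite ler_norml => /andP[+ _]; lra.
have S1 : S <= 0.
  have : 0 <= - (K * S) by move: p1 p2 p3; rewrite /t; lra.
  by rewrite oppr_ge0 pmulr_rle0.
have S00 : S = 0 by apply/eqP; rewrite eq_le S1.
have Gm : G w <= m by move: p1; rewrite S00 mulr0 subr_le0.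
by apply/eqP; rewrite eq_le Gm mG.
Qed.

(** * Jacobian calculus and the rank factorization *)

Lemma pjac_comp (R : realType) (n m p : nat) (f : 'rV[R]_n -> 'rV[R]_m)
    (g : 'rV[R]_m -> 'rV[R]_p) (x : 'rV[R]_n) :
  differentiable f x -> differentiable g (f x) ->
  pjac (g \o f) x = pjac f x *m pjac g (f x).
Proof.
move=> df dg; have dgf : differentiable (g \o f) x by exact: differentiable_comp.
have E (v : 'rV[R]_n) : v *m pjac (g \o f) x = v *m pjac f x *m pjac g (f x).
  rewrite -(derive_pjac v dgf) -(derive_pjac _ df) -(derive_pjac _ dg).
  rewrite (deriveE v dgf) (deriveE v df) (deriveE _ dg).
  exact: (congr1 (fun k : 'rV[R]_n -> 'rV[R]_p => k v) (diff_comp df dg)).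
by apply/row_matrixP => i; rewrite !rowE E mulmxA.
Qed.

Lemma differentiable_mulmx (R : realType) (n m : nat) (A : 'M[R]_(n, m)) (x : 'rV[R]_n) :
  differentiable (fun y : 'rV[R]_n => y *m A) x.
Proof. by have [+ _] := @Ck_mulmx R n m 1 A setT openT; apply. Qed.

Lemma derive_mulmx (R : realType) (n m : nat) (A : 'M[R]_(n, m)) (x v : 'rV[R]_n) :
  'D_v (fun y : 'rV[R]_n => y *m A) x = v *m A.
Proof.
have dA := differentiable_mulmx A.
have cA : continuous (mulmxr A : 'rV[R]_n -> 'rV[R]_m).
  by move=> y; exact: (differentiable_continuous (dA y)).
apply: etrans (deriveE _ (dA x)) _.
exact: (congr1 (fun k : 'rV[R]_n -> 'rV[R]_m => k v) (diff_lin x cA)).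
Qed.

Lemma pjac_uniq (R : realType) (n m : nat) (f : 'rV[R]_n -> 'rV[R]_m)
    (x : 'rV[R]_n) (A : 'M[R]_(n, m)) :
  differentiable f x -> (forall v, 'D_v f x = v *m A) -> pjac f x = A.
Proof.
by move=> df H; apply/row_matrixP => i; rewrite !rowE -derive_pjac.
Qed.

Lemma pjac_mulmx (R : realType) (n m : nat) (A : 'M[R]_(n, m)) (x : 'rV[R]_n) :
  pjac (fun y : 'rV[R]_n => y *m A) x = A.
Proof.
apply: pjac_uniq; first exact: differentiable_mulmx.
by move=> v; rewrite derive_mulmx.
Qed.

Lemma pjacD (R : realType) (n m : nat) (f g : 'rV[R]_n -> 'rV[R]_m) (x : 'rV[R]_n) :
  differentiable f x -> differentiable g x ->
  pjac (fun y => f y + g y) x = pjac f x + pjac g x.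
Proof.
move=> df dg; apply: pjac_uniq; first exact: differentiableD.
move=> v; rewrite (@deriveD _ _ _ f g); [|exact: diff_derivable..].
by rewrite !derive_pjac // mulmxDr.
Qed.

Lemma pjac_eq (R : realType) (n m : nat) (f g : 'rV[R]_n -> 'rV[R]_m) (x : 'rV[R]_n) :
  (\forall y \near x, f y = g y) -> pjac f x = pjac g x.
Proof.
move=> fg; apply/matrixP => i j; rewrite !mxE; apply: near_eq_derive.
by apply: (@filterS _ (nbhs x) (nbhs_filter x) _ _ _ fg) => y ->.
Qed.

Lemma grad_affine (R : realType) (n : nat) (F : 'rV[R]_n -> R) (a z : 'rV[R]_n)
    (B : 'M[R]_n) : differentiable F (a + z *m B) ->
  grad (fun y => F (a + y *m B)) z = grad F (a + z *m B) *m B^T.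
Proof.
move=> dF; apply/rowP => i; rewrite !mxE.
pose E (y : 'rV[R]_n) := a + y *m B.
have dE : differentiable E z.
  by apply: (@differentiableD _ _ _ (cst a)) => //; exact: differentiable_mulmx.
apply: etrans (derive_comp_rV (delta_mx 0 i) dE dF) _.
apply: eq_bigr => k _; rewrite !mxE mulrC; congr (_ * _).
apply: etrans (esym (derive_row _ k dE)) _.
rewrite (@deriveD _ _ _ (cst a)) ?derive_cst ?add0r ?derive_mulmx -?rowE ?mxE //.
exact/diff_derivable/differentiable_mulmx.
Qed.

(* The coordinates [i >= d], rather than [i < r], so as to match the slices
   [R^d x {0}] of a submanifold. *)
Definition tail_mx (R : realType) (n d : nat) : 'M[R]_n :=
  \matrix_(i, j) ((i == j) && (d <= i)%N)%:R.

Lemma tail_mxE (R : realType) (n d : nat) (v : 'rV[R]_n) i :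
  (v *m tail_mx R n d) 0 i = if (d <= i)%N then v 0 i else 0.
Proof.
rewrite mxE (bigD1 i) //= big1 => [|k ki]; rewrite mxE.
  by rewrite addr0 eqxx /=; case: ifP; rewrite ?mulr1 ?mulr0.
by rewrite (negPf ki) mulr0.
Qed.

Lemma tail_mx_idem (R : realType) (n d : nat) :
  tail_mx R n d *m tail_mx R n d = tail_mx R n d.
Proof.
apply/row_matrixP => i; rewrite row_mul; apply/rowP => j.
by rewrite tail_mxE !mxE; case: ifP => dj //; case: eqP => //= ->; rewrite dj.
Qed.

Lemma tail_mx_tr (R : realType) (n d : nat) : (tail_mx R n d)^T = tail_mx R n d.
Proof.
by apply/matrixP => i j; rewrite !mxE eq_sym; case: eqP => //= ->.
Qed.

(** The rank factorization by Gaussian elimination puts the identity block first; conjugating with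
    the order-reversing permutation, an involution, moves it to the last coordinates. *)
Lemma tail_decomposition (R : realType) (n : nat) (H : 'M[R]_n) :
  exists d, (d <= n)%N /\ exists L M : 'M[R]_n,
    [/\ L \in unitmx, M \in unitmx & H = L *m tail_mx R n d *m M].
Proof.
pose r := \rank H; have rn : (r <= n)%N := rank_leq_row H.
exists (n - r)%N; split; first exact: leq_subr.
pose s : 'S_n := perm (@rev_ord_inj n).
exists (col_ebase H *m perm_mx s), (perm_mx s *m row_ebase H).
split.
- by rewrite unitmx_mul col_ebase_unit unitmx_perm.
- by rewrite unitmx_mul row_ebase_unit unitmx_perm.
have s1 : (s^-1 = s)%g.
  apply: (mulIg s); rewrite mulVg; apply/permP => i.
  by rewrite permM perm1 !permE rev_ordK.
have E : perm_mx s *m tail_mx R n (n - r) *m perm_mx s = pid_mx r.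
  rewrite -row_permE -{2}s1 -col_permE; apply/matrixP => i j.
  rewrite !mxE !permE (inj_eq rev_ord_inj) -(inj_eq (@ord_inj _)) /=.
  by rewrite leq_sub2lE // ltnS.
by rewrite -{1}(mulmx_ebase H) -E !mulmxA.
Qed.

(** * Normal form of the level set in a chart *)

Lemma norm_delta_mx_le1 (R : realType) (n : nat) (i : 'I_n) :
  `|delta_mx 0 i : 'rV[R]_n| <= 1.
Proof.
apply: norm_le_coord => // j; rewrite mxE eqxx /=.
by case: (j == i); rewrite ?normr1 ?normr0.
Qed.

Lemma local_min_grad (R : realType) (n : nat) (U : set 'rV[R]_n)
    (F : 'rV[R]_n -> R) (x : 'rV[R]_n) : open U -> U x ->
  (forall y, U y -> differentiable F y) -> local_min F x -> grad F x = 0.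
Proof.
move=> oU Ux dF mF; apply/rowP => i; rewrite !mxE.
have Un : nbhs x U by exact: open_nbhs_nbhs.
have [r r0 H] := near_ball (filterI Un mF).
have B (t : R) : t \in `](- r), r[%R -> ball x r (x + t *: delta_mx 0 i).
  rewrite in_itv /= => tr; apply/ball_normP; rewrite addrAC subrr add0r normrZ.
  apply: le_lt_trans (_ : `|t| < r); last by rewrite ltr_norml.
  by rewrite ler_piMr // norm_delta_mx_le1.
have D (t : R) : t \in `](- r), r[%R -> derivable (fun s : R => F (x + s *: delta_mx 0 i)) t 1.
  by move=> /B/H[/dF /is_derive_line[]].
have m0 : (0 : R) \in `](- r), r[%R by rewrite in_itv /= oppr_lt0 r0.
have M (t : R) : t \in `](- r), r[%R ->
    F (x + 0 *: delta_mx 0 i) <= F (x + t *: delta_mx 0 i).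
  by move=> /B/H[_]; rewrite scale0r addr0.
have rr : - r <= r by apply: le_trans (_ : 0 <= _); rewrite ?oppr_le0 ltW.
have [_ E] := @derive1_at_min R (fun s : R => F (x + s *: delta_mx 0 i)) (- r) r 0 rr D m0 M.
have dx : differentiable F (x + 0 *: delta_mx 0 i) by rewrite scale0r addr0; exact: dF.
have [_ E'] := is_derive_line dx.
by move: E'; rewrite E scale0r addr0.
Qed.

Lemma Ck_grad (R : realType) (n k : nat) (U : set 'rV[R]_n) (F : 'rV[R]_n -> R) :
  open U -> Ck_on k.+1 U F -> Ck_on k U (grad F).
Proof.
move=> oU [_ DF]; apply/(Ck_row _ _ oU) => j.
by apply: (Ck_eq oU _ (DF (delta_mx 0 j))) => x Ux; rewrite mxE.
Qed.

Lemma hessian_sym (R : realType) (n : nat) (U : set 'rV[R]_n)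
    (F : 'rV[R]_n -> R) (x : 'rV[R]_n) : open U -> U x -> Ck_on 2 U F ->
  (pjac (grad F) x)^T = pjac (grad F) x.
Proof.
move=> oU Ux CF; apply/matrixP => i j; rewrite !mxE.
have E k : (fun y => grad F y 0 k) = partial k F by apply/funext => y; rewrite mxE.
by rewrite !E; exact: (schwarz (delta_mx 0 i) (delta_mx 0 j) oU Ux CF).
Qed.

(** The factor [tail_mx] annihilates the first d rows of H, and symmetry the first d columns.
    Invertibility of M makes the remaining block nonsingular, so filling the head block with the
    identity P yields an invertible matrix that fixes P. *)
Lemma bordered_unit (R : realType) (n d : nat) (H M : 'M[R]_n) :
  M \in unitmx -> H = tail_mx R n d *m M -> H^T = H ->
  let P := 1%:M - tail_mx R n d in
  [/\ H + P \in unitmx, H *m tail_mx R n d = H,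
      P *m invmx (H + P) = P & invmx (H + P) *m P = P].
Proof.
move=> Mu HE HT P; set E := tail_mx R n d in HE P *.
have EE : E *m E = E := tail_mx_idem R n d.
have EP : E *m P = 0 by rewrite mulmxBr mulmx1 EE subrr.
have PE : P *m E = 0 by rewrite mulmxBl mul1mx EE subrr.
have PP : P *m P = P by rewrite {2}/P mulmxBr mulmx1 PE subr0.
have EH : E *m H = H by rewrite HE mulmxA EE.
have ET : E^T = E := tail_mx_tr R n d.
have HEr : H *m E = H by rewrite -{1}HT -{1}ET -trmx_mul EH HT.
have PH : P *m H = 0 by rewrite mulmxBl mul1mx EH subrr.
have HP : H *m P = 0 by rewrite mulmxBr mulmx1 HEr subrr.
have AP : (H + P) *m P = P by rewrite mulmxDl HP PP add0r.
have PA : P *m (H + P) = P by rewrite mulmxDr PH PP add0r.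
have Au : H + P \in unitmx.
  rewrite -row_free_unit -kermx_eq0; apply/eqP/row_matrixP => i; rewrite row0.
  set u := row i _.
  have uA : u *m (H + P) = 0 by rewrite -row_mul mulmx_ker row0.
  have uP : u *m P = 0 by rewrite -AP mulmxA uA mul0mx.
  have uH : u *m H = 0 by move: uA; rewrite mulmxDr uP addr0.
  have uE : u *m E = 0.
    by have := congr1 (mulmx^~ (invmx M)) uH; rewrite /= HE mulmxA mulmxK // mul0mx.
  by move: uP; rewrite mulmxBr mulmx1 uE subr0.
split=> //; first by rewrite -{1}PA mulmxK.
by rewrite -{2}AP mulKmx.
Qed.

(** Analyticity enters as a clause about the maps already produced, so that the finite and the
    analytic case share the same chart. *)
Lemma slice_normal_form (R : realType) (n d k : nat) (U : set 'rV[R]_n)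
    (F : 'rV[R]_n -> R) (K : R) (M : 'M[R]_n) :
  open U -> U 0 -> Ck_on k.+2 U F -> 0 < K ->
  local_min F 0 ->
  (\forall x \near (0 : 'rV[R]_n), F x - F 0 <= K * \sum_i grad F x 0 i ^+ 2) ->
  M \in unitmx -> pjac (grad F) 0 = tail_mx R n d *m M ->
  exists (V W : set 'rV[R]_n) (Phi Psi : 'rV[R]_n -> 'rV[R]_n),
    [/\ [/\ open V, V 0, V `<=` U & open W],
        forall x, V x -> W (Phi x) /\ Psi (Phi x) = x,
        forall y, W y -> V (Psi y) /\ Phi (Psi y) = y,
        [/\ Ck_on k.+1 V Phi, Ck_on k.+1 W Psi &
          (forall x, U x -> omega_at F x) ->
          (forall x j, V x -> omega_at (fun z => Phi z 0 j) x) /\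
          (forall y j, W y -> omega_at (fun z => Psi z 0 j) y)] &
        forall x, V x -> ((forall i : 'I_n, (d <= i)%N -> Phi x 0 i = 0) <->
           (local_min F x /\ F x = F 0))].
Proof.
move=> oU U0 CF K0 mF PL Mu HE.
have HT : (pjac (grad F) 0)^T = pjac (grad F) 0.
  by apply: (hessian_sym oU U0); apply: Ck_le CF.
have [] := bordered_unit Mu HE HT.
set H := pjac (grad F) 0 in HE HT *; set E := tail_mx R n d in HE *.
set P := 1%:M - E; set A := H + P => Au HEr PAi AiP.
have EE : E *m E = E := tail_mx_idem R n d.
have EP : E *m P = 0 by rewrite mulmxBr mulmx1 EE subrr.
have PE : P *m E = 0 by rewrite mulmxBl mul1mx EE subrr.
have PP : P *m P = P by rewrite {2}/P mulmxBr mulmx1 PE subr0.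
have splitE (v : 'rV[R]_n) : v *m P + v *m E = v.
  by rewrite -mulmxDr subrK mulmx1.
have tailP (v : 'rV[R]_n) : v *m E = 0 <-> forall i : 'I_n, (d <= i)%N -> v 0 i = 0.
  split=> [vE i di|vi]; last first.
    by apply/rowP => i; rewrite tail_mxE mxE; case: ifP => // /vi.
  by have /rowP/(_ i) := vE; rewrite tail_mxE di mxE.
have Cg : Ck_on k.+1 U (grad F) := Ck_grad oU CF.
have dF x : U x -> differentiable F x by exact: CF.1.
have dg x : U x -> differentiable (grad F) x by exact: Cg.1.
have g0 : grad F 0 = 0 := local_min_grad oU U0 dF mF.
(* The head of z is kept and the tail of the gradient inserted; the factor [invmx A] preserves the
   head and normalizes the Jacobian at 0 to (P + H) A^-1 = 1. *)
pose Phi (z : 'rV[R]_n) := z *m (P *m invmx A) + grad F z *m (E *m invmx A).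
have CPhi : Ck_on k.+1 U Phi.
  exact: (Ck_add oU (Ck_mulmx _ _ oU)
    (Ck_comp_row oU openT Cg (Ck_mulmx _ (E *m invmx A) openT) (fun _ _ => I))).
have PhiP z : Phi z *m P = z *m P.
  by rewrite mulmxDl -!mulmxA AiP PP EP mulmx0 addr0.
(* Although [invmx A] mixes the tail coordinates, it does not change where the tail vanishes,
   because [A] fixes the head. *)
have PhiE z : Phi z *m E = 0 <-> grad F z *m E = 0.
  have PhiA : Phi z *m A = z *m P + grad F z *m E.
    by rewrite mulmxDl -!mulmxA !mulVmx // !mulmx1.
  split=> [h|h].
    have : Phi z *m A = z *m P.
      have <- : z *m P *m A = z *m P by rewrite -mulmxA -{1}PAi -!mulmxA mulVmx // mulmx1.
      congr (_ *m _); by rewrite -[LHS]splitE h addr0 PhiP.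
    by rewrite PhiA => /(canRL (addKr _)) ->; rewrite addNr.
  by rewrite /Phi (mulmxA (grad F z)) h mul0mx addr0 PAi -mulmxA PE mulmx0.
have Phi0 : Phi 0 = 0 by rewrite /Phi g0 !mul0mx addr0.
have J1 : pjac Phi 0 = 1%:M.
  rewrite pjacD; last 2 first.
  - exact: differentiable_mulmx.
  - apply: (@differentiable_comp _ _ _ _ (grad F) (fun y => y *m (E *m invmx A))).
      exact: dg.
    exact: differentiable_mulmx.
  rewrite pjac_mulmx (@pjac_comp _ _ _ _ (grad F) (fun y => y *m (E *m invmx A))); last 2 first.
  - exact: dg.
  - exact: differentiable_mulmx.
  by rewrite pjac_mulmx -/H mulmxA HEr -mulmxDl [P + H]addrC mulmxV.
have CPhi1 : Ck_on 1 U Phi by apply: Ck_le CPhi.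
have [r r0 [Psi [rU PsiK PhiK lip]]] := local_inverse oU U0 Phi0 CPhi1 J1.
have PT : P^T = P by rewrite /P linearB /= trmx1 tail_mx_tr.
have nP (v : 'rV[R]_n) : `|v *m P| <= `|v|.
  apply: norm_le_coord => // j; rewrite mulmxBr mulmx1 mxE [X in _ + X]mxE tail_mxE.
  by case: ifP; rewrite ?subrr ?normr0 ?subr0 // coord_le_norm.
have b0r : ball (0 : 'rV[R]_n) r 0 by exact: ballxx.
have r20 : 0 < r / 2 by rewrite divr_gt0.
have b0r2 : ball (0 : 'rV[R]_n) (r / 2) 0 by exact: ballxx.
have Psi0 : Psi 0 = 0.
  by have := PhiK 0 b0r; rewrite Phi0; apply.
have oB (s : R) : open (ball (0 : 'rV[R]_n) s) by exact: ball_open.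
have dPhi x : ball 0 r x -> differentiable Phi x by move=> /rU; exact: CPhi1.1.
have two0 : 0 < 2 :> R by [].
have ID := inverse_derivative (oB r) (oB (r / 2)) two0 PsiK lip dPhi.
have lPsi y y' : ball 0 (r / 2) y -> ball 0 (r / 2) y' ->
    `|Psi y' - Psi y| <= 2 * `|y' - y|.
  move=> by1 by2; have [b1 e1] := PsiK y by1; have [b2 e2] := PsiK y' by2.
  by have := lip _ _ b1 b2; rewrite e1 e2.
have nPsi y : ball 0 (r / 2) y -> `|Psi y| <= 2 * `|y|.
  by move=> by1; have := lPsi _ _ b0r2 by1; rewrite Psi0 !subr0.
(* The head of the gradient. Its Jacobian at 0 is H P = 0, which is the vanishing Hessian of the
   reduced function. *)
pose gP (x : 'rV[R]_n) := grad F x *m P.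
have CgP : Ck_on 1 U gP.
  exact: (Ck_le (ltn0Sn k) (Ck_comp_row oU openT Cg (Ck_mulmx _ P openT) (fun _ _ => I))).
have gPJ : pjac gP 0 = 0.
  rewrite (@pjac_comp _ _ _ _ (grad F) (fun y => y *m P)); last 2 first.
  - exact: dg.
  - exact: differentiable_mulmx.
  by rewrite pjac_mulmx -/H mulmxBr mulmx1 HEr subrr.
pose c := (8 * (n%:R + 1) * K)^-1.
have c0 : 0 < c by rewrite invr_gt0 !mulr_gt0 // ltr_wpDl.
(* [Psi] is 2-Lipschitz, so half of the constant of [PL_flat] is required of [gP] before
   composition. *)
have c20 : 0 < c / 2 by rewrite divr_gt0.
have [r1 r10 [_ lgP]] := C1_lipschitz_row oU U0 CgP gPJ c20.
have [r2 r2_0 Hr2] := near_ball (filterI mF PL).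
(* Points of norm below 2 s must lie in the domain of [Psi], whose values there have norm below 4 s
   and must lie where the estimates on [gP] and F hold. *)
have [s [s0 sr s1 s2]] : exists s, [/\ 0 < s, 2 * s <= r / 2, 4 * s <= r1 & 4 * s <= r2].
  exists (Num.min (r / 4) (Num.min (r1 / 4) (r2 / 4))).
  rewrite !lt_min !divr_gt0 //.
  have : Num.min (r / 4) (Num.min (r1 / 4) (r2 / 4)) <= r / 4.
    by rewrite ge_min lexx.
  have : Num.min (r / 4) (Num.min (r1 / 4) (r2 / 4)) <= r1 / 4.
    by rewrite !ge_min lexx !orbT.
  have : Num.min (r / 4) (Num.min (r1 / 4) (r2 / 4)) <= r2 / 4.
    by rewrite !ge_min lexx !orbT.
  by move: (Num.min _ _) => s h1 h2 h3; split => //; lra.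
have sr' : s <= r / 2 by move: s0 sr; lra.
(* The parametrization of Z by the head of w. It is defined on all n coordinates and ignores the
   tail, which avoids passing to vectors of length d. *)
pose E0 (w : 'rV[R]_n) := Psi (w *m P).
have bP (w : 'rV[R]_n) : ball 0 (2 * s) w -> ball 0 (r / 2) (w *m P).
  move=> /ball_normP; rewrite subr0 => h; apply/ball_normP; rewrite subr0.
  exact: le_lt_trans (nP w) (lt_le_trans h sr).
have nE0 (w : 'rV[R]_n) : ball 0 (2 * s) w -> `|E0 w| < 4 * s.
  move=> bw; apply: le_lt_trans (nPsi _ (bP _ bw)) _.
  move: bw => /ball_normP; rewrite subr0 => bw.
  by have := nP w; move: bw; move: (`|w|) (`|w *m P|) => u v; lra.
have E0ball (w : 'rV[R]_n) q : 4 * s <= q -> ball 0 (2 * s) w -> ball 0 q (E0 w).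
  by move=> sq bw; apply/ball_normP; rewrite subr0 (lt_le_trans (nE0 w bw)).
have E0P (w : 'rV[R]_n) : ball 0 (2 * s) w -> E0 w *m P = w *m P.
  by move=> bw; have [_ e1] := PsiK _ (bP _ bw); rewrite -PhiP e1 -mulmxA PP.
have gE0 (w : 'rV[R]_n) : ball 0 (2 * s) w -> grad F (E0 w) = gP (E0 w).
  move=> bw; have [_ e1] := PsiK _ (bP _ bw).
  rewrite -[LHS]splitE (_ : grad F (E0 w) *m E = 0) ?addr0 //.
  by apply/PhiE; rewrite e1 -mulmxA PE mulmx0.
have dE0 (w : 'rV[R]_n) : ball 0 (2 * s) w -> differentiable E0 w.
  move=> bw; apply: (@differentiable_comp _ _ _ _ (fun y => y *m P) Psi).
    exact: differentiable_mulmx.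
  by have [] := ID _ (bP _ bw).
have dFE0 (w : 'rV[R]_n) : ball 0 (2 * s) w -> differentiable F (E0 w).
  by move=> bw; apply/dF/rU; have [] := PsiK _ (bP _ bw).
have b02s : ball (0 : 'rV[R]_n) (2 * s) 0 by apply: ballxx; rewrite mulr_gt0.
have ss2 (w : 'rV[R]_n) : ball 0 s w -> ball 0 (2 * s) w.
  by apply: le_ball; move: s0; lra.
have flat : forall w : 'rV[R]_n, ball 0 s w -> (F \o E0) w = F 0.
  apply: (@PL_flat R n (F \o E0) (gP \o E0) s K (F 0) s0 K0).
  - by move=> w bw; apply: differentiable_comp; [exact: dE0|exact: dFE0].
  - move=> w u bw; rewrite derive_comp_rV //; [|exact: dE0|exact: dFE0].
    (* On Z the gradient equals its head, so only the head of the derivative of [E0] matters, and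
       that is the head of u because [E0] preserves heads. *)
    transitivity (('D_u E0 w *m (grad F (E0 w))^T) 0 0).
      rewrite mxE; apply: eq_bigr => i _.
      by rewrite !mxE derive_row //; exact: dE0.
    have -> : grad F (E0 w) = gP (E0 w) *m P by rewrite gE0 // -mulmxA PP.
    have DP : 'D_u E0 w *m P = u *m P.
      transitivity ('D_u (fun y => E0 y *m P) w).
        apply: esym; apply: etrans (deriveE u _) _.
          apply: (@differentiable_comp _ _ _ _ E0 (fun y => y *m P)); first exact: dE0.
          exact: differentiable_mulmx.
        apply: etrans (congr1 (fun l : 'rV[R]_n -> 'rV[R]_n => l u)
          (@diff_comp _ _ _ _ E0 (fun y => y *m P) w (dE0 w bw) (differentiable_mulmx P (E0 w)))) _.
        rewrite /= -(deriveE _ (differentiable_mulmx P (E0 w))) derive_mulmx.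
        by rewrite (deriveE u (dE0 w bw)).
      rewrite -(derive_mulmx P w u); apply: near_eq_derive.
      exact: (near_eq_open (oB (2 * s)) E0P bw).
    by rewrite trmx_mul PT mulmxA DP -mulmxA -{1}PT -trmx_mul -mulmxA PP mxE;
      apply: eq_bigr => i _; rewrite mxE.
  - by move=> w bw; have [] := Hr2 _ (E0ball _ _ s2 bw).
  - move=> w w' bw bw' /=.
    apply: le_trans (lgP _ _ (E0ball _ _ s1 bw) (E0ball _ _ s1 bw')) _.
    apply: le_trans (_ : c / 2 * (2 * `|w' *m P - w *m P|) <= _).
      by rewrite ler_pM2l //; exact: (lPsi _ _ (bP _ bw) (bP _ bw')).
    rewrite mulrA divfK // ler_pM2l // -mulmxBl; exact: nP.
  - by rewrite /= /E0 mul0mx Psi0 /gP g0 mul0mx.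
  - move=> w /ss2 bw; have [_] := Hr2 _ (E0ball _ _ s2 bw).
    by rewrite /= gE0.
(* The domain is cut down so that [Phi] lands in the ball where flatness is known; its points then
   have norm below 2 s, where F is at least F 0. *)
pose W1 := ball (0 : 'rV[R]_n) s.
pose V1 := ball (0 : 'rV[R]_n) r `&` Phi @^-1` W1.
have W1r (y : 'rV[R]_n) : W1 y -> ball 0 (r / 2) y by exact: le_ball.
have V1K x : V1 x -> Psi (Phi x) = x by move=> [bx /W1r]; exact: PhiK.
have oV1 : open V1.
  rewrite openE => x [bx Wx]; apply: filterI.
    by apply: open_nbhs_nbhs; split.
  apply: (differentiable_continuous (dPhi x bx)).
  by apply: open_nbhs_nbhs; split=> //; exact: oB.
have V1n x : V1 x -> ball 0 r2 x.
  move=> V1x; have [bx Wx] := V1x; apply/ball_normP; rewrite subr0 -(V1K x V1x).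
  apply: le_lt_trans (nPsi _ (W1r _ Wx)) _.
  by move: Wx => /ball_normP; rewrite subr0; move: s0 s2; move: (`|_|) => u; lra.
exists V1, W1, Phi, Psi; split.
- split=> //; last exact: oB.
    by split=> //; rewrite /= Phi0; exact: ballxx.
  by move=> x [/rU].
- by move=> x V1x; split; [case: V1x|exact: V1K].
- by move=> y Wy; have [b1 e1] := PsiK _ (W1r _ Wy); split=> //; split=> //=; rewrite e1.
- have W1ID y : W1 y -> _ := fun Wy => ID y (W1r y Wy).
  split.
  + by apply: Ck_sub CPhi => x [/rU].
  + apply: (Ck_inverse (oB r) (oB s) _ _ W1ID).
      by move=> y /W1r /PsiK[].
    by apply: Ck_sub CPhi => x /rU.
  + move=> oF.
    have oPhi x j : ball 0 r x -> omega_at (fun z => Phi z 0 j) x.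
      move=> /rU Ux.
      have -> : (fun z => Phi z 0 j) = (fun z => \sum_i (z 0 i * (P *m invmx A) i j)
          + \sum_i (partial i F z * (E *m invmx A) i j)).
        apply/funext => z; rewrite mxE [X in X + _]mxE [X in _ + X]mxE.
        by congr (_ + _); apply: eq_bigr => i _; rewrite mxE.
      apply: omega_add; apply: omega_sum => i; apply: omega_mul;
        [exact: omega_coord|exact: omega_cst| |exact: omega_cst].
      exact/omega_partial/oF.
    split=> [x j [bx _]|y j Wy]; first exact: oPhi.
    apply: (omega_inverse (Phi := Phi)).
      by move=> i; apply: oPhi; have [] := PsiK _ (W1r _ Wy).
    have := open_nbhs_nbhs (conj (oB s) Wy : open_nbhs y W1).
    by apply: filterS => z /W1ID.
(* If the tail of [Phi] x vanishes, then x is its own image under the parametrization, and flatness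
   gives F x = F 0, the minimal value throughout [V1]. Conversely, a local minimum is critical, so
   the tail of its gradient vanishes. *)
- move=> x V1x; have [bx Wx] := V1x; split=> [/tailP PE0|[mx _]].
    have xE : E0 (Phi x) = x.
      by rewrite /E0 -[RHS](V1K x V1x) -[in RHS](splitE (Phi x)) PE0 addr0.
    have Fx : F x = F 0 by have := flat _ Wx; rewrite /= xE.
    split=> //; rewrite /local_min Fx.
    have := open_nbhs_nbhs (conj oV1 V1x : open_nbhs x V1).
    by apply: filterS => y /V1n/Hr2[].
  apply/tailP/PhiE; rewrite (local_min_grad oU _ dF mx) ?mul0mx //.
  exact: rU.
Qed.

(** * Regularity classes and affine changes of coordinates *)

Lemma analytic_omegaP (R : realType) (n m : nat) (f : 'rV[R]_n -> 'rV[R]_m)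
    (a : 'rV[R]_n) : analytic_at f a <-> forall j, omega_at (fun x => f x 0 j) a.
Proof.
split=> [af j|H]; first exact/analytic_omegaR/analytic_coord.
by apply: analytic_row => j; exact: omega_analyticR.
Qed.

Lemma of_class_sub (R : realType) (n m : nat) (r : regularity) (U U' : set 'rV[R]_n)
    (f : 'rV[R]_n -> 'rV[R]_m) : U' `<=` U -> of_class r U f -> of_class r U' f.
Proof.
move=> sU; case: r => [k|H k|H a /sU] /=; first exact: Ck_sub.
  exact: Ck_sub (H k).
exact: H.
Qed.

Lemma of_class_comp (R : realType) (n m p : nat) (r : regularity)
    (U : set 'rV[R]_n) (U' : set 'rV[R]_m)
    (f : 'rV[R]_n -> 'rV[R]_m) (g : 'rV[R]_m -> 'rV[R]_p) :
  open U -> open U' -> (forall x, U x -> U' (f x)) ->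
  of_class r U f -> of_class r U' g -> of_class r U (g \o f).
Proof.
move=> oU oU' UU'; case: r => [k|hf hg k|hf hg a Ua] /=.
- by move=> hf hg; exact: (Ck_comp_row oU oU' hf hg UU').
- exact: (Ck_comp_row oU oU' (hf k) (hg k) UU').
apply/analytic_omegaP => j.
have /analytic_omegaP/(_ j) og := hg _ (UU' _ Ua).
have /analytic_omegaP of_ := hf _ Ua.
exact: (omega_comp of_ og).
Qed.

Lemma of_class_affine (R : realType) (n m : nat) (r : regularity)
    (U : set 'rV[R]_n) (b : 'rV[R]_m) (B : 'M[R]_(n, m)) : open U ->
  of_class r U (fun y => b + y *m B).
Proof.
move=> oU.
have C k : Ck_on k U (fun y : 'rV[R]_n => b + y *m B).
  exact: (Ck_add oU (Ck_cst k U b) (Ck_mulmx k B oU)).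
case: r => [k|k|a Ua]; [exact: C..|].
apply/analytic_omegaP => j.
have -> : (fun y : 'rV[R]_n => (b + y *m B) 0 j) = (fun y => b 0 j + \sum_i y 0 i * B i j).
  by apply/funext => y; rewrite !mxE.
apply: omega_add; first exact: omega_cst.
by apply: omega_sum => i; apply: omega_mul; [exact: omega_coord|exact: omega_cst].
Qed.

Lemma local_min_comp (R : realType) (S T : topologicalType) (F : T -> R) (s : S -> T) z :
  {for z, continuous s} -> local_min F (s z) -> local_min (F \o s) z.
Proof. by move=> cs mF; exact: (cs _ mF). Qed.

Lemma sum_sqr_mulmx_le (R : realType) (n : nat) (Q : 'M[R]_n) (u : 'rV[R]_n) :
  \sum_i (u *m Q) 0 i ^+ 2 <= n%:R * (n%:R * `|Q|) ^+ 2 * \sum_i u 0 i ^+ 2.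
Proof.
apply: le_trans (_ : n%:R * (n%:R * `|Q|) ^+ 2 * `|u| ^+ 2 <= _); last first.
  by rewrite ler_wpM2l ?norm_sqr_le_sum // mulr_ge0 // sqr_ge0.
apply: le_trans (_ : \sum_(i < n) (n%:R * `|Q| * `|u|) ^+ 2 <= _).
  apply: ler_sum => i _; rewrite -[(u *m Q) 0 i ^+ 2]real_normK ?num_real //.
  rewrite lerXn2r // ?nnegrE ?mulr_ge0 //.
  exact: le_trans (coord_le_norm _ _ _) (mulmx_norm_le _ _).
by rewrite sumr_const card_ord -[leLHS]mulr_natl exprMn mulrA.
Qed.

(** In the coordinates x = a + z L^-1 the Hessian L E M becomes E M L^-T. Only the left factor has
    to be removed: the right one remains some invertible matrix, and symmetry does the rest. *)
Lemma level_set_chart (R : realType) (n k : nat) (U : set 'rV[R]_n)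
    (F : 'rV[R]_n -> R) (a : 'rV[R]_n) (K : R) :
  open U -> U a -> Ck_on k.+2 U F -> 0 < K -> local_min F a ->
  (\forall x \near a, F x - F a <= K * \sum_i grad F x 0 i ^+ 2) ->
  exists2 d, (d <= n)%N & exists (V W : set 'rV[R]_n) (Phi Psi : 'rV[R]_n -> 'rV[R]_n),
    [/\ [/\ open V, V a, V `<=` U & open W],
        forall x, V x -> W (Phi x) /\ Psi (Phi x) = x,
        forall y, W y -> V (Psi y) /\ Phi (Psi y) = y,
        (of_class (Cr k.+1) V Phi /\ of_class (Cr k.+1) W Psi) /\
          ((forall x, U x -> omega_at F x) ->
          of_class Comega V Phi /\ of_class Comega W Psi) &
        forall x, V x -> ((forall i : 'I_n, (d <= i)%N -> Phi x 0 i = 0) <->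
           (local_min F x /\ F x = F a))].
Proof.
move=> oU Ua CF K0 mF PL.
have [d [dn [L [M [Lu Mu HE]]]]] := tail_decomposition (pjac (grad F) a).
exists d => //.
pose B := invmx L.
pose S (z : 'rV[R]_n) := a + z *m B.
pose T (x : 'rV[R]_n) := - (a *m L) + x *m L.
have ST x : S (T x) = x.
  by rewrite /S /T mulmxDl mulNmx !mulmxK // addrA subrr add0r.
have TS z : T (S z) = z by rewrite /S /T mulmxDl mulmxKV // addKr.
have S0 : S 0 = a by rewrite /S mul0mx addr0.
have Ta : T a = 0 by rewrite -S0 TS.
have clsS r (X : set 'rV[R]_n) : open X -> of_class r X S by exact: of_class_affine.
have clsT r (X : set 'rV[R]_n) : open X -> of_class r X T by exact: of_class_affine.
have dS z : differentiable S z := (clsS (Cr 1) setT openT).1 z I.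
have dT z : differentiable T z := (clsT (Cr 1) setT openT).1 z I.
have cS z : {for z, continuous S} by exact: differentiable_continuous.
have cT z : {for z, continuous T} by exact: differentiable_continuous.
pose Us := S @^-1` U.
have oUs : open Us by apply: open_comp => // z _; exact: cS.
have Us0 : Us 0 by rewrite /Us /= S0.
pose Fs := F \o S.
have CFs : Ck_on k.+2 Us Fs.
  exact: (Ck_comp oUs (clsS (Cr k.+2) Us oUs) CF).
have Fs0 : Fs 0 = F a by rewrite /Fs /= S0.
have mFs : local_min Fs 0 by apply: local_min_comp => //; rewrite S0.
have gFs z : Us z -> grad Fs z = grad F (S z) *m B^T.
  by move=> Usz; apply: (@grad_affine _ _ F a z B); exact: CF.1.
have BTu : B^T \in unitmx by rewrite unitmx_tr unitmx_inv.
pose Q := invmx B^T.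
(* The old gradient is the new one times [Q], so the PL constant grows by a bound on the squared
   norm of [Q]; adding 1 keeps it positive. *)
pose K' := K * (n%:R * (n%:R * `|Q|) ^+ 2) + 1.
have K'0 : 0 < K' by rewrite ltr_wpDl // mulr_ge0 ?(ltW K0) // mulr_ge0 // sqr_ge0.
have PLs : \forall z \near (0 : 'rV[R]_n), Fs z - Fs 0 <= K' * \sum_i grad Fs z 0 i ^+ 2.
  have Usn : nbhs (0 : 'rV[R]_n) Us by exact: open_nbhs_nbhs.
  have PLn : nbhs (0 : 'rV[R]_n) (S @^-1` [set x | F x - F a <= K * \sum_i grad F x 0 i ^+ 2]).
    by apply: cS; rewrite S0.
  apply: filterS2 Usn PLn => z Usz /= h.
  rewrite Fs0; apply: le_trans h _.
  have gF : grad F (S z) = grad Fs z *m Q by rewrite gFs // mulmxK.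
  have q0 : 0 <= \sum_i grad Fs z 0 i ^+ 2 by apply: sumr_ge0 => i _; exact: sqr_ge0.
  rewrite gF; apply: le_trans (ler_wpM2l (ltW K0) (sum_sqr_mulmx_le Q (grad Fs z))) _.
  by rewrite mulrA ler_wpM2r // lerDl.
have HEs : pjac (grad Fs) 0 = tail_mx R n d *m (M *m B^T).
  have dgF : differentiable (grad F) (S 0).
    by rewrite S0; have Cg := Ck_grad oU CF; exact: Cg.1.
  have dB y : differentiable (fun y : 'rV[R]_n => y *m B^T) y by exact: differentiable_mulmx.
  have E1 : pjac (grad Fs) 0 = pjac ((fun y => y *m B^T) \o (grad F \o S)) 0.
    by apply: pjac_eq; exact: (near_eq_open oUs gFs Us0).
  rewrite E1 pjac_comp //; last exact: differentiable_comp.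
  rewrite pjac_mulmx (pjac_comp (dS 0) dgF) S0 HE.
  have -> : pjac S 0 = B.
    apply: pjac_uniq => // v; rewrite (@deriveD _ _ _ (cst a) (fun y => y *m B)).
    - by rewrite derive_cst add0r derive_mulmx.
    - exact: derivable_cst.
    - exact/diff_derivable/differentiable_mulmx.
  by rewrite !mulmxA mulVmx // mul1mx.
have MBu : M *m B^T \in unitmx by rewrite unitmx_mul Mu.
have [Vs [W [Phis [Psis [[oVs Vs0 VsU oW] PhisK PsisK [CPhis CPsis om] chr]]]]] :=
  slice_normal_form oUs Us0 CFs K'0 mFs PLs MBu HEs.
pose V := T @^-1` Vs.
have oV : open V by apply: open_comp => // z _; exact: cT.
exists V, W, (Phis \o T), (S \o Psis); split.
- split=> //; first by rewrite /V /= Ta.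
  by move=> x /VsU; rewrite /Us /= ST.
- by move=> x /PhisK[Wx e]; split=> //=; rewrite e ST.
- by move=> y /PsisK[Vy e]; rewrite /V /= TS; split.
- split; first split.
  + exact: (@of_class_comp _ _ _ _ (Cr k.+1) V Vs T Phis oV oVs (fun _ h => h) (clsT _ _ oV) CPhis).
  + exact: (@of_class_comp _ _ _ _ (Cr k.+1) W setT Psis S oW openT (fun _ _ => I) CPsis (clsS _ _ openT)).
  move=> oF.
  have [|oPhi oPsi] := om.
    move=> z Usz; apply: (@omega_comp _ _ _ S F) => [j|]; last exact: oF.
    by have /analytic_omegaP := clsS Comega setT openT z I; apply.
  split.
  + apply: (@of_class_comp _ _ _ _ Comega V Vs T Phis oV oVs (fun _ h => h) (clsT _ _ oV)).
    by move=> z Vz; apply/analytic_omegaP => j; exact: oPhi.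
  + apply: (@of_class_comp _ _ _ _ Comega W setT Psis S oW openT (fun _ _ => I) _ (clsS _ _ openT)).
    by move=> z Wz; apply/analytic_omegaP => j; exact: oPsi.
move=> x Vx; apply: iff_trans (chr (T x) Vx) _.
rewrite Fs0 /Fs /= ST; split=> -[h1 h2]; split=> //; last first.
  by apply: local_min_comp => //; rewrite ST.
have -> : F = Fs \o T by apply/funext => y; rewrite /Fs /= ST.
exact: local_min_comp.
Qed.

(** * Transfer to the manifold *)

Lemma chart_image_open (R : realType) (n : nat) (M : topologicalType)
    (c : chart R n M) (X : set M) : open X -> X `<=` cdom c -> open (c @` X).
Proof.
move=> oX Xc; rewrite openE => _ [x Xx <-].
have cx : ccod c (c x) by exists x => //; exact: Xc.
have C : nbhs (c x) (ccod c).
  by apply: open_nbhs_nbhs; split=> //; exact: chart_open_cod.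
have I : nbhs (c x) (cinv c @^-1` X).
  apply: (chart_inv_continuous cx); rewrite chart_cancel //; last exact: Xc.
  by apply: open_nbhs_nbhs; split.
apply: (@filterS _ (nbhs (c x)) (nbhs_filter _) _ _ _ (filterI C I)) => y [[z cz <-]] /=.
by rewrite chart_cancel // => Xz; exists z.
Qed.

Lemma cmapK (R : realType) (n : nat) (M : topologicalType) (c : chart R n M) y :
  ccod c y -> cdom c (cinv c y) /\ c (cinv c y) = y.
Proof. by move=> [x cx <-]; rewrite chart_cancel. Qed.

Lemma chart_preimage_open (R : realType) (n : nat) (M : topologicalType)
    (c : chart R n M) (V : set 'rV[R]_n) : open V ->
  open (cdom c `&` c @^-1` V).
Proof.
move=> oV; rewrite openE => x [cx Vx].
have C : nbhs x (cdom c).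
  by apply: open_nbhs_nbhs; split=> //; exact: chart_open_dom.
have I : nbhs x (c @^-1` V).
  by apply: (chart_continuous cx); apply: open_nbhs_nbhs; split.
exact: (filterI C I).
Qed.

Lemma refine_chart (R : realType) (n : nat) (M : topologicalType)
    (c : chart R n M) (V W : set 'rV[R]_n) (Phi Psi : 'rV[R]_n -> 'rV[R]_n) :
  open V -> open W -> V `<=` ccod c ->
  (forall x, V x -> W (Phi x) /\ Psi (Phi x) = x) ->
  (forall y, W y -> V (Psi y) /\ Phi (Psi y) = y) ->
  (forall x, V x -> {for x, continuous Phi}) ->
  (forall y, W y -> {for y, continuous Psi}) ->
  exists c' : chart R n M, [/\ cdom c' = cdom c `&` c @^-1` V,
    cmap c' = Phi \o c, cinv c' = cinv c \o Psi & ccod c' = W].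
Proof.
move=> oV oW Vc PhiK PsiK cPhi cPsi.
have imE : (Phi \o c) @` (cdom c `&` c @^-1` V) = W.
  apply/seteqP; split=> [_ [x [cx /PhiK[? _]] <-]//|y Wy].
  have [Vy e] := PsiK y Wy; have [d1 e1] := cmapK (Vc _ Vy).
  by exists (cinv c (Psi y)) => /=; rewrite e1.
have @c' : chart R n M.
  apply: (@Chart R n M (cdom c `&` c @^-1` V) (Phi \o c) (cinv c \o Psi)).
  - exact: chart_preimage_open.
  - by rewrite imE.
  - by move=> x [cx Vx] /=; have [_ ->] := PhiK _ Vx; exact: chart_cancel.
  - move=> x [cx Vx]; apply: continuous_comp; first exact: chart_continuous.
    exact: cPhi.
  - move=> y; rewrite imE => Wy; apply: continuous_comp; first exact: cPsi.
    by apply: chart_inv_continuous; apply: Vc; have [] := PsiK y Wy.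
by exists c'.
Qed.

(** Both transition maps are those of c composed with [Phi] or [Psi], so compatibility in class r is
    inherited even when [Phi] is only of class r. *)
Lemma refine_compatible (R : realType) (n : nat) (M : topologicalType)
    (r : regularity) (a c c' : chart R n M) (V W : set 'rV[R]_n)
    (Phi Psi : 'rV[R]_n -> 'rV[R]_n) :
  open V -> open W ->
  (forall x, V x -> W (Phi x) /\ Psi (Phi x) = x) ->
  cdom c' = cdom c `&` c @^-1` V -> cmap c' = Phi \o c ->
  cinv c' = cinv c \o Psi ->
  of_class r V Phi -> of_class r W Psi -> compatible r a c -> compatible r a c'.
Proof.
move=> oV oW PhiK dE mE iE rPhi rPsi [r1 r2].
have oI : open (cdom a `&` cdom c').
  by apply: openI; exact: chart_open_dom.
have oI' : open (cdom a `&` cdom c).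
  by apply: openI; exact: chart_open_dom.
have oA : open (a @` (cdom a `&` cdom c')).
  exact: (chart_image_open oI (@subIsetl _ _ _)).
have oC : open (c' @` (cdom a `&` cdom c')).
  exact: (chart_image_open oI (@subIsetr _ _ _)).
have oC0 : open (c @` (cdom a `&` cdom c)).
  exact: (chart_image_open oI' (@subIsetr _ _ _)).
split.
  have -> : c' \o cinv a = Phi \o (c \o cinv a) by rewrite mE.
  apply: (@of_class_comp _ _ _ _ r _ V (c \o cinv a) Phi oA oV) => //.
    by move=> y [x [ax]]; rewrite dE => -[cx Vx] <- /=; rewrite chart_cancel.
  apply: of_class_sub r1 => y [x [ax]]; rewrite dE => -[cx Vx] <-.
  by exists x.
have -> : a \o cinv c' = (a \o cinv c) \o Psi by rewrite iE.
apply: (@of_class_comp _ _ _ _ r _ _ Psi (a \o cinv c) oC oC0 _ _ r2).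
  move=> y [x [ax]]; rewrite dE => -[cx Vx] <-; rewrite mE /=.
  by have [_ ->] := PhiK _ Vx; exists x.
apply: of_class_sub rPsi => y [x [ax]]; rewrite dE => -[cx Vx] <-.
by rewrite mE /=; have [] := PhiK _ Vx.
Qed.

Lemma near_compatible (R : realType) (n : nat) (M : topologicalType)
    (a b : chart R n M) x : cdom a x -> cdom b x ->
  \forall y \near a x, cdom b (cinv a y) /\ ccod a y.
Proof.
move=> ax bx; have ca : ccod a (a x) by exists x.
have C : nbhs (a x) (ccod a).
  by apply: open_nbhs_nbhs; split=> //; exact: chart_open_cod.
have I : nbhs (a x) (cinv a @^-1` cdom b).
  apply: (chart_inv_continuous ca); rewrite chart_cancel //.
  by apply: open_nbhs_nbhs; split=> //; exact: chart_open_dom.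
exact: (filterI I C).
Qed.

Lemma transition_differentiable (R : realType) (n : nat) (M : smoothManifold R n)
    (a b : chart R n M) x : atlas M a -> atlas M b -> cdom a x -> cdom b x ->
  differentiable (b \o cinv a) (a x).
Proof.
move=> Aa Ab ax bx; have [/(_ 1%N)[+ _] _] := atlas_compatible Aa Ab.
by apply; exists x.
Qed.

Lemma transitionK (R : realType) (n : nat) (M : smoothManifold R n)
    (a b : chart R n M) x (u : 'rV[R]_n) :
  atlas M a -> atlas M b -> cdom a x -> cdom b x ->
  'd (a \o cinv b) (b x) ('d (b \o cinv a) (a x) u) = u.
Proof.
move=> Aa Ab ax bx.
have d1 := transition_differentiable Aa Ab ax bx.
have bxE : (b \o cinv a) (a x) = b x by rewrite /= chart_cancel.
have d2 : differentiable (a \o cinv b) ((b \o cinv a) (a x)).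
  by rewrite bxE; exact: transition_differentiable.
have := diff_comp d1 d2 => /(congr1 (fun k : 'rV[R]_n -> 'rV[R]_n => k u)) /=.
rewrite chart_cancel // => <-.
have E : \forall y \near a x, id y = ((a \o cinv b) \o (b \o cinv a)) y.
  apply: (@filterS _ (nbhs (a x)) (nbhs_filter _) _ _ _ (near_compatible ax bx)) => y [by_ ca] /=.
  by rewrite chart_cancel //; have [_ ->] := cmapK ca.
rewrite -(near_eq_diff E) //.
by rewrite -deriveE // derive_id.
Qed.

(** The differential is defined through the preferred chart; the chain rule across the transition
    map expresses it in any chart of the atlas. *)
Lemma differential_of_coord (R : realType) (n : nat) (M : smoothManifold R n)
    (f : M -> R) (c : chart R n M) x (u : 'rV[R]_n) :
  atlas M c -> cdom c x -> function_of_class (Cr 1) f ->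
  differential f (of_coord c x u) = 'D_u (f \o cinv c) (c x).
Proof.
move=> Ac cx hf.
have Ab := chart_at_atlas x; have bx := chart_at_dom x.
set b := chart_at x in Ab bx *.
have d1 := transition_differentiable Ac Ab cx bx.
have bxE : (b \o cinv c) (c x) = b x by rewrite /= chart_cancel.
have d2 : differentiable (f \o cinv b) ((b \o cinv c) (c x)).
  by rewrite bxE; have [+ _] := hf b Ab; apply; exists x.
have dc : differentiable (f \o cinv c) (c x).
  by have [+ _] := hf c Ac; apply; exists x.
have E : \forall y \near c x, (f \o cinv c) y = ((f \o cinv b) \o (b \o cinv c)) y.
  apply: (@filterS _ (nbhs (c x)) (nbhs_filter _) _ _ _ (near_compatible cx bx)) => y [by_ cy] /=.
  by rewrite chart_cancel.
have := diff_comp d1 d2 => /(congr1 (fun k : 'rV[R]_n -> R => k u)) /=.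
rewrite chart_cancel // /differential /of_coord => <-.
by rewrite -(near_eq_diff E) // deriveE.
Qed.

(** * The metric and the PL inequality in a chart *)

(** Written exactly as in [gram_smooth], which then applies to it by conversion. *)
Definition chart_gram (R : realType) (n : nat) (M : smoothManifold R n)
    (g : riemannianMetric M) (c : chart R n M) (y : 'rV[R]_n) : 'M[R]_n :=
  \matrix_(i < n, j < n)
        gram_inner (gram g (cinv c y))
          (of_coord c (cinv c y) (delta_mx 0 i))
          (of_coord c (cinv c y) (delta_mx 0 j)).

Lemma gram_inner_mulmx (R : realType) (n : nat) (G J : 'M[R]_n) (u v : 'rV[R]_n) :
  gram_inner G (u *m J) (v *m J) = gram_inner (J *m G *m J^T) u v.
Proof. by rewrite /gram_inner trmx_mul !mulmxA. Qed.

Lemma gram_inner_delta (R : realType) (n : nat) (G : 'M[R]_n) i j :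
  gram_inner G (delta_mx 0 i) (delta_mx 0 j) = G i j.
Proof. by rewrite /gram_inner -rowE trmx_delta -colE !mxE. Qed.

Lemma chart_gramE (R : realType) (n : nat) (M : smoothManifold R n)
    (g : riemannianMetric M) (c : chart R n M) y (u v : 'rV[R]_n) :
  gram_inner (chart_gram g c y) u v =
  inner g (of_coord c (cinv c y) u) (of_coord c (cinv c y) v).
Proof.
set x := cinv c y.
pose J : 'M[R]_n := lin1_mx ('d (chart_at x \o cinv c) (c x)).
have JE w : of_coord c x w = w *m J by rewrite /J mul_rV_lin1.
have -> : chart_gram g c y = J *m gram g x *m J^T.
  apply/matrixP => i j; rewrite mxE !JE gram_inner_mulmx.
  exact: gram_inner_delta.
by rewrite -gram_inner_mulmx -!JE.
Qed.

Lemma inner_ge0 (R : realType) (n : nat) (M : smoothManifold R n)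
    (g : riemannianMetric M) (x : M) (v : tangent x) : 0 <= inner g v v.
Proof.
have [v0|/(@gram_posdef _ _ _ g x)/ltW //] := eqVneq (v : 'rV[R]_n) 0.
by rewrite /inner /gram_inner v0 !mul0mx mxE.
Qed.

(** A kernel vector represents a tangent vector of zero length, hence the zero vector, and the
    change of chart is injective on tangent vectors. *)
Lemma chart_gram_unit (R : realType) (n : nat) (M : smoothManifold R n)
    (g : riemannianMetric M) (c : chart R n M) y : atlas M c -> ccod c y ->
  chart_gram g c y \in unitmx.
Proof.
move=> Ac cy; have [cx cxy] := cmapK cy; set x := cinv c y in cx cxy.
have Ab := chart_at_atlas x; have bx := chart_at_dom x.
rewrite -row_free_unit -kermx_eq0; apply/eqP/row_matrixP => i; rewrite row0.
set v := row i _.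
have vG : v *m chart_gram g c y = 0 by rewrite -row_mul mulmx_ker row0.
have : inner g (of_coord c x v) (of_coord c x v) = 0.
  by rewrite -chart_gramE /gram_inner vG mul0mx mxE.
have [Jv0 _|/(@gram_posdef _ _ _ g x)] := eqVneq (of_coord c x v : 'rV[R]_n) 0; last first.
  by move=> h e; move: h; rewrite /inner in e; rewrite e ltxx.
have E : 'd (chart_at x \o cinv c) (c x) v = 0 := Jv0.
apply: etrans (esym (transitionK v Ac Ab cx bx)) _.
exact: etrans (congr1 _ E) (linear0 _).
Qed.

(** The coordinates u of the gradient in c satisfy u G = D with G the Gram matrix, so the squared
    norm u G u^T is the dual quadratic form of D. *)
Lemma tnorm_gradient_chart (R : realType) (n : nat) (M : smoothManifold R n)
    (g : riemannianMetric M) (f : M -> R) (c : chart R n M) y :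
  atlas M c -> ccod c y -> function_of_class (Cr 1) f ->
  let D := grad (f \o cinv c) y in
  tnorm g (gradient g f (cinv c y)) ^+ 2 =
  \sum_i D 0 i * (D *m invmx (chart_gram g c y)) 0 i.
Proof.
move=> Ac cy hf D; have [cx cxy] := cmapK cy; set x := cinv c y in cx cxy *.
have Ab := chart_at_atlas x; have bx := chart_at_dom x.
set w := gradient g f x.
pose u : 'rV[R]_n := 'd (c \o cinv (chart_at x)) (chart_at x x) w.
have Ju : of_coord c x u = w by exact: transitionK.
have Gu := chart_gram_unit g Ac cy.
have DE v : gram_inner (chart_gram g c y) u v = \sum_i D 0 i * v 0 i.
  rewrite chart_gramE -/x Ju gradientP differential_of_coord // cxy derive_grad; last first.
    by have [+ _] := hf c Ac; apply.
  by apply: eq_bigr => i _; rewrite mulrC.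
have uG : u *m chart_gram g c y = D.
  apply/rowP => j.
  have := DE (delta_mx 0 j).
  rewrite (bigD1 j) //= big1 ?addr0 => [|i ij]; last by rewrite [delta_mx _ _ _ _]mxE (negPf ij) andbF mulr0.
  rewrite [delta_mx _ _ _ _]mxE !eqxx mulr1 => <-.
  by rewrite /gram_inner trmx_delta -colE [RHS]mxE.
rewrite /tnorm sqr_sqrtr ?inner_ge0 // -Ju -chart_gramE DE.
by rewrite -uG mulmxK.
Qed.

Lemma quadratic_form_le (R : realType) (n : nat) (D : 'rV[R]_n) (X : 'M[R]_n) (C : R) :
  0 <= C -> (forall i j, `|X i j| <= C) ->
  \sum_i D 0 i * (D *m X) 0 i <= n%:R * (n%:R * C) * \sum_i D 0 i ^+ 2.
Proof.
move=> C0 XC; apply: le_trans (_ : \sum_(i < n) (n%:R * C) * `|D| ^+ 2 <= _); last first.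
  rewrite sumr_const card_ord -[leLHS]mulr_natl -[leRHS]mulrA ler_wpM2l //.
  by rewrite ler_wpM2l ?mulr_ge0 // norm_sqr_le_sum.
apply: ler_sum => i _; apply: le_trans (ler_norm _) _; rewrite normrM.
apply: le_trans (_ : `|D| * (n%:R * C * `|D|) <= _); last first.
  by rewrite le_eqVlt; apply/orP; left; apply/eqP; ring.
apply: ler_pM => //; first exact: coord_le_norm.
rewrite mxE; apply: le_trans (ler_norm_sum _ _ _) _.
apply: le_trans (_ : \sum_(k < n) `|D| * C <= _); last first.
  by rewrite sumr_const card_ord -[leLHS]mulr_natl le_eqVlt; apply/orP; left; apply/eqP; ring.
by apply: ler_sum => k _; rewrite normrM ler_pM // coord_le_norm.
Qed.

Lemma near_cinv (R : realType) (n : nat) (M : topologicalType)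
    (c : chart R n M) x (P : set M) : cdom c x ->
  (\forall z \near x, P z) -> \forall y \near c x, P (cinv c y).
Proof.
move=> cx Px; have ca : ccod c (c x) by exists x.
by apply: (chart_inv_continuous ca); rewrite chart_cancel.
Qed.

Lemma PL_chart (R : realType) (n : nat) (M : smoothManifold R n)
    (g : riemannianMetric M) (f : M -> R) (c : chart R n M) (xbar : M) :
  atlas M c -> cdom c xbar -> function_of_class (Cr 1) f ->
  PL_around g f xbar ->
  exists2 K : R, 0 < K & \forall y \near c xbar,
    (f \o cinv c) y - f xbar <= K * \sum_i grad (f \o cinv c) y 0 i ^+ 2.
Proof.
move=> Ac cx hf [mu mu0 PL].
have oU : open (ccod c) := @chart_open_cod _ _ _ c.
have Ua : ccod c (c xbar) by exists xbar.
have Un : nbhs (c xbar) (ccod c) by exact: open_nbhs_nbhs.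
have CG : forall y, ccod c y -> {for y, continuous (chart_gram g c)}.
  exact: (gram_smooth g Ac 0%N).
have CGe i j : Ck_on 0 (ccod c) (fun y => chart_gram g c y i j).
  move=> y Uy; exact: (@continuous_comp _ _ _ (chart_gram g c)
    (fun N : 'M[R]_n => N i j) y (CG y Uy) (@coord_continuous _ _ _ i j _)).
have CX i j := Ck_invmx oU CGe (fun y Uy => chart_gram_unit g Ac Uy) i j.
(* The sum bounds every entry of the inverse Gram matrix at the centre, and the extra 1 allows for
   its variation nearby. *)
pose C := \sum_i \sum_j `|invmx (chart_gram g c (c xbar)) i j| + 1.
have C0 : 0 < C.
  by rewrite ltr_wpDl // sumr_ge0 // => i _; rewrite sumr_ge0.
have XC (p : 'I_n * 'I_n) : \forall y \near c xbar, `|invmx (chart_gram g c y) p.1 p.2| <= C.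
  have /cvgrPdist_le/(_ 1 ltr01) := CX p.1 p.2 _ Ua.
  apply: (@filterS _ (nbhs (c xbar)) (nbhs_filter _)) => y h.
  have aux (u v : R) : `|v - u| <= 1 -> `|u| <= `|v| + 1.
    move=> uv; rewrite -[u in `|u|](subKr v); apply: le_trans (ler_normB _ _) _.
    by rewrite lerD2l.
  apply: le_trans (aux _ _ h) _; rewrite lerD2r.
  rewrite (bigD1 p.1) //= (bigD1 p.2) //= -addrA lerDl addr_ge0 //.
    by rewrite sumr_ge0.
  by rewrite sumr_ge0 // => i _; rewrite sumr_ge0.
have {}XC := filter_forall (nbhs_filter _) XC.
have PLn := near_cinv cx PL.
have mu20 : 0 < (2 * mu)^-1 by rewrite invr_gt0 mulr_gt0.
pose K := (2 * mu)^-1 * (n%:R * (n%:R * C)).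
have K0 : 0 <= K by rewrite mulr_ge0 ?(ltW mu20) // !mulr_ge0 // ltW.
have bound y : ccod c y -> (forall p, `|invmx (chart_gram g c y) p.1 p.2| <= C) ->
    (2 * mu)^-1 * tnorm g (gradient g f (cinv c y)) ^+ 2 <=
    (K + 1) * \sum_i grad (f \o cinv c) y 0 i ^+ 2.
  move=> Uy XCy; rewrite (tnorm_gradient_chart g Ac Uy hf).
  move: (grad (f \o cinv c) y) => D.
  have S0 : 0 <= \sum_i D 0 i ^+ 2 by apply: sumr_ge0 => i _; exact: sqr_ge0.
  apply: le_trans (_ : K * \sum_i D 0 i ^+ 2 <= _); last by rewrite ler_wpM2r // lerDl.
  rewrite /K -[leRHS]mulrA ler_pM2l //.
  by apply: quadratic_form_le; [exact: ltW|move=> i j; exact: (XCy (i, j))].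
(* [K] vanishes for n = 0, whereas a positive constant is required. *)
exists (K + 1); first by rewrite ltr_wpDl.
apply: (@filterS _ (nbhs (c xbar)) (nbhs_filter _) _ _ _ (filterI (filterI Un PLn) XC)).
by move=> y [[Uy h] XCy]; exact: le_trans h (bound y Uy XCy).
Qed.

Theorem theorem2p16 (R : realType) (n : nat) (M : smoothManifold R n)
    (g : riemannianMetric M) (p : nat) (f : M -> R) (xbar : M)
    (hp : (2 <= p)%N)
    (hf : function_of_class (Cr p) f)
    (hmin : local_min f xbar)
    (hPL : PL_around g f xbar) :
  submanifold_locally_around (Cr p.-1) (local_minima_at_level f xbar) xbar /\
  (analytic_manifold M -> function_of_class Comega f ->
   submanifold_locally_around Comega (local_minima_at_level f xbar) xbar).
Proof.
(* Now p = k + 2, so the class sought is k + 1, that of the gradient. *)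
case: p hp hf => [|[|k]] // _ hf.
have hf1 : function_of_class (Cr 1) f by move=> c Ac; exact: Ck_le (hf c Ac).
set c := chart_at xbar.
have Ac : atlas M c := chart_at_atlas xbar.
have cx : cdom c xbar := chart_at_dom xbar.
have oU : open (ccod c) := @chart_open_cod _ _ _ c.
have Ua : ccod c (c xbar) by exists xbar.
have xE : cinv c (c xbar) = xbar by rewrite chart_cancel.
pose F := f \o cinv c.
have Fa : F (c xbar) = f xbar by rewrite /F /= xE.
have mF : local_min F (c xbar).
  apply: local_min_comp; first exact: chart_inv_continuous.
  by rewrite xE.
have [K K0 PL] := PL_chart Ac cx hf1 hPL; rewrite -Fa in PL.
have [d dn [V [W [Phi [Psi [[oV Va VU oW] PhiK PsiK [[rPhi rPsi] om] chr]]]]]] :=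
  level_set_chart oU Ua (hf c Ac) K0 mF PL.
have cPhi x : V x -> {for x, continuous Phi} by exact: Ck_continuous rPhi.
have cPsi y : W y -> {for y, continuous Psi} by exact: Ck_continuous rPsi.
have [c' [dE mE iE _]] := refine_chart oV oW VU PhiK PsiK cPhi cPsi.
have main r : of_class r V Phi -> of_class r W Psi ->
    (forall a, atlas M a -> compatible r a c) ->
    submanifold_locally_around r (local_minima_at_level f xbar) xbar.
  move=> rP rQ rc; exists (cdom c').
    by apply: open_nbhs_nbhs; split; [exact: chart_open_dom|rewrite dE].
  exists d => // x [_ c'x]; exists c'; split=> // [a Aa|y c'y].
    exact: (refine_compatible oV oW PhiK dE mE iE rP rQ (rc a Aa)).
  move: (c'y); rewrite dE => -[cy Vy].
  rewrite mE /=; apply: iff_sym; apply: iff_trans (chr (c y) Vy) _.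
  have Fy : F (c y) = f y by rewrite /F /= chart_cancel.
  (* Local minimality is transported by continuity, through [c] in one direction and through
     [cinv c] in the other. *)
  split=> [[h1 h2]|[[h1 h2] _]]; split.
  - split; last by rewrite -Fy -Fa.
    have cyn : nbhs y (cdom c).
      by apply: open_nbhs_nbhs; split=> //; exact: chart_open_dom.
    have h3 : \forall z \near y, F (c y) <= F (c z).
      exact: (local_min_comp (chart_continuous cy) h1).
    apply: (@filterS _ (nbhs y) (nbhs_filter _) _ _ _ (filterI cyn h3)) => z [cz].
    by rewrite Fy /F /= chart_cancel.
  - by split.
  - apply: local_min_comp; last by rewrite chart_cancel.
    by apply: (@chart_inv_continuous _ _ _ c); exists y.
  - by rewrite -[LHS]/(F (c y)) Fy h2 -Fa.
split.
  (* Transition maps of the atlas are C^infinity, hence in particular of class C^(k+1). *)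
  apply: (main _ rPhi rPsi) => a Aa; have [h1 h2] := atlas_compatible Aa Ac.
  by split; [exact: (h1 k.+1)|exact: (h2 k.+1)].
move=> aM aF; have [|rP rQ] := om.
  by move=> y Uy; apply: analytic_omegaR; exact: aF.
by apply: (main _ rP rQ) => a Aa; exact: aM.
Qed.
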